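(* Let $\ell,\mathbf{d}\in\mathbb{C}$ and $\mathbf{c}\in\mathbb{C}^*$. The $\widehat{H}_4$-module $V_{\widehat{H}_4}(\ell,\mathbf{c},\mathbf{d})$ is irreducible if and only if $\ell\neq 0$ and $\mathbf{c}\notin\ell\mathbb{Z}$. Furthermore: (i) If $\ell\neq0$ and $\mathbf{c}+m\ell=0$ for some positive integer $m$, then all the linearly independent singular vectors (other than the highest weight vector $v_{\mathbf{d}}$ itself) are $$u=\Big[\sum_{\lambda\in P(m)}\Big(a_\lambda c(-\lambda)b+\sum_{i=1}^{k_\lambda}b_{\lambda\setminus\lambda_i,\lambda_i}\,c(-\lambda\setminus\lambda_i)b(-\lambda_i)\Big)\Big]^k v_{\mathbf{d}},\qquad k=1,2,3,\dots,$$ where the complex coefficients $a_\lambda$, $b_{\mu,s}$ are a nonzero solution of the following equations, for all $\lambda\in P(m)$: $$a_\lambda q_i\lambda_i\ell-b_{\lambda\setminus\lambda_i,\lambda_i}=0\quad(i=1,\dots,k_\lambda),$$ $$a_\lambda\mathbf{c}+\sum_{i=1}^{k_\lambda}b_{\lambda\setminus\lambda_i,\lambda_i}=0,$$ $$b_{\lambda\setminus\lambda_i,\lambda_i}(\mathbf{c}+\lambda_i\ell)+\sum_{j=1}^{k_\lambda}b_{\lambda\setminus\lambda_i\setminus\lambda_j,\lambda_i+\lambda_j}=0\quad(i=1,\dots,k_\lambda).$$ (ii) If $\ell\neq0$ and $\mathbf{c}-m\ell=0$ for some positive integer $m$, then all the linearly independent singular vectors (other than $v_{\mathbf{d}}$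 itself) are $$u=\Big[\sum_{\lambda\in P(m)}\sum_{i=1}^{k_\lambda}c_{\lambda\setminus\lambda_i,\lambda_i}\,c(-\lambda\setminus\lambda_i)a(-\lambda_i)\Big]^k v_{\mathbf{d}},\qquad k=1,2,3,\dots,$$ where the complex coefficients $c_{\mu,s}$ are a nonzero solution of the following equations, for all $\lambda\in P(m)$: $$q_i\lambda_i\ell\, c_{\lambda\setminus\lambda_j,\lambda_j}+c_{\lambda\setminus\lambda_i\setminus\lambda_j,\lambda_i+\lambda_j}=0\quad(i,j=1,\dots,k_\lambda,\ i\neq j),$$ $$c_{\lambda\setminus\lambda_i,\lambda_i}(-\mathbf{c}+\lambda_i\ell)-\sum_{j=1}^{k_\lambda}c_{\lambda\setminus\lambda_i\setminus\lambda_j,\lambda_i+\lambda_j}=0\quad(i=1,\dots,k_\lambda).$$ (iii) If $\ell=0$, then all the linearly independent singular vectors (other than $v_{\mathbf{d}}$ itself) are $u=c(-\lambda)v_{\mathbf{d}}$, for all (nonempty) partitions $\lambda$. Here, in each of (i)–(iii), ''all the linearly independent singular vectors are ...'' means that the listed vectors are singular and, together with $v_{\mathbf{d}}$, form a basis of the space $\{u\in V_{\widehat{H}_4}(\ell,\mathbf{c},\mathbf{d}): \widehat{H}_4^+u=0\}$.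
   Context: The Nappi-Witten Lie algebra is the 4-dimensional complex Lie algebra $H_4=\mathbb{C}a\oplus\mathbb{C}b\oplus\mathbb{C}c\oplus\mathbb{C}d$ with brackets $[a,b]=c$, $[d,a]=a$, $[d,b]=-b$, $[c,d]=[c,a]=[c,b]=0$, equipped with the symmetric invariant bilinear form given by $(a,b)=1$, $(c,d)=1$ and all other pairings of basis vectors $0$. The affine Nappi-Witten algebra is $\widehat{H}_4=H_4\otimes\mathbb{C}[t,t^{-1}]\oplus\mathbb{C}\mathbf{k}$ with $[h_1\otimes t^m,h_2\otimes t^n]=[h_1,h_2]\otimes t^{m+n}+m(h_1,h_2)\delta_{m+n,0}\mathbf{k}$ and $\mathbf{k}$ central. Write $x(n)=x\otimes t^n$ and $x=x(0)$ for $x\in H_4$. Put $\widehat{H}_4^{(+)}=\bigoplus_{n>0}H_4\otimes t^n$, $\widehat{H}_4^{(\geq 0)}=\widehat{H}_4^{(+)}\oplus H_4\oplus\mathbb{C}\mathbf{k}$, and $\widehat{H}_4^{+}=\mathbb{C}a\oplus\widehat{H}_4^{(+)}$. For $\mathbf{c},\mathbf{d}\in\mathbb{C}$, $M(\mathbf{c},\mathbf{d})$ is the Verma module for $H_4$: $M(\mathbf{c},\mathbf{d})=U(H_4)\otimes_{U(\mathbb{C}a\oplus\mathbb{C}c\oplus\mathbb{C}d)}\mathbb{C}v_{\mathbf{d}}$ with $av_{\mathbf{d}}=0$, $cv_{\mathbf{d}}=\mathbf{c}v_{\mathbf{d}}$, $dv_{\mathbf{d}}=\mathbf{d}v_{\mathbf{d}}$.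 Regard it as an $\widehat{H}_4^{(\geq0)}$-module with $\widehat{H}_4^{(+)}$ acting as $0$ and $\mathbf{k}$ acting as $\ell$; then $V_{\widehat{H}_4}(\ell,\mathbf{c},\mathbf{d})=U(\widehat{H}_4)\otimes_{U(\widehat{H}_4^{(\geq 0)})}M(\mathbf{c},\mathbf{d})$. A singular vector is a nonzero $u$ with $\widehat{H}_4^+u=0$. Partition notation: a partition is a finite weakly decreasing sequence of positive integers; $P(m)$ is the set of partitions of weight (sum of parts) $m$. For $\lambda=(\lambda_1,\dots,\lambda_r)$ a partition (listing all parts), $x(-\lambda)=x(-\lambda_1)\cdots x(-\lambda_r)$, and $x(-\emptyset)=1$. In the formulas of the claim, each $\lambda\in P(m)$ is written in multiplicity form $\lambda=(\lambda_1^{(q_1)},\dots,\lambda_{k_\lambda}^{(q_{k_\lambda})})$, where $\lambda_1,\dots,\lambda_{k_\lambda}$ are the distinct parts of $\lambda$ and $q_i\ge1$ is the multiplicity of $\lambda_i$, so $\sum_i q_i\lambda_i=m$. $\lambda\setminus\lambda_i$ is the partition obtained by removing one copy of the part $\lambda_i$, and $\lambda\setminus\lambda_i\setminus\lambda_j$ is obtained by removing one copy of $\lambda_i$ and then one copy of $\lambda_j$. The coefficients $b_{\mu,s}$ and $c_{\mu,s}$ are indexed by pairs ($\mu$ a possibly empty partition, $s$ a positive integer) with $|\mu|+s=m$; a term indexed by $\lambda\setminus\lambda_i\setminus\lambda_j$ in which the removal is impossible (i.e. $j=i$ and $q_i=1$) is taken to be $0$. *)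

(* Defs.v *)
From HB Require Import structures.
From mathcomp Require Import all_boot all_order all_algebra.
From mathcomp Require Import finmap boolp reals complex monalg ring.

Set Implicit Arguments.
Unset Strict Implicit.
Unset Printing Implicit Defensive.

Import Order.TTheory GRing.Theory Num.Theory.
Local Open Scope ring_scope.
Local Open Scope quotient_scope.

HB.mixin Record isLieAlgebra (K : fieldType) g of GRing.Lmodule K g := {
  lie_br : g -> g -> g;
  lie_br_linearl : forall y, linear (lie_br ^~ y);
  lie_br_linearr : forall x, linear (lie_br x);
  lie_br_alt : forall x, lie_br x x = 0;
  lie_br_jacobi : forall x y z,
    lie_br x (lie_br y z) + lie_br y (lie_br z x) + lie_br z (lie_br x y) = 0
}.

#[short(type="lieType")]
HB.structure Definition LieAlgebra (K : fieldType) :=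
  {g of GRing.Lmodule K g & isLieAlgebra K g}.

Record lieSub (K : fieldType) (g : lieType K) := LieSub {
  lieSub_pred : g -> bool;
  lieSub_submod : submod_closed (lieSub_pred : {pred g});
  lieSub_br : forall x y,
    lieSub_pred x -> lieSub_pred y -> lieSub_pred (lie_br x y)
}.

HB.instance Definition _ (K : fieldType) (g : lieType K) (p : lieSub g) :=
  GRing.isSubmodClosed.Build K g (lieSub_pred p) (lieSub_submod p).

Definition lsub (K : fieldType) (g : lieType K) (p : lieSub g) : Type :=
  {x : g | lieSub_pred p x}.

Section LieSubTheory.
Context (K : fieldType) (g : lieType K) (p : lieSub g).

HB.instance Definition _ := [isSub of lsub p for @sval _ _].
HB.instance Definition _ := [Choice of lsub p by <:].
HB.instance Definition _ := [SubChoice_isSubLmodule of lsub p by <:].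

Definition lsub_br (x y : lsub p) : lsub p :=
  exist _ (lie_br (val x) (val y)) (lieSub_br (valP x) (valP y)).

Fact lsub_br_linearl y : linear (lsub_br ^~ y).
Proof.
move=> k u v; apply: val_inj; rewrite linearP /=.
exact: (lie_br_linearl (val y) k (val u) (val v)).
Qed.

Fact lsub_br_linearr x : linear (lsub_br x).
Proof.
move=> k u v; apply: val_inj; rewrite linearP /=.
exact: (lie_br_linearr (val x) k (val u) (val v)).
Qed.

Fact lsub_br_alt x : lsub_br x x = 0.
Proof. by apply: val_inj; rewrite raddf0 /= lie_br_alt. Qed.

Fact lsub_br_jacobi x y z :
  lsub_br x (lsub_br y z) + lsub_br y (lsub_br z x)
    + lsub_br z (lsub_br x y) = 0.
Proof. by apply: val_inj; rewrite !raddfD raddf0 /= lie_br_jacobi. Qed.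

HB.instance Definition _ := isLieAlgebra.Build K (lsub p)
  lsub_br_linearl lsub_br_linearr lsub_br_alt lsub_br_jacobi.

Lemma val_lsub_br (x y : lsub p) : val (lie_br x y) = lie_br (val x) (val y).
Proof. by []. Qed.

End LieSubTheory.

(** [env g] is the unital associative K-algebra generated by [g], subject to
    the linearity of [x : g |-> x] and to [x y - y x = [x, y]], i.e. the tensor
    algebra of [g] modulo these commutation relations. *)

Section EnvelopingAlgebra.
Context (K : fieldType) (g : lieType K).

Inductive uterm : Type :=
| Uconst of K
| Ugen of g
| Uadd of uterm & uterm
| Umul of uterm & uterm.

Inductive ueq : uterm -> uterm -> Prop :=
| ueq_refl t : ueq t t
| ueq_sym t u : ueq t u -> ueq u t
| ueq_trans t u v : ueq t u -> ueq u v -> ueq t v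
| ueq_add t t' u u' : ueq t t' -> ueq u u' -> ueq (Uadd t u) (Uadd t' u')
| ueq_mul t t' u u' : ueq t t' -> ueq u u' -> ueq (Umul t u) (Umul t' u')
| ueq_addA t u v : ueq (Uadd t (Uadd u v)) (Uadd (Uadd t u) v)
| ueq_addC t u : ueq (Uadd t u) (Uadd u t)
| ueq_add0 t : ueq (Uadd (Uconst 0) t) t
| ueq_addN t : ueq (Uadd (Umul (Uconst (-1)) t) t) (Uconst 0)
| ueq_mulA t u v : ueq (Umul t (Umul u v)) (Umul (Umul t u) v)
| ueq_mul1l t : ueq (Umul (Uconst 1) t) t
| ueq_mul1r t : ueq (Umul t (Uconst 1)) t
| ueq_mulDl t u v : ueq (Umul (Uadd t u) v) (Uadd (Umul t v) (Umul u v))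
| ueq_mulDr t u v : ueq (Umul t (Uadd u v)) (Uadd (Umul t u) (Umul t v))
| ueq_constD k l : ueq (Uconst (k + l)) (Uadd (Uconst k) (Uconst l))
| ueq_constM k l : ueq (Uconst (k * l)) (Umul (Uconst k) (Uconst l))
| ueq_constC k t : ueq (Umul (Uconst k) t) (Umul t (Uconst k))
| ueq_genP k x y :
    ueq (Ugen (k *: x + y)) (Uadd (Umul (Uconst k) (Ugen x)) (Ugen y))
| ueq_br x y :
    ueq (Umul (Ugen x) (Ugen y))
        (Uadd (Umul (Ugen y) (Ugen x)) (Ugen (lie_br x y))).

HB.instance Definition _ := gen_eqMixin uterm.
HB.instance Definition _ := gen_choiceMixin uterm.

Definition ueqb : rel uterm := fun t u => `[< ueq t u >].

Fact ueqb_refl : reflexive ueqb.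
Proof. by move=> t; apply/asboolP; exact: ueq_refl. Qed.

Fact ueqb_sym : symmetric ueqb.
Proof. by move=> t u; apply/asboolP/asboolP; exact: ueq_sym. Qed.

Fact ueqb_trans : transitive ueqb.
Proof.
move=> u t v /asboolP tu /asboolP uv.
by apply/asboolP; exact: ueq_trans tu uv.
Qed.

Canonical ueqb_equiv := EquivRel ueqb ueqb_refl ueqb_sym ueqb_trans.

Definition env : Type := {eq_quot ueqb_equiv}.
HB.instance Definition _ := Choice.on env.
HB.instance Definition _ := EqQuotient.on env.

Lemma env_piP (t u : uterm) : (\pi_env t = \pi_env u) <-> ueq t u.
Proof.
split=> [/eqmodP|tu]; first by move=> /asboolP.
by apply/eqmodP/asboolP.
Qed.

Lemma env_reprP (t : uterm) : ueq (repr (\pi_env t)) t.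
Proof. by apply/env_piP; rewrite reprK. Qed.

Definition env_const (k : K) : env := \pi_env (Uconst k).
Definition env_gen (x : g) : env := \pi_env (Ugen x).
Definition env_add (u v : env) : env := \pi_env (Uadd (repr u) (repr v)).
Definition env_mul (u v : env) : env := \pi_env (Umul (repr u) (repr v)).
Definition env_opp (u : env) : env := env_mul (env_const (-1)) u.
Definition env_scale (k : K) (u : env) : env := env_mul (env_const k) u.

Lemma env_addE t u : env_add (\pi_env t) (\pi_env u) = \pi_env (Uadd t u).
Proof. by apply/env_piP; apply: ueq_add; exact: env_reprP. Qed.

Lemma env_mulE t u : env_mul (\pi_env t) (\pi_env u) = \pi_env (Umul t u).
Proof. by apply/env_piP; apply: ueq_mul; exact: env_reprP. Qed.

Fact env_addA : associative env_add.
Proof.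
elim/quotW=> t; elim/quotW=> u; elim/quotW=> v.
rewrite (env_addE u v) (env_addE t u) !env_addE.
by apply/env_piP; exact: ueq_addA.
Qed.

Fact env_addC : commutative env_add.
Proof.
elim/quotW=> t; elim/quotW=> u; rewrite !env_addE.
by apply/env_piP; exact: ueq_addC.
Qed.

Fact env_add0 : left_id (env_const 0) env_add.
Proof. by elim/quotW=> t; rewrite env_addE; apply/env_piP/ueq_add0. Qed.

Fact env_addN : left_inverse (env_const 0) env_opp env_add.
Proof.
elim/quotW=> t; rewrite /env_opp env_mulE env_addE.
by apply/env_piP/ueq_addN.
Qed.

Fact env_mulA : associative env_mul.
Proof.
elim/quotW=> t; elim/quotW=> u; elim/quotW=> v.
rewrite (env_mulE u v) (env_mulE t u) !env_mulE.
by apply/env_piP; exact: ueq_mulA.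
Qed.

Fact env_mul1l : left_id (env_const 1) env_mul.
Proof. by elim/quotW=> t; rewrite env_mulE; apply/env_piP/ueq_mul1l. Qed.

Fact env_mul1r : right_id (env_const 1) env_mul.
Proof. by elim/quotW=> t; rewrite env_mulE; apply/env_piP/ueq_mul1r. Qed.

Fact env_mulDl : left_distributive env_mul env_add.
Proof.
elim/quotW=> t; elim/quotW=> u; elim/quotW=> v.
rewrite (env_addE t u) (env_mulE t v) (env_mulE u v) env_mulE env_addE.
by apply/env_piP; exact: ueq_mulDl.
Qed.

Fact env_mulDr : right_distributive env_mul env_add.
Proof.
elim/quotW=> t; elim/quotW=> u; elim/quotW=> v.
rewrite (env_addE u v) (env_mulE t u) (env_mulE t v) env_mulE env_addE.
by apply/env_piP; exact: ueq_mulDr.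
Qed.

(* The augmentation [U(g) -> K], used to see that [U(g)] is nontrivial. *)
Fixpoint uaug (t : uterm) : K :=
  match t with
  | Uconst k => k
  | Ugen _ => 0
  | Uadd t u => uaug t + uaug u
  | Umul t u => uaug t * uaug u
  end.

Lemma uaugP t u : ueq t u -> uaug t = uaug u.
Proof.
elim=> //=; do ?[by move=> *; ring].
- by move=> ? ? ? _ -> _ ->.
- by move=> ? ? ? ? _ -> _ ->.
- by move=> ? ? ? ? _ -> _ ->.
Qed.

Fact env_1neq0 : env_const 1 != env_const 0.
Proof.
by apply/eqP => /env_piP /uaugP /= /eqP; rewrite oner_eq0.
Qed.

HB.instance Definition _ := GRing.isNzRing.Build env
  env_addA env_addC env_add0 env_addN env_mulA env_mul1l env_mul1r
  env_mulDl env_mulDr env_1neq0.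

Fact env_scaleA a b v : env_scale a (env_scale b v) = env_scale (a * b) v.
Proof.
rewrite /env_scale env_mulA; congr env_mul; rewrite env_mulE.
by apply/env_piP/ueq_sym/ueq_constM.
Qed.

Fact env_scale1 : left_id 1 env_scale.
Proof. exact: env_mul1l. Qed.

Fact env_scaleDr : right_distributive env_scale +%R.
Proof. by move=> k u v; exact: env_mulDr. Qed.

Fact env_scaleDl v : {morph env_scale^~ v : a b / a + b}.
Proof.
move=> a b /=; rewrite /env_scale -[RHS]env_mulDl; congr env_mul.
by rewrite env_addE; apply/env_piP/ueq_constD.
Qed.

HB.instance Definition _ := GRing.Zmodule_isLmodule.Build K env
  env_scaleA env_scale1 env_scaleDr env_scaleDl.

Fact env_scaleAl (a : K) (u v : env) : a *: (u * v) = (a *: u) * v.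
Proof. exact: env_mulA. Qed.

HB.instance Definition _ := GRing.Lmodule_isLalgebra.Build K env env_scaleAl.

Fact env_scaleAr (a : K) (u v : env) : a *: (u * v) = u * (a *: v).
Proof.
suff constC w : env_mul (env_const a) w = env_mul w (env_const a).
  have -> : a *: (u * v) = env_mul (env_const a) (env_mul u v) by [].
  by rewrite env_mulA constC -env_mulA.
by elim/quotW: w => t; rewrite !env_mulE; apply/env_piP/ueq_constC.
Qed.

HB.instance Definition _ := GRing.Lalgebra_isAlgebra.Build K env env_scaleAr.

Lemma env_constE k : env_const k = k%:A.
Proof. by rewrite -[LHS]env_mul1r. Qed.

Lemma env_gen_linear : linear env_gen.
Proof.
move=> k x y; transitivity (\pi_env (Uadd (Umul (Uconst k) (Ugen x)) (Ugen y))).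
  exact/env_piP/ueq_genP.
by rewrite -env_addE -env_mulE.
Qed.

HB.instance Definition _ := GRing.isLinear.Build K g env *:%R env_gen
  env_gen_linear.

Lemma env_gen_br x y :
  env_gen (lie_br x y) = env_gen x * env_gen y - env_gen y * env_gen x.
Proof.
apply/eqP; rewrite eq_sym subr_eq addrC; apply/eqP.
transitivity (\pi_env (Umul (Ugen x) (Ugen y))); first by rewrite -env_mulE.
transitivity (\pi_env (Uadd (Umul (Ugen y) (Ugen x)) (Ugen (lie_br x y)))).
  exact/env_piP/ueq_br.
by rewrite -env_addE -env_mulE.
Qed.

End EnvelopingAlgebra.

(** A Lie morphism from [g] to the commutator Lie algebra of [A], and its
    extension to a morphism of algebras [U(g) -> A]. *)

Record lieRep (K : fieldType) (g : lieType K) (A : algType K) := LieRep {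
  lieRep_fun :> g -> A;
  lieRep_linear : linear lieRep_fun;
  lieRep_br : forall x y,
    lieRep_fun (lie_br x y)
      = lieRep_fun x * lieRep_fun y - lieRep_fun y * lieRep_fun x
}.

Section EnvelopingLift.
Context (K : fieldType) (g : lieType K) (A : algType K) (f : lieRep g A).

Fixpoint ulift (t : uterm g) : A :=
  match t with
  | Uconst k => k%:A
  | Ugen x => f x
  | Uadd t u => ulift t + ulift u
  | Umul t u => ulift t * ulift u
  end.

Lemma uliftP t u : ueq t u -> ulift t = ulift u.
Proof.
elim=> //=.
- by move=> ? ? ? _ -> _ ->.
- by move=> ? ? ? ? _ -> _ ->.
- by move=> ? ? ? ? _ -> _ ->.
- by move=> *; rewrite addrA.
- by move=> *; rewrite addrC.
- by move=> *; rewrite scale0r add0r.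
- by move=> *; rewrite scaleN1r mulN1r addNr scale0r.
- by move=> *; rewrite mulrA.
- by move=> *; rewrite scale1r mul1r.
- by move=> *; rewrite scale1r mulr1.
- by move=> *; rewrite mulrDl.
- by move=> *; rewrite mulrDr.
- by move=> *; rewrite scalerDl.
- by move=> *; rewrite mulr_algl scalerA.
- by move=> *; rewrite mulr_algl mulr_algr.
- by move=> k x y; rewrite lieRep_linear mulr_algl.
- by move=> x y; rewrite lieRep_br addrC subrK.
Qed.

Definition env_lift (u : env g) : A := ulift (repr u).

Lemma env_liftE t : env_lift (\pi_(env g) t) = ulift t.
Proof. exact/uliftP/env_reprP. Qed.

Lemma env_lift_gen x : env_lift (env_gen x) = f x.
Proof. exact: env_liftE. Qed.

Fact env_lift_zmod : zmod_morphism env_lift.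
Proof.
elim/quotW=> t; elim/quotW=> u.
have -> : \pi_(env g) t - \pi_(env g) u = \pi_(env g) (Uadd t (Umul (Uconst g (-1)) u)).
  by rewrite -env_addE -env_mulE.
by rewrite !env_liftE /= scaleN1r mulN1r.
Qed.

Fact env_lift_monoid : monoid_morphism env_lift.
Proof.
split; first by rewrite [LHS]env_liftE /= scale1r.
elim/quotW=> t; elim/quotW=> u.
by rewrite [X in env_lift X]env_mulE !env_liftE.
Qed.

HB.instance Definition _ := GRing.isZmodMorphism.Build (env g) A env_lift
  env_lift_zmod.
HB.instance Definition _ := GRing.isMonoidMorphism.Build (env g) A env_lift
  env_lift_monoid.

End EnvelopingLift.

Section EnvelopingSub.
Context (K : fieldType) (g : lieType K) (p : lieSub g).

Fact lsub_gen_linear : linear (fun x : lsub p => env_gen (val x)).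
Proof. by move=> k x y; rewrite !linearP. Qed.

Fact lsub_gen_br (x y : lsub p) :
  env_gen (val (lie_br x y))
    = env_gen (val x) * env_gen (val y) - env_gen (val y) * env_gen (val x).
Proof. exact: env_gen_br. Qed.

Definition env_incl : env (lsub p) -> env g :=
  env_lift (LieRep lsub_gen_linear lsub_gen_br).
HB.instance Definition _ := GRing.RMorphism.on env_incl.

End EnvelopingSub.

Definition restr (B A : nzRingType) (f : {rmorphism B -> A}) (M : lmodType A) :
  Type := M.

Section Restriction.
Context (B A : nzRingType) (f : {rmorphism B -> A}) (M : lmodType A).

HB.instance Definition _ := GRing.Zmodule.on (restr f M).

Definition restr_scale (b : B) (m : restr f M) : restr f M := f b *: (m : M).

Fact restr_scaleA a b m :
  restr_scale a (restr_scale b m) = restr_scale (a * b) m.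
Proof. by rewrite /restr_scale scalerA rmorphM. Qed.

Fact restr_scale1 : left_id 1 restr_scale.
Proof. by move=> m; rewrite /restr_scale rmorph1 scale1r. Qed.

Fact restr_scaleDr : right_distributive restr_scale +%R.
Proof. by move=> b m n; exact: scalerDr. Qed.

Fact restr_scaleDl m : {morph restr_scale^~ m : a b / a + b}.
Proof. by move=> a b; rewrite /restr_scale rmorphD; exact: scalerDl. Qed.

HB.instance Definition _ := GRing.Zmodule_isLmodule.Build B (restr f M)
  restr_scaleA restr_scale1 restr_scaleDr restr_scaleDl.

End Restriction.

(** [tensor f M] is the left [A]-module [A (x)_B M], where [A] is a right
    [B]-module through [f : B -> A]: the abelian group generated by the pure
    tensors, modulo biadditivity and [a (f b) (x) m = a (x) (b m)]. *)

Section Tensor.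
Context (B A : nzRingType) (f : {rmorphism B -> A}) (M : lmodType B).

Inductive tterm : Type :=
| Tzero
| Tpure of A & M
| Tadd of tterm & tterm
| Topp of tterm.

Inductive teq : tterm -> tterm -> Prop :=
| teq_refl t : teq t t
| teq_sym t u : teq t u -> teq u t
| teq_trans t u v : teq t u -> teq u v -> teq t v
| teq_add t t' u u' : teq t t' -> teq u u' -> teq (Tadd t u) (Tadd t' u')
| teq_opp t t' : teq t t' -> teq (Topp t) (Topp t')
| teq_addA t u v : teq (Tadd t (Tadd u v)) (Tadd (Tadd t u) v)
| teq_addC t u : teq (Tadd t u) (Tadd u t)
| teq_add0 t : teq (Tadd Tzero t) t
| teq_addN t : teq (Tadd (Topp t) t) Tzero
| teq_pureDl a a' m : teq (Tpure (a + a') m) (Tadd (Tpure a m) (Tpure a' m))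
| teq_pureDr a m m' : teq (Tpure a (m + m')) (Tadd (Tpure a m) (Tpure a m'))
| teq_pureZ a b m : teq (Tpure (a * f b) m) (Tpure a (b *: m)).

HB.instance Definition _ := gen_eqMixin tterm.
HB.instance Definition _ := gen_choiceMixin tterm.

Definition teqb : rel tterm := fun t u => `[< teq t u >].

Fact teqb_refl : reflexive teqb.
Proof. by move=> t; apply/asboolP; exact: teq_refl. Qed.

Fact teqb_sym : symmetric teqb.
Proof. by move=> t u; apply/asboolP/asboolP; exact: teq_sym. Qed.

Fact teqb_trans : transitive teqb.
Proof.
move=> u t v /asboolP tu /asboolP uv.
by apply/asboolP; exact: teq_trans tu uv.
Qed.

Canonical teqb_equiv := EquivRel teqb teqb_refl teqb_sym teqb_trans.

Definition tensor : Type := {eq_quot teqb_equiv}.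
HB.instance Definition _ := Choice.on tensor.
HB.instance Definition _ := EqQuotient.on tensor.

Lemma tensor_piP (t u : tterm) : (\pi_tensor t = \pi_tensor u) <-> teq t u.
Proof.
split=> [/eqmodP|tu]; first by move=> /asboolP.
by apply/eqmodP/asboolP.
Qed.

Lemma tensor_reprP (t : tterm) : teq (repr (\pi_tensor t)) t.
Proof. by apply/tensor_piP; rewrite reprK. Qed.

Fixpoint tscale (a : A) (t : tterm) : tterm :=
  match t with
  | Tzero => Tzero
  | Tpure a' m => Tpure (a * a') m
  | Tadd t u => Tadd (tscale a t) (tscale a u)
  | Topp t => Topp (tscale a t)
  end.

Lemma tscaleP a t u : teq t u -> teq (tscale a t) (tscale a u).
Proof.
elim=> /=; try by econstructor; eauto.
- by move=> *; rewrite mulrDr; exact: teq_pureDl.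
- by move=> *; rewrite mulrA; exact: teq_pureZ.
Qed.

Definition tensor_zero : tensor := \pi_tensor Tzero.
Definition tensor_add (u v : tensor) : tensor := \pi_tensor (Tadd (repr u) (repr v)).
Definition tensor_opp (u : tensor) : tensor := \pi_tensor (Topp (repr u)).
Definition tensor_scale (a : A) (u : tensor) : tensor := \pi_tensor (tscale a (repr u)).
Definition tpure (a : A) (m : M) : tensor := \pi_tensor (Tpure a m).

Lemma tensor_addE t u : tensor_add (\pi_tensor t) (\pi_tensor u) = \pi_tensor (Tadd t u).
Proof. by apply/tensor_piP; apply: teq_add; exact: tensor_reprP. Qed.

Lemma tensor_oppE t : tensor_opp (\pi_tensor t) = \pi_tensor (Topp t).
Proof. by apply/tensor_piP; apply: teq_opp; exact: tensor_reprP. Qed.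

Lemma tensor_scaleE a t : tensor_scale a (\pi_tensor t) = \pi_tensor (tscale a t).
Proof. by apply/tensor_piP; apply: tscaleP; exact: tensor_reprP. Qed.

Fact tensor_addA : associative tensor_add.
Proof.
elim/quotW=> t; elim/quotW=> u; elim/quotW=> v.
rewrite (tensor_addE u v) (tensor_addE t u) !tensor_addE.
by apply/tensor_piP; exact: teq_addA.
Qed.

Fact tensor_addC : commutative tensor_add.
Proof.
elim/quotW=> t; elim/quotW=> u; rewrite !tensor_addE.
by apply/tensor_piP; exact: teq_addC.
Qed.

Fact tensor_add0 : left_id tensor_zero tensor_add.
Proof. by elim/quotW=> t; rewrite tensor_addE; apply/tensor_piP/teq_add0. Qed.

Fact tensor_addN : left_inverse tensor_zero tensor_opp tensor_add.
Proof.
elim/quotW=> t; rewrite tensor_oppE tensor_addE.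
by apply/tensor_piP/teq_addN.
Qed.

HB.instance Definition _ := GRing.isZmodule.Build tensor
  tensor_addA tensor_addC tensor_add0 tensor_addN.

Fact tensor_scaleA a b u :
  tensor_scale a (tensor_scale b u) = tensor_scale (a * b) u.
Proof.
elim/quotW: u => t; rewrite (tensor_scaleE b) !tensor_scaleE; congr (\pi _).
elim: t => //= [a' m|t -> u ->|t ->] //; by rewrite mulrA.
Qed.

Fact tensor_scale1 : left_id 1 tensor_scale.
Proof.
elim/quotW=> t; rewrite tensor_scaleE; congr (\pi _).
elim: t => //= [a' m|t -> u ->|t ->] //; by rewrite mul1r.
Qed.

Fact tensor_scaleDr : right_distributive tensor_scale +%R.
Proof.
move=> a; elim/quotW=> t; elim/quotW=> u.
by rewrite [X in tensor_scale _ X]tensor_addE !tensor_scaleE [RHS]tensor_addE.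
Qed.

Fact tensor_scaleDl u : {morph tensor_scale^~ u : a b / a + b}.
Proof.
move=> a b; elim/quotW: u => t; rewrite !tensor_scaleE.
elim: t => [|a' m|t IHt u IHu|t IHt] /=.
- by rewrite [RHS]addr0.
- by rewrite mulrDl [RHS]tensor_addE; apply/tensor_piP/teq_pureDl.
- rewrite -![\pi_tensor (Tadd _ _)]tensor_addE IHt IHu; exact: addrACA.
- by rewrite -![\pi_tensor (Topp _)]tensor_oppE IHt; exact: opprD.
Qed.

HB.instance Definition _ := GRing.Zmodule_isLmodule.Build A tensor
  tensor_scaleA tensor_scale1 tensor_scaleDr tensor_scaleDl.

Lemma tpureDl a a' m : tpure (a + a') m = tpure a m + tpure a' m.
Proof.
transitivity (\pi_tensor (Tadd (Tpure a m) (Tpure a' m))).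
  exact/tensor_piP/teq_pureDl.
by rewrite -tensor_addE.
Qed.

Lemma tpureDr a m m' : tpure a (m + m') = tpure a m + tpure a m'.
Proof.
transitivity (\pi_tensor (Tadd (Tpure a m) (Tpure a m'))).
  exact/tensor_piP/teq_pureDr.
by rewrite -tensor_addE.
Qed.

Lemma tpure_balanced a b m : tpure (a * f b) m = tpure a (b *: m).
Proof. exact/tensor_piP/teq_pureZ. Qed.

Lemma tpureZ a a' m : a *: tpure a' m = tpure (a * a') m.
Proof. exact: tensor_scaleE. Qed.

End Tensor.

Definition is_submodule (A : nzRingType) (V : lmodType A) (W : V -> Prop) :
  Prop :=
  [/\ W 0, forall u v, W u -> W v -> W (u + v)
    & forall (a : A) u, W u -> W (a *: u)].

Definition irreducible_module (A : nzRingType) (V : lmodType A) : Prop :=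
  (exists v : V, v != 0) /\
  forall W : V -> Prop, is_submodule W -> (exists2 w, W w & w != 0) ->
    forall v, W v.

(** [(v_j)_j] is a basis of the K-subspace [W] of a module [V] over the
    K-algebra [A]. *)
Definition is_basis (K : fieldType) (A : algType K) (V : lmodType A)
    (W : V -> Prop) (J : eqType) (v : J -> V) : Prop :=
  [/\ forall j, W (v j),
      forall (s : seq J) (z : J -> K), uniq s ->
        \sum_(j <- s) (z j)%:A *: v j = 0 -> forall j, j \in s -> z j = 0
    & forall w, W w ->
        exists (s : seq J) (z : J -> K), w = \sum_(j <- s) (z j)%:A *: v j].

(** A row vector lists the coordinates in the basis (a, b, c, d). *)

Section NappiWitten.
Context (K : fieldType).

Definition nw : Type := 'rV[K]_4.
HB.instance Definition _ := GRing.Lmodule.on nw.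

Definition nw_coord (i : nat) (x : nw) : K := (x : 'rV[K]_4) 0 (inord i).
Local Notation xa := (nw_coord 0).
Local Notation xb := (nw_coord 1).
Local Notation xc := (nw_coord 2).
Local Notation xd := (nw_coord 3).

Definition nw_vec (ka kb kc kd : K) : nw :=
  \row_(i < 4) [:: ka; kb; kc; kd]`_i.

Definition nw_a : nw := nw_vec 1 0 0 0.
Definition nw_b : nw := nw_vec 0 1 0 0.
Definition nw_c : nw := nw_vec 0 0 1 0.
Definition nw_d : nw := nw_vec 0 0 0 1.

Definition nw_br (x y : nw) : nw :=
  nw_vec (xd x * xa y - xa x * xd y)
         (xb x * xd y - xd x * xb y)
         (xa x * xb y - xb x * xa y)
         0.

Definition nw_form (x y : nw) : K :=
  xa x * xb y + xb x * xa y + xc x * xd y + xd x * xc y.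

Lemma nw_vecE ka kb kc kd :
  (xa (nw_vec ka kb kc kd) = ka) * (xb (nw_vec ka kb kc kd) = kb) *
  (xc (nw_vec ka kb kc kd) = kc) * (xd (nw_vec ka kb kc kd) = kd).
Proof. by rewrite /nw_coord !mxE !inordK. Qed.

Fact nw_coord_linear i : linear_for *%R (nw_coord i).
Proof. by move=> k x y; rewrite /nw_coord !mxE. Qed.

HB.instance Definition _ i := GRing.isLinear.Build K nw K *%R (nw_coord i)
  (nw_coord_linear i).

Lemma nwP (x y : nw) :
  xa x = xa y -> xb x = xb y -> xc x = xc y -> xd x = xd y -> x = y.
Proof.
move=> ea eb ec ed; apply/rowP => j; rewrite -[j]inord_val.
by case: j => [[|[|[|[|]]]]] //= _.
Qed.

Fact nw_br_linearl y : linear (nw_br ^~ y).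
Proof.
by move=> k u v; apply: nwP; rewrite !linearP /= /nw_br !nw_vecE ?linearP /=; ring.
Qed.

Fact nw_br_linearr x : linear (nw_br x).
Proof.
by move=> k u v; apply: nwP; rewrite !linearP /= /nw_br !nw_vecE ?linearP /=; ring.
Qed.

Fact nw_br_alt x : nw_br x x = 0.
Proof. by apply: nwP; rewrite !linear0 /= /nw_br !nw_vecE; ring. Qed.

Fact nw_br_jacobi x y z :
  nw_br x (nw_br y z) + nw_br y (nw_br z x) + nw_br z (nw_br x y) = 0.
Proof. by apply: nwP; rewrite !raddfD raddf0 /= /nw_br !nw_vecE; ring. Qed.

HB.instance Definition _ := isLieAlgebra.Build K nw
  nw_br_linearl nw_br_linearr nw_br_alt nw_br_jacobi.

Lemma nw_br_basis :
  (lie_br nw_a nw_b = nw_c) * (lie_br nw_d nw_a = nw_a) *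
  (lie_br nw_d nw_b = - nw_b) * (lie_br nw_c nw_d = 0) *
  (lie_br nw_c nw_a = 0) * (lie_br nw_c nw_b = 0).
Proof.
by do !split; apply: nwP; rewrite ?raddfN ?raddf0 /= /lie_br /= /nw_br !nw_vecE; ring.
Qed.

Lemma nw_form_linearl y : linear_for *%R (nw_form ^~ y).
Proof. by move=> k u v; rewrite /nw_form !linearP /=; ring. Qed.

Lemma nw_form_sym x y : nw_form x y = nw_form y x.
Proof. by rewrite /nw_form; ring. Qed.

Lemma nw_form_linearr x : linear_for *%R (nw_form x).
Proof. by move=> k u v; rewrite /nw_form !linearP /=; ring. Qed.

Lemma nw_form_invariant x y z : nw_form (lie_br x y) z = nw_form x (lie_br y z).
Proof. by rewrite /nw_form /lie_br /= /nw_br !nw_vecE; ring. Qed.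

Lemma nw_form_basis :
  (nw_form nw_a nw_b = 1) * (nw_form nw_c nw_d = 1) *
  (nw_form nw_a nw_a = 0) * (nw_form nw_b nw_b = 0) *
  (nw_form nw_c nw_c = 0) * (nw_form nw_d nw_d = 0) *
  (nw_form nw_a nw_c = 0) * (nw_form nw_a nw_d = 0) *
  (nw_form nw_b nw_c = 0) * (nw_form nw_b nw_d = 0).
Proof. by rewrite /nw_form !nw_vecE; do !split; ring. Qed.

End NappiWitten.

(** Elements of [H_4 (x) C[t, t^-1]] are finitely supported functions
    [int -> H_4]; the monomial [x (x) t^n] is [<< x *g n >>]. *)

Fact sum3D (V : zmodType) (x1 x2 x3 y1 y2 y3 : V) :
  x1 + x2 + x3 = 0 -> y1 + y2 + y3 = 0 -> x1 + y1 + (x2 + y2) + (x3 + y3) = 0.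
Proof.
by move=> hx hy; rewrite (addrACA x1) (addrACA (x1 + x2)) hx hy addr0.
Qed.

Section Loop.
Context (K : fieldType).

Definition loop : Type := {malg (nw K)[int]}.
HB.instance Definition _ := GRing.Zmodule.on loop.

Definition loop_coef (f : loop) (n : int) : nw K := (f : {malg (nw K)[int]})@_n.
Definition loop_supp (f : loop) : {fset int} := msupp (f : {malg (nw K)[int]}).
Definition loop_mono (x : nw K) (n : int) : loop := << x *g n >>.

Lemma loopP (f g : loop) : loop_coef f =1 loop_coef g -> f = g.
Proof. by move=> fg; apply/malgP. Qed.

Definition loop_scale (k : K) (f : loop) : loop :=
  [malg n in loop_supp f => k *: loop_coef f n].

Lemma loop_coef_out (f : loop) n : n \notin loop_supp f -> loop_coef f n = 0.
Proof. exact: mcoeff_outdom. Qed.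

Lemma loop_coefD (f g : loop) n :
  loop_coef (f + g) n = loop_coef f n + loop_coef g n.
Proof. exact: mcoeffD. Qed.

Lemma loop_coef0 n : loop_coef 0 n = 0.
Proof. exact: mcoeff0. Qed.

Lemma loop_coef_scale k f n :
  loop_coef (loop_scale k f) n = k *: loop_coef f n.
Proof.
rewrite /loop_coef /loop_scale mcoeffE; case: ifPn => // nf.
by rewrite -/(loop_coef f n) (loop_coef_out nf) scaler0.
Qed.

Lemma loop_coef_mono x m n :
  loop_coef (loop_mono x m) n = if m == n then x else 0.
Proof. by rewrite /loop_coef mcoeffU; case: eqP. Qed.

Fact loop_scaleA a b f : loop_scale a (loop_scale b f) = loop_scale (a * b) f.
Proof. by apply: loopP => n; rewrite !loop_coef_scale scalerA. Qed.

Fact loop_scale1 : left_id 1 loop_scale.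
Proof. by move=> f; apply: loopP => n; rewrite loop_coef_scale scale1r. Qed.

Fact loop_scaleDr : right_distributive loop_scale +%R.
Proof.
move=> k f g; apply: loopP => n.
by rewrite !(loop_coefD, loop_coef_scale) scalerDr.
Qed.

Fact loop_scaleDl f : {morph loop_scale^~ f : a b / a + b}.
Proof.
move=> a b; apply: loopP => n.
by rewrite !(loop_coefD, loop_coef_scale) scalerDl.
Qed.

HB.instance Definition _ := GRing.Zmodule_isLmodule.Build K loop
  loop_scaleA loop_scale1 loop_scaleDr loop_scaleDl.

Lemma loop_coefZ k (f : loop) n : loop_coef (k *: f) n = k *: loop_coef f n.
Proof. exact: loop_coef_scale. Qed.

Fact loop_coef_linear n : linear (loop_coef ^~ n).
Proof. by move=> k f g; rewrite loop_coefD loop_coefZ. Qed.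

Fact loop_mono_linear n : linear (loop_mono ^~ n).
Proof.
move=> k x y; apply: loopP => m; rewrite loop_coefD loop_coefZ !loop_coef_mono.
by case: eqP => // _; rewrite scaler0 addr0.
Qed.

Lemma loop_mono0 n : loop_mono 0 n = 0.
Proof. by apply: loopP => m; rewrite loop_coef_mono loop_coef0 if_same. Qed.

Lemma loopE (f : loop) :
  f = \sum_(n <- loop_supp f) loop_mono (loop_coef f n) n.
Proof. exact: monalgE. Qed.

Lemma loop_ind (P : loop -> Prop) :
  P 0 -> (forall f g, P f -> P g -> P (f + g)) ->
  (forall x n, P (loop_mono x n)) -> forall f, P f.
Proof. by move=> P0 PD Pm f; rewrite (loopE f); apply: big_ind. Qed.

Section SupportSums.
Context (V : lmodType K) (F : int -> nw K -> V).
Hypothesis F_linear : forall n, linear (F n).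

Let F0 n : F n 0 = 0.
Proof.
have := F_linear n 1 0 0; rewrite scaler0 addr0 scale1r => /eqP.
by rewrite -subr_eq subrr eq_sym => /eqP.
Qed.

Lemma loop_sum_supp (D : {fset int}) (f : loop) : (loop_supp f `<=` D)%fset ->
  \sum_(n <- loop_supp f) F n (loop_coef f n) = \sum_(n <- D) F n (loop_coef f n).
Proof.
move=> fD; apply/esym; rewrite (bigID (fun n => n \in loop_supp f)) /=.
rewrite [X in _ + X]big1 ?addr0 => [|n nf]; last by rewrite loop_coef_out.
rewrite -big_filter; apply: perm_big; apply: uniq_perm.
- exact/filter_uniq/fset_uniq.
- exact: fset_uniq.
move=> n; rewrite mem_filter; case nf: (n \in loop_supp f) => //=.
exact: (fsubsetP fD).
Qed.

Lemma loop_sum_linear :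
  linear (fun f : loop => \sum_(n <- loop_supp f) F n (loop_coef f n)).
Proof.
move=> k f g; pose h := k *: f + g; rewrite -/h.
set D := (loop_supp f `|` loop_supp g `|` loop_supp h)%fset.
rewrite !(@loop_sum_supp D).
- rewrite scaler_sumr -big_split; apply: eq_bigr => n _ /=.
  by rewrite /h loop_coefD loop_coefZ F_linear.
- by rewrite /D -fsetUA fsetUCA fsubsetUl.
- by rewrite /D -fsetUA fsubsetUl.
- exact: fsubsetUr.
Qed.

Lemma loop_sum_mono x m :
  \sum_(n <- loop_supp (loop_mono x m)) F n (loop_coef (loop_mono x m) n)
    = F m x.
Proof.
rewrite (@loop_sum_supp [fset m]%fset) ?msuppU_le // big_seq_fset1.
by rewrite loop_coef_mono eqxx.
Qed.

End SupportSums.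

(* [x (x) t^m, y (x) t^n] = [x, y] (x) t^(m+n) + m (x, y) delta_(m+n,0) k,
   extended bilinearly; the central part is [loop_cocycle]. *)
Definition loop_br (f g : loop) : loop :=
  \sum_(m <- loop_supp f) \sum_(n <- loop_supp g)
    loop_mono (lie_br (loop_coef f m) (loop_coef g n)) (m + n).

Definition loop_cocycle (f g : loop) : K^o :=
  \sum_(m <- loop_supp f) m%:~R * nw_form (loop_coef f m) (loop_coef g (- m)).

Let br_mono_linearr x m n : linear (fun y => loop_mono (lie_br x y) (m + n)).
Proof. by move=> k y z; rewrite lie_br_linearr loop_mono_linear. Qed.

Let br_mono_linearl y m n : linear (fun x => loop_mono (lie_br x y) (m + n)).
Proof.
by move=> k x z; rewrite -loop_mono_linear; congr loop_mono; apply: lie_br_linearl.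
Qed.

Let br_sum_linear g m : linear (fun x =>
  \sum_(n <- loop_supp g) loop_mono (lie_br x (loop_coef g n)) (m + n)).
Proof.
move=> k x y; rewrite scaler_sumr -big_split; apply: eq_bigr => n _ /=.
exact: br_mono_linearl.
Qed.

Lemma loop_br_linearl g : linear (loop_br ^~ g).
Proof. exact: (loop_sum_linear (br_sum_linear g)). Qed.

Lemma loop_br_linearr f : linear (loop_br f).
Proof.
move=> k g h; rewrite /loop_br scaler_sumr -big_split; apply: eq_bigr => m _ /=.
exact: (loop_sum_linear (br_mono_linearr (loop_coef f m) m)).
Qed.

Let cocycle_linear g m :
  linear (fun x => m%:~R * nw_form x (loop_coef g (- m)) : K^o).
Proof.
move=> k x y; rewrite nw_form_linearl; rewrite -[k *: _]/(k * _); ring.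
Qed.

Lemma loop_cocycle_linearl g : linear (loop_cocycle ^~ g).
Proof. exact: (loop_sum_linear (cocycle_linear g)). Qed.

Lemma loop_cocycle_linearr f : linear (loop_cocycle f).
Proof.
move=> k g h; rewrite /loop_cocycle scaler_sumr -big_split.
apply: eq_bigr => m _ /=; rewrite loop_coef_linear nw_form_linearr.
rewrite -[k *: (_ * _)]/(k * _); ring.
Qed.

Lemma loop_br_mono x m y n :
  loop_br (loop_mono x m) (loop_mono y n) = loop_mono (lie_br x y) (m + n).
Proof.
rewrite /loop_br (loop_sum_mono (br_sum_linear _)).
exact: (loop_sum_mono (br_mono_linearr x m)).
Qed.

Lemma loop_cocycle_mono x m y n :
  loop_cocycle (loop_mono x m) (loop_mono y n)
    = if m + n == 0 then m%:~R * nw_form x y else 0.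
Proof.
rewrite /loop_cocycle (loop_sum_mono (cocycle_linear _)) loop_coef_mono.
rewrite addrC addr_eq0; case: eqP => // _.
by rewrite /nw_form !linear0; ring.
Qed.

Lemma loop_coef_br f g p : loop_coef (loop_br f g) p =
  \sum_(m <- loop_supp f) \sum_(n <- loop_supp g)
    if m + n == p then lie_br (loop_coef f m) (loop_coef g n) else 0.
Proof.
have coef_sum (I : Type) (r : seq I) (G : I -> loop) :
    loop_coef (\sum_(i <- r) G i) p = \sum_(i <- r) loop_coef (G i) p.
  by apply: (big_morph (loop_coef ^~ p)) => [u v|]; rewrite ?loop_coefD ?loop_coef0.
rewrite coef_sum; apply: eq_bigr => m _; rewrite coef_sum; apply: eq_bigr => n _.
exact: loop_coef_mono.
Qed.

Definition affnw : Type := (loop * K^o)%type.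
HB.instance Definition _ := GRing.Lmodule.on affnw.

Definition affnw_mode (x : nw K) (n : int) : affnw := (loop_mono x n, 0).
Definition affnw_k : affnw := (0, 1).

Definition affnw_br (x y : affnw) : affnw :=
  (loop_br x.1 y.1, loop_cocycle x.1 y.1).

Fact affnw_br_linearl y : linear (affnw_br ^~ y).
Proof.
move=> k u v; rewrite /affnw_br /=.
by rewrite (loop_br_linearl y.1) (loop_cocycle_linearl y.1).
Qed.

Fact affnw_br_linearr x : linear (affnw_br x).
Proof.
move=> k u v; rewrite /affnw_br /=.
by rewrite (loop_br_linearr x.1) (loop_cocycle_linearr x.1).
Qed.

Let linear_eqs (f : affnw -> affnw) : linear f ->
  (f 0 = 0) * {morph f : x y / x + y} * {morph f : x / - x}
  * (forall k, {morph f : x / k *: x}).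
Proof.
move=> f_lin.
have f0 : f 0 = 0.
  have /eqP := f_lin (-1) 0 0; rewrite scaleN1r oppr0 addr0 scaleN1r addrC.
  by rewrite subrr => /eqP.
have fD : {morph f : x y / x + y}.
  by move=> x y; have := f_lin 1 x y; rewrite !scale1r.
have fZ k : {morph f : x / k *: x}.
  by move=> x; have := f_lin k x 0; rewrite f0 !addr0.
by do !split => //; move=> x; rewrite -!scaleN1r fZ.
Qed.

Let brl y := linear_eqs (affnw_br_linearl y).
Let brr x := linear_eqs (affnw_br_linearr x).

Lemma affnw_br_mode x m y n :
  affnw_br (affnw_mode x m) (affnw_mode y n)
    = affnw_mode (lie_br x y) (m + n)
      + (if m + n == 0 then m%:~R * nw_form x y else 0) *: affnw_k.
Proof.
rewrite /affnw_br /= loop_br_mono loop_cocycle_mono.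
rewrite /affnw_mode /affnw_k; congr pair.
  by rewrite /= scaler0 addr0.
by rewrite /= add0r; rewrite -[RHS]/(_ * 1) mulr1.
Qed.

Lemma affnw_br_kr x : affnw_br x affnw_k = 0.
Proof.
congr pair; rewrite /= /loop_br /loop_cocycle big1 // => m _.
  by rewrite /loop_supp msupp0 big_nil.
by rewrite loop_coef0 /nw_form !linear0 !mulr0 !addr0 mulr0.
Qed.

Lemma affnw_br_kl x : affnw_br affnw_k x = 0.
Proof.
by rewrite /affnw_br /= /loop_br /loop_cocycle /loop_supp msupp0 !big_nil.
Qed.

Lemma affnw_ind (P : affnw -> Prop) :
  P 0 -> (forall x y, P x -> P y -> P (x + y)) ->
  (forall x n, P (affnw_mode x n)) -> (forall z, P (z *: affnw_k)) ->
  forall x, P x.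
Proof.
move=> P0 PD Pm Pk [f z].
have -> : (f, z) = (f, 0) + z *: affnw_k :> affnw.
  congr pair; rewrite /= ?scaler0 ?addr0 ?add0r //.
  by rewrite -[RHS]/(_ * 1) mulr1.
apply: (PD) => //; elim/loop_ind: f => // f g Pf Pg.
have -> : (f + g, 0) = (f, 0) + (g, 0) :> affnw by congr pair; rewrite /= addr0.
exact: PD.
Qed.

Let nw_br_antisym (x y : nw K) : lie_br y x = - lie_br x y.
Proof.
by apply: nwP; rewrite raddfN /lie_br /= /nw_br !nw_vecE; ring.
Qed.

Let affnw_modeD x y n :
  affnw_mode (x + y) n = affnw_mode x n + affnw_mode y n.
Proof.
congr pair; rewrite /= ?addr0 //.
by have := loop_mono_linear n 1 x y; rewrite !scale1r.
Qed.

Let affnw_modeN x n : affnw_mode (- x) n = - affnw_mode x n.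
Proof.
apply/eqP; rewrite -addr_eq0 -affnw_modeD addNr; apply/eqP.
by congr pair; exact: loop_mono0.
Qed.

Fact affnw_br_antisym x y : affnw_br x y = - affnw_br y x.
Proof.
elim/affnw_ind: x => [|x x' IHx IHx'|x m|z].
- by rewrite brl brr oppr0.
- by rewrite brl brr IHx IHx' opprD.
- elim/affnw_ind: y => [|y y' IHy IHy'|y n|z].
  + by rewrite brl brr oppr0.
  + by rewrite brl brr IHy IHy' opprD.
  + rewrite !affnw_br_mode [n + m]addrC nw_br_antisym affnw_modeN opprD -scaleNr.
    congr (_ + _ *: _); case: eqP => [|_]; last by rewrite oppr0.
    move=> /eqP; rewrite addr_eq0 => /eqP ->.
    by rewrite nw_form_sym rmorphN /= mulNr.
  + by rewrite brl brr affnw_br_kr affnw_br_kl scaler0 oppr0.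
- by rewrite brl brr affnw_br_kr affnw_br_kl scaler0 oppr0.
Qed.

Fact affnw_br_alt x : affnw_br x x = 0.
Proof.
elim/affnw_ind: x => [|x y IHx IHy|x m|z].
- by rewrite brl.
- by rewrite brl !brr IHx IHy add0r addr0 [affnw_br y x]affnw_br_antisym subrr.
- rewrite affnw_br_mode lie_br_alt.
  case: eqP => [|_]; last by rewrite scale0r addr0 /affnw_mode loop_mono0.
  move=> /eqP; rewrite -mulr2n mulrn_eq0 /= => /eqP ->.
  by rewrite mul0r scale0r addr0 /affnw_mode loop_mono0.
- by rewrite brl brr affnw_br_kl !scaler0.
Qed.

Fact affnw_br_jacobi x y z :
  affnw_br x (affnw_br y z) + affnw_br y (affnw_br z x)
    + affnw_br z (affnw_br x y) = 0.
Proof.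
elim/affnw_ind: x => [|x x' IHx IHx'|x m|k].
- by rewrite !(brl, brr) !addr0.
- by rewrite !(brl, brr); exact: sum3D.
- elim/affnw_ind: y => [|y y' IHy IHy'|y n|k].
  + by rewrite !(brl, brr) !addr0.
  + by rewrite !(brl, brr); exact: sum3D.
  + elim/affnw_ind: z => [|z z' IHz IHz'|z p|k].
    * by rewrite !(brl, brr) !addr0.
    * by rewrite !(brl, brr); exact: sum3D.
    * rewrite !affnw_br_mode !brr !affnw_br_kr !scaler0 !addr0 !affnw_br_mode.
      have -> : n + (p + m) = m + (n + p) by ring.
      have -> : p + (m + n) = m + (n + p) by ring.
      rewrite (addrACA (affnw_mode _ _)) (addrACA (_ + _)) -!affnw_modeD lie_br_jacobi.
      rewrite /affnw_mode loop_mono0 add0r -!scalerDl; case: eqP => [e|_]; last first.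
        by rewrite !addr0 scale0r.
      have -> : nw_form y (lie_br z x) = nw_form x (lie_br y z).
        by rewrite nw_form_sym nw_form_invariant nw_form_sym -nw_form_invariant nw_form_sym.
      have -> : nw_form z (lie_br x y) = nw_form x (lie_br y z).
        by rewrite nw_form_sym nw_form_invariant.
      by rewrite -!mulrDl -!rmorphD /= -addrA e mul0r scale0r.
    * by rewrite !(brl, brr) !affnw_br_kr !affnw_br_kl !(brl, brr) !scaler0 !addr0.
  + by rewrite !(brl, brr) !affnw_br_kr !affnw_br_kl !(brl, brr) !scaler0 !addr0.
- by rewrite !(brl, brr) !affnw_br_kr !affnw_br_kl !(brl, brr) !scaler0 !addr0.
Qed.

HB.instance Definition _ := isLieAlgebra.Build K affnw
  affnw_br_linearl affnw_br_linearr affnw_br_alt affnw_br_jacobi.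

End Loop.

Fact subr_swap (V : zmodType) (p q r s t : V) :
  (p + q + (r + s)) - (t + r + (q + s)) = p - t.
Proof.
rewrite (addrACA t) opprD (addrACA (p + q)) subrr addr0.
by rewrite opprD (addrACA p) subrr addr0.
Qed.

Section Modules.
Context (K : fieldType).

(* [C a + C c + C d] *)
Definition borel_pred (x : nw K) : bool := nw_coord 1 x == 0.

Fact borel_submod : submod_closed (borel_pred : {pred nw K}).
Proof.
split=> [|k x y]; rewrite !unfold_in /borel_pred ?linear0 //.
by move=> /eqP x0 /eqP y0; rewrite linearP /= x0 y0 mulr0 addr0.
Qed.

Fact borel_br x y :
  borel_pred x -> borel_pred y -> borel_pred (lie_br x y).
Proof.
move=> /eqP x0 /eqP y0; rewrite /borel_pred /lie_br /= /nw_br nw_vecE x0 y0.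
by rewrite mul0r mulr0 subrr.
Qed.

Definition borel : lieSub (nw K) := LieSub borel_submod borel_br.

Section Character.
Context (cc dd : K).

Definition borel_char (x : lsub borel) : K^o :=
  cc * nw_coord 2 (val x) + dd * nw_coord 3 (val x).

Fact borel_char_linear : linear borel_char.
Proof.
move=> k x y.
have e i : nw_coord i (val (k *: x + y))
    = k * nw_coord i (val x) + nw_coord i (val y) by rewrite !linearP.
rewrite /borel_char !e.
have distr (p q r s : K) : cc * (k * p + q) + dd * (k * r + s)
    = k * (cc * p + dd * r) + (cc * q + dd * s) by ring.
exact: distr.
Qed.

Fact borel_char_br x y : borel_char (lie_br x y)
  = borel_char x * borel_char y - borel_char y * borel_char x.
Proof.
rewrite [X in X - _]mulrC subrr /borel_char val_lsub_br /lie_br /= /nw_br !nw_vecE.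
have /eqP -> := valP x; have /eqP -> := valP y.
by rewrite mul0r !mulr0 subrr mulr0 addr0.
Qed.

Definition borel_rep : lieRep (lsub borel) K^o :=
  LieRep borel_char_linear borel_char_br.

(* The one-dimensional [U(C a + C c + C d)]-module [C v_d]. *)
Definition char_module : lmodType (env (lsub borel)) :=
  restr (env_lift borel_rep) (K^o)^o.

Definition verma : lmodType (env (nw K)) :=
  tensor (@env_incl K (nw K) borel) char_module.

End Character.

Definition affnw_ge0_pred (x : affnw K) : bool :=
  `[< forall n : int, n < 0 -> loop_coef x.1 n = 0 >].

Fact affnw_ge0_submod : submod_closed (affnw_ge0_pred : {pred affnw K}).
Proof.
split=> [|k x y]; rewrite !unfold_in.
  by apply/asboolP => n _; exact: loop_coef0.
move=> /asboolP x0 /asboolP y0; apply/asboolP => n n0.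
by rewrite /= loop_coef_linear x0 // y0 // scaler0 addr0.
Qed.

Lemma affnw_ge0_supp x m : affnw_ge0_pred x -> m \in loop_supp x.1 -> 0 <= m.
Proof.
move=> /asboolP x0; rewrite leNgt; apply: contraTN => /x0 e.
by rewrite -mcoeff_eq0; apply/eqP.
Qed.

Fact affnw_ge0_br x y :
  affnw_ge0_pred x -> affnw_ge0_pred y -> affnw_ge0_pred (lie_br x y).
Proof.
move=> x0 y0; apply/asboolP => p p0; rewrite /lie_br /= loop_coef_br.
rewrite big_seq big1 // => m mx; rewrite big_seq big1 // => n ny.
case: eqP => // e; move: p0; rewrite -e ltNge addr_ge0 //.
  exact: affnw_ge0_supp x0 mx.
exact: affnw_ge0_supp y0 ny.
Qed.

(* [H_4^(>= 0)] *)
Definition affnw_ge0 : lieSub (affnw K) := LieSub affnw_ge0_submod affnw_ge0_br.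

Section Induced.
Context (ell cc dd : K).

(* [x (x) t^n |-> x] if [n = 0], [x (x) t^n |-> 0] if [n > 0], [k |-> ell]. *)
Definition affnw_ev (x : lsub affnw_ge0) : env (nw K) :=
  env_gen (loop_coef (val x).1 0) + (ell * (val x).2)%:A.

Fact affnw_ev_linear : linear affnw_ev.
Proof.
move=> k x y.
have e1 : loop_coef (val (k *: x + y)).1 0
    = k *: loop_coef (val x).1 0 + loop_coef (val y).1 0.
  by rewrite linearP /= loop_coef_linear.
have e2 : (val (k *: x + y)).2 = k * (val x).2 + (val y).2 by rewrite linearP.
rewrite /affnw_ev e1 e2 linearP mulrDr mulrCA scalerDl scalerDr scalerA.
by rewrite addrACA.
Qed.

Lemma affnw_ge0_br0 x y : affnw_ge0_pred x -> affnw_ge0_pred y ->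
  loop_coef (lie_br x y).1 0 = lie_br (loop_coef x.1 0) (loop_coef y.1 0).
Proof.
move=> x0 y0; rewrite /lie_br /= loop_coef_br.
have pick (f : loop K) (G : int -> nw K) : (0 \notin loop_supp f -> G 0 = 0) ->
    \sum_(n <- loop_supp f) (if n == 0 then G n else 0) = G 0.
  move=> G0; case: (boolP (0 \in loop_supp f)) => f0.
    rewrite (bigD1_seq 0) ?fset_uniq //= big1 ?addr0 // => n.
    by move/negPf ->.
  rewrite G0 // big_seq big1 // => n nf; case: eqP => // n0.
  by rewrite -n0 nf in f0.
transitivity (\sum_(m <- loop_supp x.1) if m == 0 then
    \sum_(n <- loop_supp y.1)
      (if n == 0 then lie_br (loop_coef x.1 m) (loop_coef y.1 n) else 0) else 0).
  rewrite big_seq [RHS]big_seq; apply: eq_bigr => m /(affnw_ge0_supp x0) m0.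
  case: eqP => [->|mn0]; first by apply: eq_bigr => n _; rewrite add0r.
  rewrite big_seq big1 // => n /(affnw_ge0_supp y0) n0.
  by rewrite paddr_eq0 //; case: eqP.
have br0 (u : nw K) : (lie_br 0 u = 0) * (lie_br u 0 = 0).
  by split; apply: nwP; rewrite /lie_br /= /nw_br !nw_vecE !linear0; ring.
rewrite pick => [|/loop_coef_out ->]; last first.
  by rewrite big1 // => n _; rewrite br0 if_same.
by rewrite pick // => /loop_coef_out ->; rewrite br0.
Qed.

Lemma affnw_ge0_cocycle x y : affnw_ge0_pred x -> affnw_ge0_pred y ->
  (lie_br x y).2 = 0.
Proof.
move=> x0 /asboolP y0; rewrite /lie_br /= /loop_cocycle big_seq big1 // => m.
move=> /(affnw_ge0_supp x0); rewrite le0r => /orP[/eqP ->|m0].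
  by rewrite mul0r.
by rewrite y0 ?oppr_lt0 // /nw_form !linear0; ring.
Qed.

Fact affnw_ev_br x y : affnw_ev (lie_br x y)
  = affnw_ev x * affnw_ev y - affnw_ev y * affnw_ev x.
Proof.
rewrite /affnw_ev val_lsub_br.
rewrite (affnw_ge0_br0 (valP x) (valP y)) (affnw_ge0_cocycle (valP x) (valP y)).
rewrite mulr0 scale0r addr0 env_gen_br.
move: (env_gen _) (env_gen _) (ell * _) (ell * _) => u v k l.
rewrite !mulrDl !mulrDr !mulr_algl !mulr_algr !scalerA [l * k]mulrC.
exact/esym/subr_swap.
Qed.

Definition affnw_ev_rep : lieRep (lsub affnw_ge0) (env (nw K)) :=
  LieRep affnw_ev_linear affnw_ev_br.

Definition affnw_verma : lmodType (env (affnw K)) :=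
  tensor (@env_incl K (affnw K) affnw_ge0)
    (restr (env_lift affnw_ev_rep) (verma cc dd)).

End Induced.

Definition verma_hwv cc dd : verma cc dd :=
  @tpure _ _ (@env_incl K (nw K) borel) (char_module cc dd) 1 (1 : K).

Definition affnw_hwv ell cc dd : affnw_verma ell cc dd :=
  @tpure _ _ (@env_incl K (affnw K) affnw_ge0)
    (restr (env_lift (affnw_ev_rep ell)) (verma cc dd)) 1 (verma_hwv cc dd).

End Modules.

Section HighestWeight.
Context (K : fieldType) (ell cc dd : K).
Lemma env_incl_gen (g : lieType K) (p : lieSub g) (x : lsub p) :
  env_incl (env_gen x) = env_gen (val x).
Proof. exact: env_lift_gen. Qed.
Lemma verma_hwvE (x : lsub (borel K)) :
  env_gen (val x) *: verma_hwv cc dd =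
  (cc * nw_coord 2 (val x) + dd * nw_coord 3 (val x))%:A *: verma_hwv cc dd.
Proof.
rewrite /verma_hwv !tpureZ !mulr1 -env_incl_gen.
set k := (X in X%:A).
have -> : k%:A = env_incl (k%:A : env (lsub (borel K))).
  rewrite -!env_constE [RHS]env_liftE /=; by rewrite env_constE.
rewrite -{1}[env_incl (env_gen x)]mul1r -[env_incl k%:A]mul1r.
rewrite !tpure_balanced; congr (tpure _ _ _).
transitivity (env_lift (borel_rep cc dd) (env_gen x) *: (1 : (K^o)^o)); first by [].
transitivity (env_lift (borel_rep cc dd) k%:A *: (1 : (K^o)^o)); last by [].
rewrite env_lift_gen -env_constE env_liftE /=.
change ((borel_char cc dd x : K) * 1 = k * 1 * 1); by rewrite !mulr1.
Qed.
Lemma affnw_hwvE (x : lsub (affnw_ge0 K)) :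
  env_gen (val x) *: affnw_hwv ell cc dd =
  tpure (env_incl (p:=_)) 1 ((env_gen (loop_coef (val x).1 0) + (ell * (val x).2)%:A)
     *: verma_hwv cc dd : restr (env_lift (affnw_ev_rep ell)) (verma cc dd)).
Proof.
rewrite /affnw_hwv tpureZ mulr1 -env_incl_gen -[env_incl _]mul1r tpure_balanced.
congr (tpure _ _ _).
transitivity (env_lift (affnw_ev_rep ell) (env_gen x) *: verma_hwv cc dd); first by [].
by rewrite env_lift_gen.
Qed.
End HighestWeight.

Section SingularVectors.
Context (K : fieldType).

Definition affnw_plus (x : affnw K) : Prop :=
  [/\ forall n : int, n < 0 -> loop_coef x.1 n = 0,
      exists k : K, loop_coef x.1 0 = k *: nw_a K & x.2 = 0].

Definition affnw_singular (V : lmodType (env (affnw K))) (u : V) : Prop :=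
  forall x : affnw K, affnw_plus x -> env_gen x *: u = 0.

(* The vectors [f i] are singular and form, together with [v], a basis of the
   space of all vectors killed by [H_4^+]. *)
Definition singular_basis (V : lmodType (env (affnw K))) (v : V) (I : eqType)
    (f : I -> V) : Prop :=
  is_basis (@affnw_singular V) (fun o : option I => if o is Some i then f i else v).

(** Partitions: weakly decreasing sequences of positive integers. The distinct
    parts of [la] are [undup la], and [rem p la] removes one copy of [p]. *)

Definition is_partition (la : seq nat) : bool := sorted geq la && (0%N \notin la).

Definition partitions_of (m : nat) : seq (seq nat) :=
  [seq la <- [seq map val (s : seq 'I_m.+1) | s : {bseq m of 'I_m.+1}]
     | is_partition la & sumn la == m].

Lemma mem_partitions_of m la :
  (la \in partitions_of m) = is_partition la && (sumn la == m).
Proof.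
rewrite mem_filter andb_idr // => /andP[/andP[_ la0] /eqP lam].
have le_sumn p : p \in la -> (p <= sumn la)%N.
  move=> pla; rewrite (perm_sumn (perm_to_rem pla)); exact: leq_addr.
have size_la : (size (map (@inord m) la) <= m)%N.
  rewrite size_map -lam; elim: la la0 {lam le_sumn} => //= p la IH.
  rewrite inE negb_or => /andP[p0 /IH]; case: p p0 => // p _.
  by rewrite addSn ltnS => /leq_trans; apply; exact: leq_addl.
apply/mapP; exists (Bseq size_la); rewrite ?mem_enum //=.
rewrite -map_comp map_id_in // => p pla /=.
by rewrite inordK // ltnS -lam le_sumn.
Qed.

Lemma partitions_of_uniq m : uniq (partitions_of m).
Proof.
apply: filter_uniq; rewrite map_inj_uniq ?enum_uniq // => s t /inj_map st.
by apply/val_inj/st/val_inj.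
Qed.

Record ne_partition := NePartition {
  nepart :> seq nat;
  nepartP : is_partition nepart && (nepart != [::])
}.
HB.instance Definition _ := [isSub for nepart].
HB.instance Definition _ := [Equality of ne_partition by <:].

(* [x(-p)] and [x(-lambda)], as elements of the enveloping algebra *)
Definition neg_mode (x : nw K) (p : nat) : env (affnw K) :=
  env_gen (affnw_mode x (- p%:Z)).

Definition neg_modes (x : nw K) (la : seq nat) : env (affnw K) :=
  \prod_(p <- la) neg_mode x p.

(* The term indexed by [la \ p \ q], which is 0 when the removal is
   impossible. *)
Definition rem2_coef (b : seq nat -> nat -> K) (la : seq nat) (p q : nat) : K :=
  if q \in rem p la then b (rem q (rem p la)) (p + q)%N else 0.

Section Claims.
Context (ell cc : K) (m : nat).

Definition pair_nonzero (b : seq nat -> nat -> K) : Prop :=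
  exists mu s, [/\ is_partition mu, (0 < s)%N, (sumn mu + s)%N = m & b mu s != 0].

Definition solution_i (a : seq nat -> K) (b : seq nat -> nat -> K) : Prop :=
  forall la, la \in partitions_of m ->
  [/\ forall p, p \in la ->
        a la * (count_mem p la)%:R * p%:R * ell - b (rem p la) p = 0,
      a la * cc + \sum_(p <- undup la) b (rem p la) p = 0
    & forall p, p \in la ->
        b (rem p la) p * (cc + p%:R * ell)
          + \sum_(q <- undup la) rem2_coef b la p q = 0].

Definition nonzero_i (a : seq nat -> K) (b : seq nat -> nat -> K) : Prop :=
  (exists2 la, la \in partitions_of m & a la != 0) \/ pair_nonzero b.

Definition element_i (a : seq nat -> K) (b : seq nat -> nat -> K) :
    env (affnw K) :=
  \sum_(la <- partitions_of m)
    (a la *: (neg_modes (nw_c K) la * neg_mode (nw_b K) 0)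
     + \sum_(p <- undup la)
         b (rem p la) p *: (neg_modes (nw_c K) (rem p la) * neg_mode (nw_b K) p)).

Definition solution_ii (c : seq nat -> nat -> K) : Prop :=
  forall la, la \in partitions_of m ->
  (forall p q, p \in la -> q \in la -> p != q ->
     (count_mem p la)%:R * p%:R * ell * c (rem q la) q + rem2_coef c la p q = 0)
  /\ (forall p, p \in la ->
     c (rem p la) p * (- cc + p%:R * ell)
       - \sum_(q <- undup la) rem2_coef c la p q = 0).

Definition element_ii (c : seq nat -> nat -> K) : env (affnw K) :=
  \sum_(la <- partitions_of m) \sum_(p <- undup la)
    c (rem p la) p *: (neg_modes (nw_c K) (rem p la) * neg_mode (nw_a K) p).

End Claims.
End SingularVectors.

(* Main.v *)
(** [V(ell, c, d)] is realized on the polynomial ring [P] in variables [A_n, B_n,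
    C_n, D_n] ([n >= 0]) standing for [a(-n-1), b(-n), c(-n-1), d(-n-1)].

    If [ell != 0], let [c(n)] and [d(n)], [n > 0], act as [n ell d/dD_(n-1)] and
    [n ell d/dC_(n-1)]. Dividing [a(z)] and [b(z)] by the mutually inverse vertex
    operators [exp (+- sum_n c(n) z^(-n) / (n ell))], [n != 0], leaves two fields
    that commute with the nonzero modes of [c] and [d] and satisfy
    [[fa k, fb l] = (k ell + c) delta_(k+l,0)]: thus [fa k = (k ell + c) d/dB_k] for [k >= 0], [fb k = (k ell - c) d/dA_(k-1)]
    for [k > 0], and the other modes are multiplications by variables. A vector is
    singular iff it is killed by these and by all [d/dC_n], [d/dD_n]. If no
    [k ell +- c] vanishes then derivatives lower any nonzero vector to a constant;
    if [k ell + c] (resp. [k ell - c]) vanishes, the singular vectors are the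
    polynomials in the single variable [B_k] (resp. [A_(k-1)]), whose ideal is a
    submodule. The linear systems of the claim have a unique solution up to a
    scalar, the coefficients of the exponentials above, so that the elements in
    (i) and (ii) multiply by [B_m] and [A_(m-1)], respectively.

    If [ell = 0], then [c(n)] acts as 0 for [n > 0], [a(z)] is the product of
    [fa(z)] with [c(z) / c], [b = fb], and [d(z)] is the sum of a term acting on
    the [D] variables and of the quadratic expression [- :fb(z) fa(z): / c]; the
    singular vectors are the polynomials in the variables [C_n].

    In both cases, the map from the Verma module is injective because the
    operators of the four families are the corresponding variables up to terms
    that raise the weight [#C - #D] of a monomial, so that ordered words have
    distinct leading monomials. *)
Require Import Defs.
From HB Require Import structures.
From mathcomp Require Import all_boot all_order all_algebra.
From mathcomp Require Import finmap boolp reals complex monalg.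
From mathcomp Require Import ring zify.

Set Implicit Arguments.
Unset Strict Implicit.
Unset Printing Implicit Defensive.

Import Order.TTheory GRing.Theory Num.Theory.
Local Open Scope ring_scope.
Local Open Scope quotient_scope.

(** * Linear endomorphisms and universal properties *)

(** The modules are quotients of types of terms, so neither a basis nor even the fact that the
    highest weight vector is nonzero is known beforehand. The polynomial operators supply both: by
    the universal properties of [env] and [tensor], operators satisfying [nwrep] give a module map
    out of the Verma module; reordering makes ordered words span, and triangularity makes them
    independent. The vertex operators split by the sign of the mode. The negative modes of [c] are
    variables, so one half of the exponential is a power series in the [C_n]; the positive ones are
    multiples of [d/dD_n], so the other half translates the [D] variables and is the identity on
    polynomials free of [D]. Singular vectors are of that kind, and commutators are checked there
    first and carried to all polynomials by brackets with [D_n]. At level zero, [- :fb fa: / c]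
    moves the modes of [fa] and [fb] as [d] must, but its opposite modes [k], [-k] have commutator
    [-k]. The pairs [D_n], [d/dD_n] contribute [+k], so that the modes of [d] commute. *)

Section LinearEndomorphisms.
Context (K : fieldType) (V : algType K).

(** The carrier is an algebra because its [1] is the nonzero vector that makes the ring of
    endomorphisms nontrivial, as an [algType] must be. The same [1] later serves as the image of the
    highest weight vector. *)
Record lend := Lend { lend_fun :> V -> V; lend_linear : linear lend_fun }.

HB.instance Definition _ := gen_eqMixin lend.
HB.instance Definition _ := gen_choiceMixin lend.

Lemma lendP (f g : lend) : f =1 g -> f = g.
Proof.
case: f g => [f fl] [g gl] /= /funext fg; case: _ / fg gl => gl.
by congr Lend; exact: Prop_irrelevance.
Qed.

HB.instance Definition _ (f : lend) := GRing.isLinear.Build K V V *:%R f (lend_linear f).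

Lemma lend_vecZ (f : lend) k v : f (k *: v) = k *: f v. Proof. exact: linearZ. Qed.
Lemma lend_vecD (f : lend) u v : f (u + v) = f u + f v. Proof. exact: linearD. Qed.
Lemma lend_vecN (f : lend) v : f (- v) = - f v. Proof. exact: linearN. Qed.
Lemma lend_vec0 (f : lend) : f 0 = 0. Proof. exact: linear0. Qed.
Lemma lend_vec_sum (f : lend) (J : Type) (s : seq J) (Q : pred J) (F : J -> V) :
  f (\sum_(j <- s | Q j) F j) = \sum_(j <- s | Q j) f (F j).
Proof. exact: linear_sum. Qed.

Fact lend0_linear : linear (fun _ : V => 0 : V).
Proof. by move=> k u v; rewrite scaler0 addr0. Qed.
Fact lendD_linear (f g : lend) : linear (fun v => f v + g v).
Proof. by move=> k u v; rewrite !linearP scalerDr addrACA. Qed.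
Fact lendN_linear (f : lend) : linear (fun v => - f v).
Proof. by move=> k u v; rewrite linearP opprD scalerN. Qed.
Fact lendM_linear (f g : lend) : linear (fun v => f (g v)).
Proof. by move=> k u v; rewrite !linearP. Qed.
Fact lend1_linear : linear (fun v : V => v).
Proof. by []. Qed.
Fact lendZ_linear k (f : lend) : linear (fun v => k *: f v).
Proof. by move=> l u v; rewrite linearP scalerDr !scalerA mulrC. Qed.

Definition lend0 := Lend lend0_linear.
Definition lendD f g := Lend (lendD_linear f g).
Definition lendN f := Lend (lendN_linear f).
Definition lend1 := Lend lend1_linear.
Definition lendM f g := Lend (lendM_linear f g).
Definition lendZ k f := Lend (lendZ_linear k f).

Fact lendDA : associative lendD. Proof. by move=> f g h; apply: lendP => v; exact: addrA. Qed.
Fact lendDC : commutative lendD. Proof. by move=> f g; apply: lendP => v; exact: addrC. Qed.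
Fact lend0D : left_id lend0 lendD. Proof. by move=> f; apply: lendP => v; exact: add0r. Qed.
Fact lendND : left_inverse lend0 lendN lendD. Proof. by move=> f; apply: lendP => v; exact: addNr. Qed.
HB.instance Definition _ := GRing.isZmodule.Build lend lendDA lendDC lend0D lendND.

Fact lendMA : associative lendM. Proof. by move=> f g h; exact: lendP. Qed.
Fact lend1M : left_id lend1 lendM. Proof. by move=> f; exact: lendP. Qed.
Fact lendM1 : right_id lend1 lendM. Proof. by move=> f; exact: lendP. Qed.
Fact lendMDl : left_distributive lendM +%R. Proof. by move=> f g h; exact: lendP. Qed.
Fact lendMDr : right_distributive lendM +%R.
Proof. by move=> f g h; apply: lendP => v /=; exact: linearD. Qed.
Fact lend_1neq0 : lend1 != 0.
Proof. by apply/eqP => /(congr1 (fun f => lend_fun f 1)) /eqP; rewrite oner_eq0. Qed.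
HB.instance Definition _ := GRing.Zmodule_isNzRing.Build lend
  lendMA lend1M lendM1 lendMDl lendMDr lend_1neq0.

Fact lendZA a b f : lendZ a (lendZ b f) = lendZ (a * b) f.
Proof. by apply: lendP => v /=; rewrite scalerA. Qed.
Fact lendZ1 : left_id 1 lendZ. Proof. by move=> f; apply: lendP => v; exact: scale1r. Qed.
Fact lendZDr : right_distributive lendZ +%R.
Proof. by move=> k f g; apply: lendP => v; exact: scalerDr. Qed.
Fact lendZDl f : {morph lendZ^~ f : a b / a + b}.
Proof. by move=> a b; apply: lendP => v; exact: scalerDl. Qed.
HB.instance Definition _ := GRing.Zmodule_isLmodule.Build K lend
  lendZA lendZ1 lendZDr lendZDl.
Fact lendZAl (a : K) (f g : lend) : a *: (f * g) = (a *: f) * g.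
Proof. exact: lendP. Qed.
HB.instance Definition _ := GRing.Lmodule_isLalgebra.Build K lend lendZAl.
Fact lendZAr (a : K) (f g : lend) : a *: (f * g) = f * (a *: g).
Proof. by apply: lendP => v; rewrite /= linearZ. Qed.
HB.instance Definition _ := GRing.Lalgebra_isAlgebra.Build K lend lendZAr.

Lemma lendDE (f g : lend) v : (f + g : lend) v = f v + g v. Proof. by []. Qed.
Lemma lendNE (f : lend) v : (- f : lend) v = - f v. Proof. by []. Qed.
Lemma lendME (f g : lend) v : (f * g : lend) v = f (g v). Proof. by []. Qed.
Lemma lendZE k (f : lend) v : (k *: f : lend) v = k *: f v. Proof. by []. Qed.
Lemma lend0E v : (0 : lend) v = 0. Proof. by []. Qed.
Lemma lend_sumE (J : Type) (s : seq J) (Q : pred J) (F : J -> lend) v :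
  (\sum_(j <- s | Q j) F j : lend) v = \sum_(j <- s | Q j) F j v.
Proof. by elim/big_rec2: _ => // j f g _ <-. Qed.

(** A copy of [V] whose scalars are operators; restriction of scalars along a representation turns
    it into a module over an enveloping algebra. *)
Definition lendmod : Type := V.
HB.instance Definition _ := GRing.Zmodule.on lendmod.
Definition lendmod_scale (f : lend) (v : lendmod) : lendmod := f v.
Fact lendmod_scaleA f g v : lendmod_scale f (lendmod_scale g v) = lendmod_scale (f * g) v.
Proof. by []. Qed.
Fact lendmod_scale1 : left_id 1 lendmod_scale. Proof. by []. Qed.
Fact lendmod_scaleDr : right_distributive lendmod_scale +%R.
Proof. by move=> f u v; exact: linearD. Qed.
Fact lendmod_scaleDl v : {morph lendmod_scale^~ v : f g / f + g}.
Proof. by []. Qed.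
HB.instance Definition _ := GRing.Zmodule_isLmodule.Build lend lendmod
  lendmod_scaleA lendmod_scale1 lendmod_scaleDr lendmod_scaleDl.

End LinearEndomorphisms.

Section EnvInduction.
Context (K : fieldType) (g : lieType K).

Lemma env_ind (Q : env g -> Prop) :
  (forall k : K, Q k%:A) -> (forall x, Q (env_gen x)) ->
  (forall u v, Q u -> Q v -> Q (u + v)) -> (forall u v, Q u -> Q v -> Q (u * v)) ->
  forall u, Q u.
Proof.
move=> Qk Qx QD QM; elim/quotW; elim=> [k|x|t Qt u Qu|t Qt u Qu].
- by have := Qk k; rewrite -env_constE.
- exact: Qx.
- by rewrite -env_addE; exact: QD.
- by rewrite -env_mulE; exact: QM.
Qed.

Lemma env_lift_const (A : algType K) (f : lieRep g A) (k : K) :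
  env_lift f k%:A = k%:A.
Proof. by rewrite -env_constE env_liftE. Qed.

End EnvInduction.

Section TensorLift.
Context (B A : nzRingType) (f : {rmorphism B -> A}) (M : lmodType B) (N : lmodType A).
Context (psi : {additive M -> N}).
Hypothesis psiZ : forall b m, psi (b *: m) = f b *: psi m.

Fixpoint tterm_lift (t : tterm A M) : N :=
  match t with
  | Tzero => 0
  | Tpure a m => a *: psi m
  | Tadd t u => tterm_lift t + tterm_lift u
  | Topp t => - tterm_lift t
  end.

Lemma tterm_liftP t u : teq f t u -> tterm_lift t = tterm_lift u.
Proof.
elim=> //=.
- by move=> ? ? ? _ -> _ ->.
- by move=> ? ? ? ? _ -> _ ->.
- by move=> ? ? _ ->.
- by move=> *; rewrite addrA.
- by move=> *; rewrite addrC.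
- by move=> *; rewrite add0r.
- by move=> *; rewrite addNr.
- by move=> *; rewrite scalerDl.
- by move=> *; rewrite raddfD scalerDr.
- by move=> *; rewrite psiZ scalerA.
Qed.

Definition tensor_lift (u : tensor f M) : N := tterm_lift (repr u).

Lemma tensor_liftE t : tensor_lift (\pi_(tensor f M) t) = tterm_lift t.
Proof. exact/tterm_liftP/tensor_reprP. Qed.

Fact tensor_lift_linear : linear tensor_lift.
Proof.
move=> a; elim/quotW=> t; elim/quotW=> u.
rewrite [X in tensor_lift (X + _)]tensor_scaleE [X in tensor_lift X]tensor_addE.
rewrite !tensor_liftE /=; congr (_ + _).
elim: t => /= [|a' m|t -> t' ->|t ->]; rewrite ?scaler0 ?scalerA ?scalerDr ?scalerN //.
Qed.
HB.instance Definition _ := GRing.isLinear.Build A (tensor f M) N *:%R tensor_lift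
  tensor_lift_linear.

Lemma tensor_lift_pure a m : tensor_lift (tpure f a m) = a *: psi m.
Proof. exact: tensor_liftE. Qed.

Lemma tensor_ind (Q : tensor f M -> Prop) :
  (forall a m, Q (tpure f a m)) -> (forall u v, Q u -> Q v -> Q (u + v)) ->
  (forall u, Q u -> Q (- u)) -> Q 0 -> forall u, Q u.
Proof.
move=> Qp QD QN Q0; elim/quotW; elim=> // [t Qt u Qu|t Qt].
- by rewrite -tensor_addE; exact: QD.
- by rewrite -tensor_oppE; exact: QN.
Qed.

End TensorLift.

(** * Representations of the affine algebra by operators *)

Lemma commutator_linearl (K : fieldType) (A : algType K) (k : K) (x y z : A) :
  (k *: x + y) * z - z * (k *: x + y) = k *: (x * z - z * x) + (y * z - z * y).
Proof.
by rewrite mulrDl mulrDr -scalerAl -scalerAr opprD addrACA scalerBr.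
Qed.

Section NappiWittenOperators.
Context (K : fieldType) (W : algType K) (ell cc dd : K).

(** Each pair of basis families is listed in one order only, the other following by antisymmetry.
    Since [k] acts as [ell], central terms are scalars. The last six fields make [w] a highest
    weight vector. *)
Record nwrep (oa ob oc od : int -> lend W) (w : W) : Prop := NwRep {
  nwrep_aa : forall m n, oa m * oa n = oa n * oa m;
  nwrep_bb : forall m n, ob m * ob n = ob n * ob m;
  nwrep_cc : forall m n, oc m * oc n = oc n * oc m;
  nwrep_dd : forall m n, od m * od n = od n * od m;
  nwrep_ca : forall m n, oc m * oa n = oa n * oc m;
  nwrep_cb : forall m n, oc m * ob n = ob n * oc m;
  nwrep_ab : forall m n, oa m * ob n - ob n * oa m
    = oc (m + n) + (if m + n == 0 then m%:~R * ell else 0)%:A;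
  nwrep_da : forall m n, od m * oa n - oa n * od m = oa (m + n);
  nwrep_db : forall m n, od m * ob n - ob n * od m = - ob (m + n);
  nwrep_cd : forall m n, oc m * od n - od n * oc m
    = (if m + n == 0 then m%:~R * ell else 0)%:A;
  nwrep_a0 : forall n : nat, oa n w = 0;
  nwrep_b0 : forall n : nat, ob n.+1 w = 0;
  nwrep_c0 : forall n : nat, oc n.+1 w = 0;
  nwrep_d0 : forall n : nat, od n.+1 w = 0;
  nwrep_cw : oc 0 w = cc *: w;
  nwrep_dw : od 0 w = dd *: w
}.

Context (oa ob oc od : int -> lend W) (w : W) (H : nwrep oa ob oc od w).

Definition nwop (n : int) (x : nw K) : lend W :=
  nw_coord 0 x *: oa n + nw_coord 1 x *: ob n
  + nw_coord 2 x *: oc n + nw_coord 3 x *: od n.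

Arguments nwop : simpl never.

Fact nwop_linear n : linear (nwop n).
Proof.
move=> k x y; rewrite /nwop !linearP !scalerDl !scalerDr !scalerA.
by rewrite (addrACA (_ *: oa n)) (addrACA (_ *: oa n + _)) (addrACA (_ *: oa n + _ + _)).
Qed.
HB.instance Definition _ n := GRing.isLinear.Build K (nw K) (lend W) *:%R (nwop n)
  (nwop_linear n).

Lemma nwop_basis n : (nwop n (nw_a K) = oa n) * (nwop n (nw_b K) = ob n)
  * (nwop n (nw_c K) = oc n) * (nwop n (nw_d K) = od n).
Proof.
by rewrite /nwop !nw_vecE !scale0r !scale1r !addr0 !add0r.
Qed.

Lemma nwE (x : nw K) : x = nw_coord 0 x *: nw_a K + nw_coord 1 x *: nw_b K
  + nw_coord 2 x *: nw_c K + nw_coord 3 x *: nw_d K.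
Proof. by apply: nwP; rewrite !linearD !linearZ /= !nw_vecE; ring. Qed.

Lemma nw_ind (Q : nw K -> Prop) : (forall k x y, Q x -> Q y -> Q (k *: x + y)) ->
  Q (nw_a K) -> Q (nw_b K) -> Q (nw_c K) -> Q (nw_d K) -> forall x, Q x.
Proof.
move=> QP Qa Qb Qc Qd x; rewrite [x]nwE.
have Q0 : Q 0 by have := QP (-1) _ _ Qa Qa; rewrite scaleN1r addNr.
have QZ k y : Q y -> Q (k *: y) by move=> Qy; rewrite -[_ *: _]addr0; exact: QP.
have QD y z : Q y -> Q z -> Q (y + z) by move=> *; rewrite -[y]scale1r; exact: QP.
exact: (QD _ _ (QD _ _ (QD _ _ (QZ _ _ Qa) (QZ _ _ Qb)) (QZ _ _ Qc)) (QZ _ _ Qd)).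
Qed.

Lemma nw_br_antisym (x y : nw K) : lie_br y x = - lie_br x y.
Proof. by apply: nwP; rewrite raddfN /lie_br /= /nw_br !nw_vecE; ring. Qed.

(** Both sides are bilinear in [x] and [y] and change sign together when the factors are exchanged,
    so the ten relations of [nwrep] settle all sixteen pairs of basis vectors. *)
Lemma nwop_br m n x y : nwop (m + n) (lie_br x y)
    + (if m + n == 0 then m%:~R * nw_form x y * ell else 0)%:A
  = nwop m x * nwop n y - nwop n y * nwop m x.
Proof.
pose Q m n x y := nwop (m + n) (lie_br x y)
    + (if m + n == 0 then m%:~R * nw_form x y * ell else 0)%:A
  = nwop m x * nwop n y - nwop n y * nwop m x.
have QP k u v z m' n' : Q m' n' u z -> Q m' n' v z -> Q m' n' (k *: u + v) z.
  rewrite /Q lie_br_linearl nw_form_linearl !linearP /= commutator_linearl => <- <-.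
  move: (nwop _ (lie_br u z)) (nwop _ (lie_br v z)) => U V.
  rewrite scalerDr scalerA [RHS]addrACA; congr (_ + _); rewrite -scalerDl; congr (_ *: _).
  by case: ifP => _; ring.
have Qsym m' n' u v : Q m' n' u v -> Q n' m' v u.
  rewrite /Q => Quv; rewrite -opprB -Quv opprD nw_br_antisym linearN addrC.
  rewrite [n' + m']addrC addrC; congr (_ + _); rewrite -scaleNr nw_form_sym.
  congr (_ *: _); case: eqP => [/eqP|_]; rewrite ?oppr0 //.
  by rewrite addrC addr_eq0 => /eqP ->; rewrite rmorphN /=; ring.
have e : (if m + n == 0 then m%:~R * 0 * ell else 0) = 0.
  by rewrite mulr0 mul0r if_same.
have {}e m' n' : ((if m' + n' == 0 then m'%:~R * 0 * ell else 0) = 0) * 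
  ((if m' + n' == 0 then m'%:~R * 1 * ell else 0) = (if m' + n' == 0 then m'%:~R * ell else 0)).
  by rewrite mulr0 mul0r if_same mulr1.
have b := nw_br_basis K; have f := nw_form_basis K.
have aa m' n' : Q m' n' (nw_a K) (nw_a K).
  by rewrite /Q lie_br_alt f !nwop_basis e linear0 scale0r addr0 (nwrep_aa H) subrr.
have bb m' n' : Q m' n' (nw_b K) (nw_b K).
  by rewrite /Q lie_br_alt f !nwop_basis e linear0 scale0r addr0 (nwrep_bb H) subrr.
have cc' m' n' : Q m' n' (nw_c K) (nw_c K).
  by rewrite /Q lie_br_alt f !nwop_basis e linear0 scale0r addr0 (nwrep_cc H) subrr.
have dd' m' n' : Q m' n' (nw_d K) (nw_d K).
  by rewrite /Q lie_br_alt f !nwop_basis e linear0 scale0r addr0 (nwrep_dd H) subrr.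
have ab m' n' : Q m' n' (nw_a K) (nw_b K).
  by rewrite /Q b f !nwop_basis e (nwrep_ab H).
have ca m' n' : Q m' n' (nw_c K) (nw_a K).
  by rewrite /Q b nw_form_sym f !nwop_basis e linear0 scale0r addr0 (nwrep_ca H) subrr.
have cb m' n' : Q m' n' (nw_c K) (nw_b K).
  by rewrite /Q b nw_form_sym f !nwop_basis e linear0 scale0r addr0 (nwrep_cb H) subrr.
have da m' n' : Q m' n' (nw_d K) (nw_a K).
  by rewrite /Q b nw_form_sym f !nwop_basis e scale0r addr0 (nwrep_da H).
have db m' n' : Q m' n' (nw_d K) (nw_b K).
  by rewrite /Q b nw_form_sym f linearN /= !nwop_basis e scale0r addr0 (nwrep_db H).
have cd m' n' : Q m' n' (nw_c K) (nw_d K).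
  by rewrite /Q b f !nwop_basis e linear0 add0r (nwrep_cd H).
have QPr k u v z m' n' : Q m' n' z u -> Q m' n' z v -> Q m' n' z (k *: u + v).
  by move=> /Qsym Qu /Qsym Qv; apply/Qsym/QP.
rewrite -[_ = _]/(Q m n x y).
elim/nw_ind: x => [k u v Qu Qv||||]; first exact: QP.
- elim/nw_ind: y => [k u v Qu Qv||||]; first exact: QPr.
  + exact: aa.
  + exact: ab.
  + exact/Qsym/ca.
  + exact/Qsym/da.
- elim/nw_ind: y => [k u v Qu Qv||||]; first exact: QPr.
  + exact/Qsym/ab.
  + exact: bb.
  + exact/Qsym/cb.
  + exact/Qsym/db.
- elim/nw_ind: y => [k u v Qu Qv||||]; first exact: QPr.
  + exact: ca.
  + exact: cb.
  + exact: cc'.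
  + exact: cd.
- elim/nw_ind: y => [k u v Qu Qv||||]; first exact: QPr.
  + exact: da.
  + exact: db.
  + exact/Qsym/cd.
  + exact: dd'.
Qed.

Definition affnw_op (x : affnw K) : lend W :=
  \sum_(n <- loop_supp x.1) nwop n (loop_coef x.1 n) + (ell * x.2)%:A.

Fact affnw_op_linear : linear affnw_op.
Proof.
move=> k x y; rewrite /affnw_op.
have -> := loop_sum_linear nwop_linear k x.1 y.1.
have -> : (k *: x + y).2 = k * x.2 + y.2 by [].
by rewrite mulrDr mulrCA scalerDl scalerDr scalerA addrACA.
Qed.

Lemma affnw_op_mode x n : affnw_op (affnw_mode x n) = nwop n x.
Proof. by rewrite /affnw_op (loop_sum_mono nwop_linear) mulr0 scale0r addr0. Qed.

Lemma affnw_op_k : affnw_op (affnw_k K) = ell%:A.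
Proof. by rewrite /affnw_op /loop_supp msupp0 big_nil add0r mulr1. Qed.

Lemma affnw_op_br x y :
  affnw_op (lie_br x y) = affnw_op x * affnw_op y - affnw_op y * affnw_op x.
Proof.
pose Q x y := affnw_op (lie_br x y) = affnw_op x * affnw_op y - affnw_op y * affnw_op x.
have opP := affnw_op_linear.
have op0 : affnw_op 0 = 0 by have := opP (-1) 0 0; rewrite !scaleN1r !addNr.
have opD u v : affnw_op (u + v) = affnw_op u + affnw_op v.
  by have := opP 1 u v; rewrite !scale1r.
have opZ k u : affnw_op (k *: u) = k *: affnw_op u.
  by have := opP k u 0; rewrite op0 !addr0.
have Ql u v z : Q u z -> Q v z -> Q (u + v) z.
  rewrite /Q => Qu Qv; have := lie_br_linearl z 1 u v; rewrite !scale1r => ->.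
  rewrite !opD Qu Qv; move: (affnw_op u) (affnw_op v) (affnw_op z) => U V Z.
  by rewrite mulrDl mulrDr opprD [RHS]addrACA.
have Qr u v z : Q z u -> Q z v -> Q z (u + v).
  rewrite /Q => Qu Qv; have := lie_br_linearr z 1 u v; rewrite !scale1r => ->.
  rewrite !opD Qu Qv; move: (affnw_op u) (affnw_op v) (affnw_op z) => U V Z.
  by rewrite mulrDl mulrDr opprD [RHS]addrACA.
have Qkl k z : Q (k *: affnw_k K) z.
  rewrite /Q; have := lie_br_linearl z k (affnw_k K) 0; rewrite !addr0 => ->.
  have -> : lie_br (affnw_k K) z = 0 by exact: affnw_br_kl.
  have -> : lie_br 0 z = 0 by have := lie_br_linearl z (-1) 0 0; rewrite !scaleN1r !addNr.
  rewrite scaler0 addr0 op0 opZ affnw_op_k scalerA -!scalerAl -!scalerAr mul1r mulr1.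
  by rewrite subrr.
have Qkr k z : Q z (k *: affnw_k K).
  rewrite /Q; have := lie_br_linearr z k (affnw_k K) 0; rewrite !addr0 => ->.
  have -> : lie_br z (affnw_k K) = 0 by exact: affnw_br_kr.
  have -> : lie_br z 0 = 0 by have := lie_br_linearr z (-1) 0 0; rewrite !scaleN1r !addNr.
  rewrite scaler0 addr0 op0 opZ affnw_op_k scalerA -!scalerAl -!scalerAr mul1r mulr1.
  by rewrite subrr.
rewrite -/(Q x y); elim/affnw_ind: x => [|u v Qu Qv|u m|k].
- by have := Qkl 0 y; rewrite scale0r.
- exact: Ql.
- elim/affnw_ind: y => [|v v' Qv Qv'|v n|k].
  + by have := Qkr 0 (affnw_mode u m); rewrite scale0r.
  + exact: Qr.
  + rewrite /Q; have -> : lie_br (affnw_mode u m) (affnw_mode v n) = _ := affnw_br_mode u m v n.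
    rewrite opD opZ affnw_op_k !affnw_op_mode -nwop_br; congr (_ + _).
    by rewrite scalerA; congr (_ *: _); case: ifP => _; rewrite ?mul0r.
  + exact: Qkr.
- exact: Qkl.
Qed.

Definition affnw_rep : lieRep (affnw K) (lend W) := LieRep affnw_op_linear affnw_op_br.

Definition affnw_mod : lmodType (env (affnw K)) := restr (env_lift affnw_rep) (lendmod W).

Lemma affnw_mod_gen x (u : affnw_mod) : env_gen x *: u = affnw_op x u.
Proof. by rewrite [LHS]/(env_lift affnw_rep (env_gen x) u) env_lift_gen. Qed.

Lemma affnw_mod_const k (u : affnw_mod) : k%:A *: u = k *: (u : W).
Proof. by rewrite [LHS]/(env_lift affnw_rep k%:A u) env_lift_const. Qed.

Fact mode0_linear : linear (fun x : nw K => affnw_op (affnw_mode x 0)).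
Proof. by move=> k x y /=; rewrite !affnw_op_mode linearP. Qed.
Fact mode0_br (x y : nw K) : affnw_op (affnw_mode (lie_br x y) 0)
  = affnw_op (affnw_mode x 0) * affnw_op (affnw_mode y 0)
    - affnw_op (affnw_mode y 0) * affnw_op (affnw_mode x 0).
Proof.
rewrite !affnw_op_mode -nwop_br addr0 eqxx !mul0r scale0r addr0 //.
Qed.
Definition nw_rep : lieRep (nw K) (lend W) := LieRep mode0_linear mode0_br.
Definition nw_mod : lmodType (env (nw K)) := restr (env_lift nw_rep) (lendmod W).

Lemma nw_mod_gen x (u : nw_mod) : env_gen x *: u = nwop 0 x u.
Proof.
rewrite [LHS]/(env_lift nw_rep (env_gen x) u) env_lift_gen.
by rewrite [LHS]/(affnw_op (affnw_mode x 0) u) affnw_op_mode.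
Qed.

Lemma nw_mod_const k (u : nw_mod) : k%:A *: u = k *: (u : W).
Proof. by rewrite [LHS]/(env_lift nw_rep k%:A u) env_lift_const. Qed.

Definition psi0 (k : char_module cc dd) : nw_mod := (k : K) *: w.
Fact psi0_zmod : zmod_morphism psi0.
Proof. by move=> k l; exact: (scalerBl (k : K) l w). Qed.
HB.instance Definition _ := GRing.isZmodMorphism.Build (char_module cc dd) nw_mod psi0 psi0_zmod.

Lemma psi0Z b k : psi0 (b *: k) = env_incl b *: psi0 k.
Proof.
elim/env_ind: b k => [l|x|u v IHu IHv|u v IHu IHv] k.
- have -> : env_incl (l%:A : env (lsub (borel K))) = l%:A by exact: env_lift_const.
  rewrite nw_mod_const.
  have -> : l%:A *: k = l *: (k : K^o) :> K.
    by rewrite [LHS]/(env_lift (borel_rep cc dd) l%:A * (k : K)) env_lift_const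
      [_%:A]mulr1.
  by rewrite /psi0 scalerA.
- rewrite env_incl_gen nw_mod_gen.
  have -> : env_gen x *: k = borel_char cc dd x * (k : K) :> K.
    by rewrite [LHS]/(env_lift (borel_rep cc dd) (env_gen x) * (k : K)) env_lift_gen.
  transitivity ((k : K) *: ((borel_char cc dd x : K) *: w)); first by rewrite scalerA mulrC.
  rewrite /psi0 lend_vecZ.
  congr ((k : K) *: (_ : W)).
  rewrite /nwop /=; have /eqP -> := valP x; rewrite scale0r (nwrep_a0 H 0).
  rewrite (nwrep_cw H) (nwrep_dw H) scaler0 !add0r !scalerA -scalerDl.
  by rewrite /borel_char ![_ * nw_coord _ _]mulrC.
- by rewrite rmorphD !scalerDl raddfD /= IHu IHv.
- by rewrite rmorphM -!scalerA IHu IHv.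
Qed.
Definition psi (m : verma cc dd) : nw_mod := tensor_lift psi0 m.

Fact psi_linear : linear psi.
Proof. exact: (tensor_lift_linear psi0Z). Qed.
HB.instance Definition _ := GRing.isLinear.Build (env (nw K)) (verma cc dd) nw_mod *:%R psi
  psi_linear.

Lemma psiZ a m : psi (a *: m) = a *: psi m.
Proof. exact: linearZ. Qed.

(** The bracket of a positive mode with a zero mode is a positive mode of the same index, without
    central term. Hence being killed by all positive modes passes from [f] to the [H_4]-submodule it
    generates. *)
Lemma nw_mod_positive (a : env (nw K)) (f : nw_mod) :
  (forall (n : nat) y, nwop n.+1 y f = 0) ->
  forall (n : nat) y, nwop n.+1 y (a *: f : nw_mod) = 0.
Proof.
elim/env_ind: a f => [k|x|a b IHa IHb|a b IHa IHb] f f0 n y.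
- by rewrite nw_mod_const lend_vecZ f0 scaler0.
- rewrite nw_mod_gen.
  have := nwop_br n.+1 0 y x; rewrite addr0 /= scale0r addr0 => /eqP.
  rewrite eq_sym subr_eq => /eqP e.
  transitivity ((nwop n.+1 y * nwop 0 x) f); first by [].
  by rewrite e lendDE lendME !f0 lend_vec0 addr0.
- by rewrite scalerDl lend_vecD IHa // IHb // addr0.
- by rewrite -scalerA; apply: IHa => *; exact: IHb.
Qed.

Lemma psi_positive m (n : nat) y : nwop n.+1 y (psi m) = 0.
Proof.
elim/tensor_ind: m => [a k|u v IHu IHv|u IHu|].
- rewrite /psi (tensor_lift_pure psi0Z); apply: nw_mod_positive => {}n {}y.
  rewrite /psi0 lend_vecZ /nwop /= (nwrep_a0 H n.+1) (nwrep_b0 H) (nwrep_c0 H) (nwrep_d0 H).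
  by rewrite !scaler0 !addr0 scaler0.
- by rewrite linearD lend_vecD IHu IHv addr0.
- by rewrite linearN lend_vecN IHu oppr0.
- by rewrite linear0 lend_vec0.
Qed.

Definition psi1 (m : restr (env_lift (affnw_ev_rep ell)) (verma cc dd)) : affnw_mod := psi m.
Fact psi1_zmod : zmod_morphism psi1.
Proof. by move=> u v; exact: (raddfB psi). Qed.
HB.instance Definition _ := GRing.isZmodMorphism.Build
  (restr (env_lift (affnw_ev_rep ell)) (verma cc dd)) affnw_mod psi1 psi1_zmod.

(** The evaluation [affnw_ev] discards positive modes; the operators agree with this because
    [psi_positive] makes these modes vanish on the image of the Verma module of [H_4]. *)
Lemma psi1Z b m : psi1 (b *: m) = env_incl b *: psi1 m.
Proof.
elim/env_ind: b m => [l|x|u v IHu IHv|u v IHu IHv] m.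
- have -> : env_incl (l%:A : env (lsub (affnw_ge0 K))) = l%:A by exact: env_lift_const.
  rewrite affnw_mod_const.
  rewrite [l%:A *: m]/(env_lift (affnw_ev_rep ell) l%:A *: (m : verma cc dd)) env_lift_const.
  by rewrite /psi1 linearZ /= nw_mod_const.
- rewrite env_incl_gen affnw_mod_gen.
  rewrite [_ *: m]/(env_lift (affnw_ev_rep ell) (env_gen x) *: (m : verma cc dd)) env_lift_gen.
  rewrite /psi1 psiZ [_ *: psi m]scalerDl nw_mod_gen nw_mod_const /affnw_op.
  have f0 n : n < 0 -> loop_coef (val x).1 n = 0 by move/asboolP: (valP x); apply.
  rewrite [RHS]lendDE [X in _ = _ + X]lendZE; congr (_ + _); rewrite lend_sumE.
  have F0 n : n != 0 -> nwop n (loop_coef (val x).1 n) (psi m) = 0.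
    case: n => [[//|n]|n] _; first exact: psi_positive.
    by rewrite f0 // linear0.
  case: (boolP (0 \in loop_supp (val x).1)) => f00.
    rewrite (bigD1_seq 0) ?fset_uniq //; rewrite big1 => [|n]; last exact: F0.
    exact/esym/addr0.
  rewrite big_seq big1 => [|n nf].
    by rewrite (loop_coef_out f00) linear0.
  by apply: F0; apply: contraTneq nf => ->.
- by rewrite rmorphD !scalerDl raddfD /= IHu IHv.
- by rewrite rmorphM -!scalerA IHu IHv.
Qed.

(** Two inductions follow one another: [psi] extends the assignment of [w] to the highest weight
    vector over the Verma module of [H_4], and this map extends that one to the affine algebra. *)
Definition affnw_lift (u : affnw_verma ell cc dd) : affnw_mod := tensor_lift psi1 u.
Fact affnw_lift_linear : linear affnw_lift.
Proof. exact: (tensor_lift_linear psi1Z). Qed.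
HB.instance Definition _ := GRing.isLinear.Build (env (affnw K)) (affnw_verma ell cc dd)
  affnw_mod *:%R affnw_lift affnw_lift_linear.

Lemma affnw_lift_hwv : affnw_lift (affnw_hwv ell cc dd) = w.
Proof.
rewrite /affnw_lift (tensor_lift_pure psi1Z) scale1r /psi1.
apply: etrans (tensor_lift_pure psi0Z _ _) _; rewrite scale1r; exact: (scale1r w).
Qed.

Lemma affnw_lift_mode x n u : affnw_lift (env_gen (affnw_mode x n) *: u) = nwop n x (affnw_lift u).
Proof. by rewrite linearZ /= affnw_mod_gen affnw_op_mode. Qed.

Lemma affnw_lift_const k u : affnw_lift (k%:A *: u) = k *: (affnw_lift u : W).
Proof. by rewrite linearZ /= affnw_mod_const. Qed.

End NappiWittenOperators.

(** * Polynomials and their derivations *)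

Section Monomials.
Context (I : choiceType).
Implicit Types (m : {cmonom I}).

Lemma cmonom_eqP m1 m2 : m1 =1 m2 -> m1 = m2.
Proof. by move=> e; apply/eqP/cmP. Qed.

Lemma cmonom_divK m i : (0 < m i)%N -> mmul (ucm i) (divcm m (ucm i)) = m.
Proof.
move=> mi; apply: cmonom_eqP => j; rewrite cmM divcmE cmU.
by case: eqP => [<-|_]; rewrite ?add0n ?subn0 // subnKC.
Qed.

Lemma cmonom_mulK m i : divcm (mmul (ucm i) m) (ucm i) = m.
Proof. by apply: cmonom_eqP => j; rewrite divcmE cmM cmU addKn. Qed.

Lemma cmonom_ind (Q : {cmonom I} -> Prop) :
  Q mone -> (forall i m, Q m -> Q (mmul (ucm i) m)) -> forall m, Q m.
Proof.
move=> Q1 QU m; elim/ltn_ind: {m}(mdeg m) {-2}m (erefl (mdeg m)) => d IH m md.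
have [->//|m1] := m =P mone.
have [i mi] : exists i, (0 < m i)%N.
  apply: contrapT => /forallNP m0; case: m1; apply: cmonom_eqP => i.
  by rewrite cm1; apply/eqP; rewrite -leqn0 leqNgt; apply/negP; exact: m0.
rewrite -(cmonom_divK mi); apply: QU; apply: (IH _ _ _ erefl).
by rewrite -md -{2}(cmonom_divK mi) mdegM mdegU.
Qed.

End Monomials.

(* The polynomial algebra [{malg K[{cmonom I}]}] is only used through this
   interface: it is far too easily unfolded by unification otherwise. *)
Record polyalg (K : fieldType) (I : choiceType) := PolyAlg {
  polyalg_sort :> comAlgType K;
  pmon : {cmonom I} -> polyalg_sort;
  pcoef : {cmonom I} -> polyalg_sort -> K;
  psupp : polyalg_sort -> seq {cmonom I};
  pmon1 : pmon mone = 1;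
  pmonM : forall m m', pmon m * pmon m' = pmon (mmul m m');
  pcoefP : forall m k f g, pcoef m (k *: f + g) = k * pcoef m f + pcoef m g;
  pcoef_mon : forall m m', pcoef m (pmon m') = (m' == m)%:R;
  psupp_uniq : forall f, uniq (psupp f);
  mem_psupp : forall f m, (m \in psupp f) = (pcoef m f != 0);
  polyE : forall f, f = \sum_(m <- psupp f) pcoef m f *: pmon m;
  polyP : forall f g, (forall m, pcoef m f = pcoef m g) -> f = g
}.

Lemma polyalg_exists (K : fieldType) (I : choiceType) : polyalg K I.
Proof.
pose P := {malg K[{cmonom I}]} : comAlgType K.
pose mon (m : {cmonom I}) : P := << 1 *g m >>.
pose coef (m : {cmonom I}) (f : P) := (f : {malg K[{cmonom I}]})@_m.
apply: (@PolyAlg K I P mon coef (fun f => msupp (f : {malg K[{cmonom I}]}))).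
- by [].
- move=> m m'; rewrite /mon [LHS]malgM_def fgmulUU; congr << _ *g _ >>; exact: mulr1.
- by move=> m k f g; rewrite /coef mcoeffD; congr (_ + _); exact: mcoeffZ.
- by move=> m m'; exact: mcoeffU1.
- by move=> f; exact: fset_uniq.
- by move=> f m; rewrite -mcoeff_neq0.
- move=> f; rewrite [LHS]monalgE; apply: eq_bigr => m _.
  apply/malgP => m'; rewrite [LHS]mcoeffU [RHS]mcoeffZ [X in _ * X]mcoeffU1.
  by rewrite mulr_natr.
- by move=> f g fg; apply/malgP.
Qed.

Section Polynomials.
Context (K : numFieldType) (I : choiceType) (P : polyalg K I).
Implicit Types (f g : P) (m : {cmonom I}).

Definition pvar (i : I) : P := pmon P (ucm i).

Lemma pvar_mon i m : pvar i * pmon P m = pmon P (mmul (ucm i) m).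
Proof. exact: pmonM. Qed.

Lemma poly_mon_ind (Q : P -> Prop) :
  (forall k f g, Q f -> Q g -> Q (k *: f + g)) -> (forall m, Q (pmon P m)) ->
  forall f, Q f.
Proof.
move=> QP Qm f.
have Q0 : Q 0 by have := QP (-1) _ _ (Qm mone) (Qm mone); rewrite scaleN1r addNr.
rewrite (polyE f); apply: (big_rec Q) => [|m g _ Qg]; first exact: Q0.
exact: QP (Qm m) Qg.
Qed.

Lemma poly_ind (Q : P -> Prop) :
  (forall k f g, Q f -> Q g -> Q (k *: f + g)) -> Q 1 ->
  (forall i f, Q f -> Q (pvar i * f)) -> forall f, Q f.
Proof.
move=> QP Q1 QX; apply: poly_mon_ind => [|m]; first exact: QP.
elim/cmonom_ind: m => [|i m Qm]; first by rewrite pmon1.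
by rewrite -pvar_mon; exact: QX.
Qed.

Lemma pcoef0 m : pcoef m (0 : P) = 0.
Proof. by have := pcoefP m (-1) (0 : P) 0; rewrite scaleN1r addNr mulN1r addNr. Qed.

Lemma pcoefZ m k f : pcoef m (k *: f) = k * pcoef m f.
Proof. by have := pcoefP m k f 0; rewrite !addr0 pcoef0 addr0. Qed.

Lemma pcoefD m f g : pcoef m (f + g) = pcoef m f + pcoef m g.
Proof. by have := pcoefP m 1 f g; rewrite scale1r mul1r. Qed.

Lemma pcoef1 m : pcoef m (1 : P) = (m == mone)%:R.
Proof. by rewrite -pmon1 pcoef_mon eq_sym. Qed.

Lemma pcoef_sum (J : Type) (s : seq J) (Q : pred J) (F : J -> P) m :
  pcoef m (\sum_(j <- s | Q j) F j) = \sum_(j <- s | Q j) pcoef m (F j).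
Proof. by rewrite (big_morph _ (pcoefD m) (pcoef0 m)). Qed.

Lemma pmulP (h : P) k f g : h * (k *: f + g) = k *: (h * f) + h * g.
Proof. by rewrite mulrDr scalerAr. Qed.

Lemma pcoef_varM i f m :
  pcoef m (pvar i * f) = if m i == 0%N then 0 else pcoef (divcm m (ucm i)) f.
Proof.
elim/poly_mon_ind: f => [k f g IHf IHg|n].
  by rewrite pmulP !pcoefP IHf IHg; case: ifP => // _; rewrite mulr0 addr0.
rewrite pvar_mon !pcoef_mon.
have -> : (mmul (ucm i) n == m) = (m i != 0%N) && (n == divcm m (ucm i)).
  apply/eqP/andP => [<-|[mi /eqP ->]].
    by rewrite cmonom_mulK eqxx cmM cmUU.
  by rewrite cmonom_divK // lt0n.
by case: eqP.
Qed.

Fact pmul_linear (f : P) : linear (fun g => f * g).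
Proof. by move=> k u v; exact: pmulP. Qed.
Definition mulop f : lend P := Lend (pmul_linear f).

(** Where [m i = 0] the division by the variable is truncated, but the coefficient is 0, so the term
    is harmless. *)
Definition pder_fun i f : P :=
  \sum_(m <- psupp f) (pcoef m f * (m i)%:R) *: pmon P (divcm m (ucm i)).

Lemma pcoef_der_fun i f m : pcoef m (pder_fun i f) = (m i).+1%:R * pcoef (mmul (ucm i) m) f.
Proof.
rewrite /pder_fun pcoef_sum.
have E m' : pcoef m ((pcoef m' f * (m' i)%:R) *: pmon P (divcm m' (ucm i)))
    = if m' == mmul (ucm i) m then (m i).+1%:R * pcoef m' f else 0.
  rewrite pcoefZ pcoef_mon; case: (m' =P _) => [->|ne].
    by rewrite cmonom_mulK eqxx mulr1 cmM cmUU add1n mulrC.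
  case: (posnP (m' i)) => [->|m'i]; first by rewrite mulr0 mul0r.
  by case: eqP => [e|_]; [case: ne; rewrite -e cmonom_divK | rewrite mulr0].
rewrite (eq_bigr _ (fun m' _ => E m')) -big_mkcond.
set M := mmul (ucm i) m.
have [f0|fn0] := eqVneq (pcoef M f) 0.
  by rewrite f0 mulr0 big1 // => m' /eqP ->; rewrite f0 mulr0.
rewrite -big_filter (bigD1_seq M) /=; last 2 first.
- by rewrite mem_filter eqxx mem_psupp.
- exact/filter_uniq/psupp_uniq.
rewrite big_seq_cond big1 ?addr0 // => m'.
by rewrite mem_filter => /andP[/andP[/eqP -> _]]; rewrite eqxx.
Qed.

Fact pder_linear i : linear (pder_fun i).
Proof.
move=> k f g; apply: polyP => m.
by rewrite pcoefP !pcoef_der_fun pcoefP mulrDr mulrCA.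
Qed.
Definition pder i : lend P := Lend (pder_linear i).

Lemma pcoef_der i f m : pcoef m (pder i f) = (m i).+1%:R * pcoef (mmul (ucm i) m) f.
Proof. exact: pcoef_der_fun. Qed.

Lemma pder_varM i j f :
  pder i (pvar j * f) = (if i == j then f else 0) + pvar j * pder i f.
Proof.
apply: polyP => m; rewrite pcoefD pcoef_der !pcoef_varM pcoef_der cmM cmU.
case: (i =P j) => [<-|ne].
  rewrite add1n /= cmonom_mulK; case: (posnP (m i)) => [->|mi].
    by rewrite mul1r addr0.
  rewrite cmonom_divK // divcmE cmUU subn1 prednK //.
  by rewrite -add1n natrD mulrDl mul1r.
have /negPf ij : j != i by apply/eqP => /esym.
rewrite add0n pcoef0 add0r; case: (posnP (m j)) => [_|mj].
  by rewrite mulr0.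
rewrite divcmE cmU ij subn0; congr (_ * pcoef _ _).
apply: cmonom_eqP => l; rewrite divcmE !cmM divcmE !cmU.
by case: (j =P l) => [<-|_]; rewrite ?subn0 // addnBA.
Qed.

Lemma pder1 i : pder i (1 : P) = 0.
Proof.
apply: polyP => m; rewrite pcoef_der pcoef1 pcoef0.
case: eqP => [/(congr1 (fun m : {cmonom I} => m i))|_]; last by rewrite mulr0.
by rewrite cmM cmUU cm1.
Qed.

Lemma pderM i f g : pder i (f * g) = pder i f * g + f * pder i g.
Proof.
elim/poly_ind: f => [k f f' IHf IHf'||j f IH].
- rewrite mulrDl -scalerAl !(lend_vecD, lend_vecZ) IHf IHf' !mulrDl -!scalerAl scalerDr.
  exact: addrACA.
- by rewrite pder1 mul0r add0r !mul1r.
- rewrite -mulrA !pder_varM IH !mulrDr !mulrDl !mulrA addrA; congr (_ + _ + _).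
  by case: eqP => // _; rewrite mul0r.
Qed.

Lemma pderC i j f : pder i (pder j f) = pder j (pder i f).
Proof.
apply: polyP => m; rewrite !pcoef_der !cmM !cmU.
have -> : mmul (ucm i) (mmul (ucm j) m) = mmul (ucm j) (mmul (ucm i) m).
  by apply: cmonom_eqP => l; rewrite !cmM addnCA.
rewrite [j == i]eq_sym; case: eqP => [->//|_]; rewrite !add0n; exact: mulrCA.
Qed.

(** Differentiation multiplies coefficients by positive integers, which are invertible in
    characteristic zero. *)
Lemma pder_eq0P i f : pder i f = 0 <-> forall m, pcoef m f != 0 -> m i = 0%N.
Proof.
split=> [d0 m|f0].
  apply: contraNeq; rewrite -lt0n => mi.
  have := congr1 (pcoef (divcm m (ucm i))) d0.
  rewrite pcoef_der pcoef0 cmonom_divK // => /eqP.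
  by rewrite mulf_eq0 pnatr_eq0.
apply: polyP => m; rewrite pcoef_der pcoef0.
have [->|/f0] := eqVneq (pcoef (mmul (ucm i) m) f) 0; first by rewrite mulr0.
by rewrite cmM cmUU.
Qed.

(** A polynomial involves finitely many variables. This is the source of the truncation property of
    [fa] and [fb]. *)
Lemma pder_locfin (v : nat -> I) f : injective v ->
  exists N, forall n, (N <= n)%N -> pder (v n) f = 0.
Proof.
move=> v_inj; elim/poly_ind: f => [k f g [N fN] [M gM]||j f [N fN]].
- exists (maxn N M) => n; rewrite geq_max => /andP[/fN f0 /gM g0].
  by rewrite lend_vecD lend_vecZ f0 g0 scaler0 addr0.
- by exists 0%N => n _; rewrite pder1.
- have [[n0 vn0]|nv] := pselect (exists n0, v n0 = j).
    exists (maxn N n0.+1) => n; rewrite geq_max => /andP[/fN f0 n0n].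
    rewrite pder_varM f0 mulr0 addr0 -vn0 inj_eq //.
    by case: eqP n0n => // ->; rewrite ltnn.
  exists N => n /fN f0; rewrite pder_varM f0 mulr0 addr0.
  by case: eqP => // e; case: nv; exists n.
Qed.

Definition psupported (S : {cmonom I} -> Prop) f : Prop :=
  forall m, pcoef m f != 0 -> S m.

Lemma psupportedP S k f g :
  psupported S f -> psupported S g -> psupported S (k *: f + g).
Proof.
move=> Sf Sg m; rewrite pcoefP.
have [->|/Sf//] := eqVneq (pcoef m f) 0; have [->|/Sg//] := eqVneq (pcoef m g) 0.
by rewrite mulr0 addr0 => /eqP.
Qed.

Lemma psupported0 S : psupported S 0.
Proof. by move=> m; rewrite pcoef0 => /eqP. Qed.

Lemma psupported_varM (S S' : {cmonom I} -> Prop) i f :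
  (forall m, S m -> S' (mmul (ucm i) m)) -> psupported S f -> psupported S' (pvar i * f).
Proof.
move=> SS' Sf m; rewrite pcoef_varM; case: (m i =P 0%N) => [_ /eqP//|/eqP].
by rewrite -lt0n => mi /Sf/SS'; rewrite cmonom_divK.
Qed.

Lemma psupported_der (S S' : {cmonom I} -> Prop) i f :
  (forall m, S (mmul (ucm i) m) -> S' m) -> psupported S f -> psupported S' (pder i f).
Proof.
move=> SS' Sf m; rewrite pcoef_der mulf_eq0 negb_or => /andP[_].
by move/Sf/SS'.
Qed.

End Polynomials.

(** * Locally finite infinite sums of operators *)

Section LocallyFinite.
Context (K : fieldType) (V : algType K).

Implicit Types (F G : nat -> lend V) (X : lend V).

Definition locfin (F : nat -> lend V) : Prop :=
  forall v, exists N, forall n, (N <= n)%N -> F n v = 0.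

(** The bound is chosen classically; any valid bound gives the same value by [lfsum_funE], and the
    default 0 is never met for a locally finite family. *)
Definition lfsum_fun (F : nat -> lend V) (v : V) : V :=
  if pselect (exists N, forall n, (N <= n)%N -> F n v = 0) is left h
  then \sum_(n < proj1_sig (cid h)) F n v else 0.

Lemma lfsum_funE F (v : V) N : (forall n, (N <= n)%N -> F n v = 0) ->
  lfsum_fun F v = \sum_(n < N) F n v.
Proof.
have widen M M' : (M <= M')%N -> (forall n, (M <= n)%N -> F n v = 0) ->
    \sum_(n < M) F n v = \sum_(n < M') F n v.
  move=> MM' F0; rewrite -!(big_mkord predT (fun n => F n v)) [RHS](big_cat_nat (n := M)) //=.
  rewrite [X in _ = _ + X]big_nat_cond [X in _ = _ + X]big1 ?addr0 //.
  by move=> n /andP[/andP[/F0]].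
move=> FN; rewrite /lfsum_fun; case: pselect => [h|]; last by case; exists N.
case: (cid h) => /= M FM.
rewrite (widen M (maxn M N)) ?leq_maxl //; rewrite [RHS](widen N (maxn M N)) ?leq_maxr //.
Qed.

Fact lfsum_linear F : locfin F -> linear (lfsum_fun F).
Proof.
move=> lf k u v; have [N FN] := lf u; have [M FM] := lf v.
have uM n : (maxn N M <= n)%N -> F n u = 0 by rewrite geq_max => /andP[/FN].
have vM n : (maxn N M <= n)%N -> F n v = 0 by rewrite geq_max => /andP[_ /FM].
rewrite (lfsum_funE uM) (lfsum_funE vM) (@lfsum_funE _ _ (maxn N M)).
  by rewrite scaler_sumr -big_split; apply: eq_bigr => n _; rewrite linearP.
by move=> n nM; rewrite lend_vecD lend_vecZ uM // vM // scaler0 addr0.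
Qed.

Definition lfsum F : lend V :=
  if pselect (locfin F) is left h then Lend (lfsum_linear h) else 0.

Lemma lfsumE F (v : V) N : locfin F -> (forall n, (N <= n)%N -> F n v = 0) ->
  lfsum F v = \sum_(n < N) F n v.
Proof. by rewrite /lfsum; case: pselect => // h _; exact: lfsum_funE. Qed.

(** A bracket with a fixed operator can be taken termwise once a common bound is found for [v] and
    [X v]. *)
Lemma lfsum_commutator X F G : locfin F -> locfin G ->
  (forall n, X * F n - F n * X = G n) -> X * lfsum F - lfsum F * X = lfsum G.
Proof.
move=> lF lG XFG; apply: lendP => v; rewrite [LHS]lendDE [X in _ + X = _]lendNE.
rewrite [X in X - _ = _]lendME [X in _ - X = _]lendME.
have [N FN] := lF v; have [M FM] := lF (X v).
have geN n : (maxn N M <= n)%N -> F n v = 0 by rewrite geq_max => /andP[/FN].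
have geM n : (maxn N M <= n)%N -> F n (X v) = 0 by rewrite geq_max => /andP[_ /FM].
have GE n : G n v = X (F n v) - F n (X v) by rewrite -XFG.
have geG n : (maxn N M <= n)%N -> G n v = 0.
  by move=> nN; rewrite GE geN // geM // lend_vec0 subr0.
rewrite (lfsumE lF geN) (lfsumE lF geM) (lfsumE lG geG) lend_vec_sum -sumrB.
by apply: eq_bigr => n _; rewrite GE.
Qed.

Lemma lfsumZ k F : locfin F -> lfsum (fun n => k *: F n) = k *: lfsum F.
Proof.
move=> lF; apply: lendP => v; have [N FN] := lF v.
have FkN n : (N <= n)%N -> (k *: F n) v = 0 by move=> /FN e; rewrite lendZE e scaler0.
rewrite lendZE (lfsumE lF FN) (lfsumE _ FkN); first by rewrite scaler_sumr.
move=> u; have [M FM] := lF u; exists M => n /FM e; by rewrite lendZE e scaler0.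
Qed.

Lemma lfsum_shift m F : locfin F ->
  lfsum (fun n => if (m < n)%N then F (n - m.+1)%N else 0) = lfsum F.
Proof.
move=> lF; apply: lendP => v; have [N FN] := lF v.
have shN u M : (forall n, (M <= n)%N -> F n u = 0) -> forall n, (m.+1 + M <= n)%N ->
    (if (m < n)%N then F (n - m.+1)%N else 0) u = 0.
  by move=> FM n nM; case: ifP => // mn; apply: FM; lia.
rewrite (lfsumE lF FN) (lfsumE _ (shN v N FN)); last first.
  by move=> u; have [M FM] := lF u; exists (m.+1 + M)%N; exact: shN.
rewrite big_split_ord /= big1 ?add0r => [|i _].
  by apply: eq_bigr => i _; rewrite leq_addr addKn.
by rewrite ltnNge -ltnS ltn_ord.
Qed.

Lemma lfsum0 : lfsum (fun _ => 0) = 0.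
Proof.
apply: lendP => v; rewrite (@lfsumE _ _ 0) ?big_ord0 // => u.
by exists 0%N.
Qed.

Lemma lfsum_comm X F : locfin F -> (forall n, X * F n = F n * X) ->
  X * lfsum F = lfsum F * X.
Proof.
move=> lF XF; apply/eqP; rewrite -subr_eq0; apply/eqP.
rewrite (lfsum_commutator (G := fun _ => 0) lF) ?lfsum0 //.
  by move=> u; exists 0%N.
by move=> n; rewrite XF subrr.
Qed.

End LocallyFinite.

(** * Free fields *)

Section FieldOperators.
Context (K : numFieldType) (I : choiceType) (P : polyalg K I).
Implicit Types (f g : P) (k l : int).

Lemma mulopE f g : mulop f g = f * g. Proof. by []. Qed.

Lemma pder_mul_comm i j : pder P i * mulop (pvar P j) - mulop (pvar P j) * pder P i
  = ((i == j)%:R : K)%:A.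
Proof.
apply: lendP => f; rewrite lendDE lendNE !lendME !mulopE pder_varM addrK.
by rewrite lendZE; case: eqP => _; rewrite ?scale1r ?scale0r.
Qed.

Lemma pder_pder_comm i j : pder P i * pder P j = pder P j * pder P i.
Proof. by apply: lendP => f; exact: pderC. Qed.

Lemma mulop_comm (f g : P) : mulop f * mulop g = mulop g * mulop f.
Proof. by apply: lendP => h; rewrite !lendME !mulopE mulrCA. Qed.

Lemma mulop_der_comm f i : pder P i f = 0 -> mulop f * pder P i = pder P i * mulop f.
Proof. by move=> f0; apply: lendP => g; rewrite !lendME !mulopE pderM f0 mul0r add0r. Qed.

(** The truncation condition on fields in vertex algebra theory; it makes products with power series
    in [z] well defined. *)
Definition lfield (y : int -> lend P) : Prop :=
  forall f, exists N : nat, forall n, (N <= n)%N -> y n f = 0.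

Lemma lfield_shift y f (k : int) : lfield y ->
  exists N : nat, forall i, (N <= i)%N -> y (k + i) f = 0.
Proof.
move=> /(_ f)[N yN]; exists (N + absz k)%N => i Ni.
have -> : k + i = (absz (k + i))%:Z by lia.
by apply: yN; lia.
Qed.

Lemma lfield_uniform y (F : nat -> P) M B (k : int) : lfield y ->
  exists2 N : nat, (B <= N)%N &
    forall j, (j < M)%N -> forall i, (N <= i)%N -> y (k + i) (F j) = 0.
Proof.
move=> ly; elim: M => [|M [N BN NF]]; first by exists B.
have [N' N'F] := lfield_shift (F M) k ly.
exists (maxn N N'); first by rewrite leq_max BN.
move=> j; rewrite ltnS leq_eqVlt => /predU1P[->|jM] i; rewrite geq_max => /andP[Ni N'i].
  exact: N'F.
exact: NF.
Qed.

(* The product of [\sum_i s_i z^i] with [y(z) = \sum_k y(k) z^(-k-1)]. *)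
Definition field (s : nat -> P) (y : int -> lend P) (k : int) : lend P :=
  lfsum (fun i => mulop (s i) * y (k + i)).

Lemma field_locfin s y k : lfield y -> locfin (fun i => mulop (s i) * y (k + i)).
Proof.
move=> ly f; have [N NF] := lfield_shift f k ly.
by exists N => n /NF e; rewrite lendME e lend_vec0.
Qed.

Lemma fieldE N s y k f : lfield y -> (forall i, (N <= i)%N -> y (k + i) f = 0) ->
  field s y k f = \sum_(i < N) s i * y (k + i) f.
Proof.
move=> ly yN; rewrite /field (lfsumE (N := N)) //; first exact: field_locfin.
by move=> n /yN e; rewrite lendME e lend_vec0.
Qed.

Lemma field_comm_op s y (X : lend P) k : lfield y ->
  (forall i, mulop (s i) * X = X * mulop (s i)) -> (forall k, y k * X = X * y k) ->
  field s y k * X = X * field s y k.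
Proof.
move=> ly sX yX; apply: lendP => f; rewrite !lendME.
have [N NF] := lfield_shift f k ly.
have yXE i g : y i (X g) = X (y i g) by rewrite -!lendME yX.
rewrite (fieldE _ ly NF) (fieldE (N := N)) //; last first.
  by move=> i /NF e; rewrite yXE e lend_vec0.
rewrite lend_vec_sum; apply: eq_bigr => i _; rewrite yXE.
by have := congr1 (fun F : lend P => F (y (k + i) f)) (sX i).
Qed.

(** With both products truncated, the commutator reduces to that of single modes, a scalar supported
    on total mode 0. The bounds depend on [f]; [B] allows them to be pushed beyond the diagonal
    carrying the scalars. *)
Lemma field_commutator s t y z (g : int -> K) k l f B :
  lfield y -> lfield z ->
  (forall i k, mulop (s i) * z k = z k * mulop (s i)) ->
  (forall j k, mulop (t j) * y k = y k * mulop (t j)) ->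
  (forall k l, y k * z l - z l * y k = (if k + l == 0 then g k else 0)%:A) ->
  exists N M : nat, [/\ (B <= N)%N, (B <= M)%N &
   field s y k (field t z l f) - field t z l (field s y k f)
   = \sum_(i < N) \sum_(j < M)
       (if k + l + (i + j)%N%:Z == 0 then g (k + i) else 0) *: (s i * t j * f)].
Proof.
move=> ly lz sz ty yz.
have szE i h j : z j (s i * h) = s i * z j h.
  by have := congr1 (fun F : lend P => F h) (sz i j).
have tyE i h j : y j (t i * h) = t i * y j h.
  by have := congr1 (fun F : lend P => F h) (ty i j).
have [M0 M0F] := lfield_shift f l lz.
(* Index 0 of the family is [f] itself and index [j.+1] its image under the mode [l + j], so one
   bound covers both kinds of vectors. *)
have [N BN NF] := lfield_uniform (fun j => if j is j'.+1 then z (l + j') f else f)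
  M0.+1 B k ly.
have [M BM MF] := lfield_uniform (fun i => if i is i'.+1 then y (k + i') f else f)
  N.+1 (maxn B M0) l lz.
exists N, M; split=> //; first by move: BM; rewrite geq_max => /andP[].
have fN i : (N <= i)%N -> y (k + i) f = 0 by exact: (NF 0%N).
have fM j : (M <= j)%N -> z (l + j) f = 0 by exact: (MF 0%N).
have zN (j i : nat) : (N <= i)%N -> y (k + i) (z (l + j) f) = 0.
  case: (ltnP j M0) => [jM0|/M0F ->]; last by rewrite lend_vec0.
  exact: (NF j.+1 jM0).
have yM (i j : nat) : (i < N)%N -> (M <= j)%N -> z (l + j) (y (k + i) f) = 0.
  by move=> iN; exact: (MF i.+1 iN).
rewrite (fieldE _ ly fN) (fieldE _ lz fM) !lend_vec_sum.
have XZ : \sum_(j < M) field s y k (t j * z (l + j) f)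
    = \sum_(i < N) \sum_(j < M) s i * t j * y (k + i) (z (l + j) f).
  rewrite exchange_big; apply: eq_bigr => j _.
  rewrite (fieldE (N := N)) //; last by move=> i Ni; rewrite tyE zN // mulr0.
  by apply: eq_bigr => i _; rewrite tyE mulrA.
have ZX : \sum_(i < N) field t z l (s i * y (k + i) f)
    = \sum_(i < N) \sum_(j < M) s i * t j * z (l + j) (y (k + i) f).
  apply: eq_bigr => i _.
  rewrite (fieldE (N := M)) //; last by move=> j Mj; rewrite szE yM // mulr0.
  by apply: eq_bigr => j _; rewrite szE mulrA [t j * _]mulrC.
rewrite XZ ZX -sumrB; apply: eq_bigr => i _; rewrite -sumrB; apply: eq_bigr => j _.
rewrite -mulrBr; have /(congr1 (fun F : lend P => F f)) := yz (k + i) (l + j).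
rewrite lendDE lendNE !lendME => ->; rewrite lendZE.
have -> : k + i + (l + j) = k + l + (i + j)%N%:Z by rewrite addrACA.
by rewrite scalerAr.
Qed.

End FieldOperators.

Definition gvar : Type := (nat + nat + (nat + nat))%type.
HB.instance Definition _ := Choice.on gvar.
Definition gA (n : nat) : gvar := inl (inl n).
Definition gB (n : nat) : gvar := inl (inr n).
Definition gC (n : nat) : gvar := inr (inl n).
Definition gD (n : nat) : gvar := inr (inr n).

Lemma gA_inj : injective gA. Proof. by move=> m n []. Qed.
Lemma gB_inj : injective gB. Proof. by move=> m n []. Qed.
Lemma gC_inj : injective gC. Proof. by move=> m n []. Qed.
Lemma gD_inj : injective gD. Proof. by move=> m n []. Qed.

Section FreeFields.
Context (K : numFieldType) (P : polyalg K gvar) (ell cc : K).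
Implicit Types (f g : P) (k l : int).
Local Notation xA n := (pvar P (gA n)).
Local Notation xB n := (pvar P (gB n)).
Local Notation xC n := (pvar P (gC n)).

Definition fa (k : int) : lend P :=
  match k with
  | Posz n => (n%:R * ell + cc) *: pder P (gB n)
  | Negz n => mulop (xA n)
  end.

(** Unlike for [fa], mode 0 is a multiplication: [b(0)] is the operator that generates the Verma
    module of [H_4] from its highest weight vector. *)
Definition fb (k : int) : lend P :=
  match k with
  | Posz 0 => mulop (xB 0)
  | Posz n.+1 => (n.+1%:R * ell - cc) *: pder P (gA n)
  | Negz n => mulop (xB n.+1)
  end.

Lemma commutatorZl (A : algType K) (c : K) (x y : A) :
  (c *: x) * y - y * (c *: x) = c *: (x * y - y * x).
Proof. by rewrite -scalerAl -scalerAr scalerBr. Qed.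

Lemma commutatorZr (A : algType K) (c : K) (x y : A) :
  x * (c *: y) - (c *: y) * x = c *: (x * y - y * x).
Proof. by rewrite -scalerAl -scalerAr scalerBr. Qed.

Lemma fa_fb k l : fa k * fb l - fb l * fa k
  = (if k + l == 0 then k%:~R * ell + cc else 0)%:A.
Proof.
have swap (A : algType K) (x y : A) : x * y - y * x = - (y * x - x * y) by rewrite opprB.
case: k => m; case: l => [[|n]|n]; rewrite /fa /fb.
- rewrite commutatorZl pder_mul_comm scalerA; congr (_ *: _).
  by rewrite addr0; case: m => [|m]; rewrite ?mulr0 // eqxx mulr1.
- have -> : (m%:Z + n.+1%:Z == 0) = false by lia.
  by rewrite commutatorZl commutatorZr pder_pder_comm subrr !scaler0 scale0r.
- rewrite commutatorZl pder_mul_comm scalerA; congr (_ *: _).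
  have -> : (gB m == gB n.+1) = (m == n.+1) by [].
  have -> : (m%:Z + Negz n == 0) = (m == n.+1) by lia.
  by case: eqP => [->|_]; rewrite ?mulr1 ?mulr0.
- by rewrite mulop_comm subrr scale0r.
- rewrite commutatorZr swap pder_mul_comm scalerN scalerA -scaleNr; congr (_ *: _).
  have -> : (gA n == gA m) = (n == m) by [].
  have -> : (Negz m + n.+1%:Z == 0) = (n == m) by lia.
  case: eqP => [->|_]; rewrite ?mulr0 ?oppr0 // NegzE mulrNz mulr1; ring.
- by rewrite mulop_comm subrr scale0r.
Qed.

Lemma fa_fa k l : fa k * fa l = fa l * fa k.
Proof.
case: k => m; case: l => n; rewrite /fa.
- by rewrite -!scalerAl -!scalerAr !scalerA pder_pder_comm [X in X *: _]mulrC.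
- rewrite -scalerAl -scalerAr; congr (_ *: _); apply/eqP.
  by rewrite -subr_eq0 pder_mul_comm scale0r.
- rewrite -scalerAl -scalerAr; congr (_ *: _); apply/eqP.
  by rewrite eq_sym -subr_eq0 pder_mul_comm scale0r.
- exact: mulop_comm.
Qed.

Lemma fb_fb k l : fb k * fb l = fb l * fb k.
Proof.
have C n i : pder P (gA n) * mulop (xB i) = mulop (xB i) * pder P (gA n).
  by apply/eqP; rewrite -subr_eq0 pder_mul_comm scale0r.
case: k => [[|m]|m]; case: l => [[|n]|n]; rewrite /fb.
- by [].
- by rewrite -scalerAl -scalerAr C.
- exact: mulop_comm.
- by rewrite -scalerAl -scalerAr C.
- by rewrite -!scalerAl -!scalerAr !scalerA pder_pder_comm [X in X *: _]mulrC.
- by rewrite -scalerAl -scalerAr C.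
- exact: mulop_comm.
- by rewrite -scalerAl -scalerAr C.
- exact: mulop_comm.
Qed.

Lemma fa_lfield : lfield fa.
Proof.
move=> f; have [N NF] := pder_locfin f gB_inj.
by exists N => n /NF e; rewrite /fa lendZE e scaler0.
Qed.

Lemma fb_lfield : lfield fb.
Proof.
move=> f; have [N NF] := pder_locfin f gA_inj.
by exists N.+1 => -[//|n] /NF e; rewrite /fb lendZE e scaler0.
Qed.

Definition cpoly f : Prop :=
  forall n, [/\ pder P (gA n) f = 0, pder P (gB n) f = 0 & pder P (gD n) f = 0].

Lemma fa_cpoly f k : cpoly f -> mulop f * fa k = fa k * mulop f.
Proof.
case: k => n cf; rewrite /fa; last exact: mulop_comm.
by rewrite -scalerAl -scalerAr mulop_der_comm //; case: (cf n).
Qed.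

Lemma fb_cpoly f k : cpoly f -> mulop f * fb k = fb k * mulop f.
Proof.
case: k => [[|n]|n] cf; rewrite /fb; do ?exact: mulop_comm.
by rewrite -scalerAl -scalerAr mulop_der_comm //; case: (cf n).
Qed.

(** The creation half of [c(z)], together with its mode 0: [c(-n)] is the variable of index [n-1],
    and [c(0)] is the scalar [cc]. *)
Definition cseries (n : nat) : P := if n is n'.+1 then xC n' else cc%:A.

Section Dressed.
Context (p q : nat -> P).
Hypothesis pC : forall i, cpoly (p i).
Hypothesis qC : forall i, cpoly (q i).
(** In generating functions, [(k ell + cc) p q + ell z p' q = cseries(z) + k ell]. At nonzero level
    this means [p q = 1] with a prescribed logarithmic derivative of [p]; at level zero it
    prescribes the product [cc p q]. *)
Hypothesis pq : forall (k : int) T,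
  \sum_(i < T.+1) ((k + i)%:~R * ell + cc) *: (p i * q (T - i)%N)
    = cseries T + (if T == 0%N then k%:~R * ell else 0)%:A.

Definition na := field p fa.
Definition nb := field q fb.

Lemma na_na k l : na k * na l = na l * na k.
Proof.
rewrite {1}/na field_comm_op //; first exact: fa_lfield.
- move=> i; rewrite -field_comm_op //; first exact: fa_lfield.
    by move=> j; exact: mulop_comm.
  by move=> j; rewrite fa_cpoly.
- by move=> j; rewrite -field_comm_op //; [exact: fa_lfield | move=> i; exact: fa_cpoly
    | move=> i; exact: fa_fa].
Qed.

Lemma nb_nb k l : nb k * nb l = nb l * nb k.
Proof.
rewrite {1}/nb field_comm_op //; first exact: fb_lfield.
- move=> i; rewrite -field_comm_op //; first exact: fb_lfield.
    by move=> j; exact: mulop_comm.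
  by move=> j; rewrite fb_cpoly.
- by move=> j; rewrite -field_comm_op //; [exact: fb_lfield | move=> i; exact: fb_cpoly
    | move=> i; exact: fb_fb].
Qed.

(** At nonzero level these are the modes of [c] as seen on polynomials free of [D], where the
    positive ones vanish; at level zero they are the modes of [c] outright. *)
Definition nc (k : int) : lend P :=
  match k with Posz 0 => cc%:A | Posz _.+1 => 0 | Negz n => mulop (xC n) end.

Lemma mulopD f g : mulop (f + g) = mulop f + mulop g.
Proof. by apply: lendP => h; rewrite lendDE /= mulrDl. Qed.
Lemma mulopA (k : K) : mulop (k%:A : P) = k%:A.
Proof. by apply: lendP => h; rewrite lendZE /= mulr_algl. Qed.

(** In the double sum only [i + j = -(k + l)] survives, and along this diagonal [pq] adds up the
    scalars. A positive total mode leaves nothing. *)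
Lemma na_nb k l : na k * nb l - nb l * na k
  = nc (k + l) + (if k + l == 0 then k%:~R * ell else 0)%:A.
Proof.
apply: lendP => f; rewrite [LHS]lendDE [X in _ + X = _]lendNE [X in X - _ = _]lendME.
rewrite [X in _ - X = _]lendME [RHS]lendDE.
have [N [M [BN BM ->]]] := field_commutator k l f (absz (k + l)).+1 fa_lfield fb_lfield
  (fun i n => fb_cpoly n (pC i)) (fun i n => fa_cpoly n (qC i)) fa_fb.
pose g (i : nat) : K := (k + i)%:~R * ell + cc.
case: (lerP (k + l) 0) => kl; last first.
  rewrite big1 => [|i _]; last first.
    rewrite big1 // => j _; have -> : (k + l + (i + j)%N%:Z == 0) = false by lia.
    by rewrite scale0r.
  have -> : (k + l == 0) = false by lia.
  by case: (k + l) kl => [[|n]|n] // _; rewrite scale0r /nc !lend0E addr0.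
have [T klT] : exists T : nat, k + l = - T%:Z by exists (absz (k + l)); lia.
have TN : (T < N)%N by apply: leq_trans BN; rewrite klT abszN.
have TM : (T < M)%N by apply: leq_trans BM; rewrite klT abszN.
transitivity ((\sum_(i < T.+1) g i *: (p i * q (T - i)%N)) * f).
  rewrite mulr_suml (big_ord_widen N (fun i => g i *: (p i * q (T - i)%N) * f)) //.
  rewrite [RHS]big_mkcond; apply: eq_bigr => i _.
  case: ltnP => iT; last first.
    rewrite big1 // => j _; have -> : (k + l + (i + j)%N%:Z == 0) = false by lia.
    by rewrite scale0r.
  have TiM : (T - i < M)%N by exact: leq_ltn_trans (leq_subr _ _) TM.
  rewrite (bigD1 (Ordinal TiM)) //= big1 ?addr0 => [|j /eqP jT].
    have -> : (k + l + (i + (T - i))%N%:Z == 0) = true by lia.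
    by rewrite scalerAl.
  have -> : (k + l + (i + j)%N%:Z == 0) = false.
    by apply/negP => e; case: jT; apply: val_inj => /=; lia.
  by rewrite scale0r.
rewrite pq mulrDl mulr_algl; congr (_ + _).
  by rewrite klT; case: (T) => [|T'] //=; rewrite mulr_algl.
rewrite lendZE; congr (_ *: _); rewrite klT oppr_eq0.
by case: (T).
Qed.

End Dressed.
End FreeFields.

(** * Exponentials of power series *)

Section Newton.
Context (K : numFieldType) (A : algType K) (c : nat -> A).

(** All earlier coefficients are carried along, which makes a course-of-values recursion
    structural. *)
Fixpoint newton_list (n : nat) : seq A :=
  if n is n'.+1 then
    let s := newton_list n' in
    rcons s (n%:R^-1 *: \sum_(i < n) c i * s`_(n' - i))
  else [:: 1].

(* the coefficients of [exp (\sum_i c_i z^(i+1) / (i+1))], when the [c_i] commute *)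
Definition newton (n : nat) : A := (newton_list n)`_n.

Lemma size_newton_list n : size (newton_list n) = n.+1.
Proof. by elim: n => //= n IH; rewrite size_rcons IH. Qed.

Lemma nth_newton_list n i : (i <= n)%N -> (newton_list n)`_i = newton i.
Proof.
elim: n => [|n IH]; first by rewrite leqn0 => /eqP ->.
rewrite leq_eqVlt => /predU1P[->//|]; rewrite ltnS => i_n.
by rewrite /= nth_rcons size_newton_list ltnS i_n IH.
Qed.

Lemma newton0 : newton 0 = 1. Proof. by []. Qed.

Lemma newtonE n : n.+1%:R *: newton n.+1 = \sum_(i < n.+1) c i * newton (n - i).
Proof.
rewrite {1}/newton [newton_list n.+1]/= nth_rcons size_newton_list ltnn eqxx.
rewrite scalerA mulfV ?pnatr_eq0 // scale1r.
by apply: eq_bigr => i _; rewrite nth_newton_list ?leq_subr.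
Qed.

Lemma newton_eq n x : n.+1%:R *: x = \sum_(i < n.+1) c i * newton (n - i) ->
  x = newton n.+1.
Proof.
rewrite -newtonE => /(congr1 (fun y => n.+1%:R^-1 *: y)).
by rewrite !scalerA mulVf ?pnatr_eq0 // !scale1r.
Qed.

Lemma newton_ind (Q : nat -> A -> Prop) : Q 0%N 1 ->
  (forall n, (forall i, (i <= n)%N -> Q i (newton i)) -> Q n.+1 (newton n.+1)) ->
  forall n, Q n (newton n).
Proof.
move=> Q0 QS n; elim/ltn_ind: n => -[|n] IH; first exact: Q0.
by apply: QS => i i_n; apply: IH.
Qed.

(** On the coefficients, [delta] acts as [(m+1) d/dc_m], and this derivation multiplies
    [exp (\sum_i c_i z^(i+1) / (i+1))] by [z^(m+1)]. *)
Lemma newton_shift (delta : lend A) m : delta 1 = 0 ->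
  (forall i x, delta (c i * x) = (if i == m then m.+1%:R *: x else 0) + c i * delta x) ->
  forall n, delta (newton n) = if (m < n)%N then newton (n - m.+1) else 0.
Proof.
move=> d1 dc; apply: (newton_ind (Q := fun n x => delta x =
  if (m < n)%N then newton (n - m.+1) else 0)) => [//|n IH].
(* Clearing the denominator brings in the recursion. The factor [n+1] on the right then splits into
   [m+1], from the term where [delta] hits [c_m], and [n-m], from the recursion for the shifted
   coefficient. *)
suff : n.+1%:R *: delta (newton n.+1)
    = n.+1%:R *: (if (m < n.+1)%N then newton (n.+1 - m.+1) else 0).
  move=> /(congr1 (fun y => n.+1%:R^-1 *: y)).
  by rewrite !scalerA mulVf ?pnatr_eq0 // !scale1r.
rewrite -lend_vecZ newtonE lend_vec_sum.
have E (i : 'I_n.+1) : delta (c i * newton (n - i)) =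
   (if i == m :> nat then m.+1%:R *: newton (n - m) else 0) +
   (if (m + i < n)%N then c i * newton (n - m.+1 - i) else 0).
  rewrite dc; congr (_ + _); first by case: eqP => // ->.
  rewrite IH ?leq_subr // ltn_subRL addnC; case: ifP => _; rewrite ?mulr0 //.
  by congr (_ * newton _); lia.
rewrite (eq_bigr _ (fun i _ => E i)) big_split /= -!big_mkcond /=.
case: (ltnP m n.+1) => mn; last first.
  rewrite !big1 ?addr0 ?scaler0 // => i; first lia.
  by move=> /eqP im; have := ltn_ord i; rewrite im ltnNge mn.
rewrite (big_pred1 (Ordinal mn)) // subSS.
have [->|mn'] := eqVneq m n.
  rewrite big1 ?addr0 ?subnn // => i; lia.
have {}mn' : (m < n)%N by lia.
have nm : (n - m)%N = (n - m.+1).+1 by lia.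
have -> : n.+1%:R *: newton (n - m) = m.+1%:R *: newton (n - m) + (n - m)%:R *: newton (n - m).
  by rewrite -scalerDl -natrD; congr (_%:R *: _); lia.
congr (_ + _); rewrite {1 2}nm newtonE.
rewrite (big_ord_widen n.+1 (fun i => c i * newton (n - m.+1 - i))); last lia.
by apply: eq_bigl => i; lia.
Qed.

End Newton.

Section NewtonConvolution.
Context (K : numFieldType) (A : comAlgType K) (c : nat -> A).
Local Notation p := (newton c).
Local Notation q := (newton (fun n => - c n)).

(** Associativity of the product [z c(z) x(z) y(z)], read on coefficients. *)
Lemma newton_conv_shift (x y : nat -> A) T :
  \sum_(i < T.+1) (\sum_(n < i) c n * x (i - n.+1)%N) * y (T - i)%N
  = \sum_(n < T) c n * \sum_(i < (T - n.+1).+1) x i * y (T - n.+1 - i)%N.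
Proof.
transitivity (\sum_(i < T.+1) \sum_(n < T | (n < i)%N) c n * (x (i - n.+1)%N * y (T - i)%N)).
  apply: eq_bigr => i _; rewrite mulr_suml.
  rewrite (big_ord_widen T (fun n => c n * x (i - n.+1)%N * y (T - i)%N)); last first.
    by rewrite -ltnS.
  by apply: eq_bigr => n _; rewrite mulrA.
rewrite (exchange_big_dep predT) //=; apply: eq_bigr => n _; rewrite -mulr_sumr.
congr (_ * _).
rewrite -(big_mkord (fun i => (n < i)%N) (fun i => x (i - n.+1)%N * y (T - i)%N)).
have nT : (n.+1 <= T.+1)%N by rewrite ltnS ltnW.
rewrite (big_cat_nat (n := n.+1)) //= [X in X + _]big_nat_cond big1 ?add0r => [|i].
  rewrite -{1}[n.+1]add0n big_addn big_mkord.
  have -> : (T.+1 - n.+1 = (T - n.+1).+1)%N by have := ltn_ord n; lia.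
  by apply: eq_big => i; rewrite ?addnK; [lia | move=> _; congr (_ * y _); lia].
by move=> /andP[/andP[_]]; rewrite ltnS ltnNge => ->.
Qed.

Lemma newton_mulE n : n%:R *: p n = \sum_(i < n) c i * p (n - i.+1)%N.
Proof. by case: n => [|n]; rewrite ?big_ord0 ?scale0r // newtonE. Qed.

Lemma newton_mulNE n : n%:R *: q n = - \sum_(i < n) c i * q (n - i.+1)%N.
Proof.
case: n => [|n]; rewrite ?big_ord0 ?scale0r ?oppr0 // newtonE -sumrN.
by apply: eq_bigr => i _; rewrite mulNr.
Qed.

Lemma newton_conv_weighted T :
  \sum_(i < T.+1) i%:R *: (p i * q (T - i)%N)
  = \sum_(n < T) c n * \sum_(i < (T - n.+1).+1) p i * q (T - n.+1 - i)%N.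
Proof.
rewrite -newton_conv_shift; apply: eq_bigr => i _.
by rewrite scalerAl newton_mulE.
Qed.

(** Exponentials of opposite series are inverse to each other. Weighting the terms by
    [T = i + (T - i)] and applying the recursion to one factor or the other produces equal sums of
    opposite sign. *)
Lemma newton_conv T : \sum_(i < T.+1) p i * q (T - i)%N = (T == 0%N)%:R.
Proof.
case: T => [|T]; first by rewrite big_ord1 !newton0 mulr1.
apply: (@scalerI _ _ T.+1%:R); rewrite ?pnatr_eq0 // scaler0 scaler_sumr.
transitivity (\sum_(i < T.+2) i%:R *: (p i * q (T.+1 - i)%N)
  + \sum_(i < T.+2) (T.+1 - i)%:R *: (p i * q (T.+1 - i)%N)).
  rewrite -big_split; apply: eq_bigr => i _ /=; rewrite -scalerDl -natrD.
  by rewrite subnKC // -ltnS.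
rewrite newton_conv_weighted.
rewrite [X in _ + X](reindex_inj rev_ord_inj) /=.
have -> : \sum_(j < T.+2) (T.+1 - (T.+2 - j.+1))%:R *: (p (T.+2 - j.+1)%N * q (T.+1 - (T.+2 - j.+1))%N)
   = \sum_(j < T.+2) (- \sum_(n < j) c n * q (j - n.+1)%N) * p (T.+1 - j)%N.
  apply: eq_bigr => j _; have -> : (T.+1 - (T.+2 - j.+1))%N = j by have := ltn_ord j; lia.
  by rewrite subSS mulrC scalerAl newton_mulNE.
under [X in _ + X]eq_bigr => j _ do rewrite mulNr.
rewrite sumrN newton_conv_shift -sumrB big1 // => n _; rewrite -mulrBr.
rewrite [X in _ - X](reindex_inj rev_ord_inj) /= -sumrB big1 ?mulr0 // => i _.
have -> : ((T.+1 - n.+1) - ((T.+1 - n.+1).+1 - i.+1))%N = i by have := ltn_ord i; lia.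
have -> : ((T.+1 - n.+1).+1 - i.+1 = T.+1 - n.+1 - i)%N by lia.
by rewrite [q _ * _]mulrC subrr.
Qed.

(** As [q = 1 / p], these are the coefficients of [z p'(z) / p(z)], the logarithmic derivative of
    the exponential. *)
Lemma newton_conv1 T : \sum_(i < T.+1) i%:R *: (p i * q (T - i)%N)
  = if T is T'.+1 then c T' else 0.
Proof.
rewrite newton_conv_weighted; case: T => [|T]; first by rewrite big_ord0.
rewrite big_ord_recr /= newton_conv subnn eqxx mulr1 big1 ?add0r // => n _.
rewrite newton_conv; have -> : (T.+1 - n.+1 == 0)%N = false by have := ltn_ord n; lia.
by rewrite mulr0.
Qed.
End NewtonConvolution.

(** * Translations of the [D] variables *)

Lemma newton_commute (K : numFieldType) (A : algType K) (c : nat -> A) (X : A) n :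
  (forall i, c i * X = X * c i) -> newton c n * X = X * newton c n.
Proof.
move=> cX; apply: (newton_ind (Q := fun n x => x * X = X * x)) => [|{}n IH].
  by rewrite mul1r mulr1.
apply: (@scalerI _ _ n.+1%:R); first by rewrite pnatr_eq0.
rewrite scalerAl scalerAr newtonE mulr_suml mulr_sumr; apply: eq_bigr => i _.
by rewrite -mulrA IH ?leq_subr // mulrA cX mulrA.
Qed.

Section CommuteLemmas.
Context (K : fieldType) (A : algType K).
Implicit Types (x y z : A).

Lemma commuteZl (k : K) x y : x * y = y * x -> (k *: x) * y = y * (k *: x).
Proof. by rewrite -scalerAl -scalerAr => ->. Qed.
Lemma commuteDl x y z : x * z = z * x -> y * z = z * y -> (x + y) * z = z * (x + y).
Proof. by rewrite mulrDl mulrDr => -> ->. Qed.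
Lemma commuteMl x y z : x * z = z * x -> y * z = z * y -> (x * y) * z = z * (x * y).
Proof. by rewrite -mulrA => xz ->; rewrite mulrA xz mulrA. Qed.
Lemma commuteA (k : K) x : k%:A * x = x * k%:A.
Proof. by rewrite mulr_algl mulr_algr. Qed.
End CommuteLemmas.

Section Diagonal.
Context (K : numFieldType) (I : choiceType) (P : polyalg K I) (w : I -> int).
Implicit Types (f : P) (m : {cmonom I}).

Definition wt m : int := \sum_(i <- finsupp m) w i *+ m i.

Lemma wtE (d : {fset I}) m : (finsupp m `<=` d)%fset -> wt m = \sum_(i <- d) w i *+ m i.
Proof.
move=> le; apply: big_fset_incl => // i _; rewrite -cmE_eq0 => /eqP ->.
by rewrite mulr0n.
Qed.

Lemma wt1 : wt mone = 0.
Proof. by rewrite /wt mdom1 big_nil. Qed.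

Lemma wtM m1 m2 : wt (mmul m1 m2) = wt m1 + wt m2.
Proof.
rewrite (@wtE (finsupp m1 `|` finsupp m2)%fset); last by rewrite mdomD.
rewrite (wtE (fsubsetUl _ (finsupp m2))) (wtE (fsubsetUr (finsupp m1) _)) -big_split.
by apply: eq_bigr => i _; rewrite cmM mulrnDr.
Qed.

Lemma wtU i : wt (ucm i) = w i.
Proof. by rewrite /wt mdomU big_seq_fset1 cmUU. Qed.

(** The Euler derivation [\sum_i w_i x_i d/dx_i], given by its eigenvalues on monomials so that no
    infinite sum is needed. *)
Definition pdiag_fun f : P := \sum_(m <- psupp f) (pcoef m f * (wt m)%:~R) *: pmon P m.

Lemma pcoef_diag_fun f m : pcoef m (pdiag_fun f) = (wt m)%:~R * pcoef m f.
Proof.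
rewrite /pdiag_fun pcoef_sum; under eq_bigr => m' _ do rewrite pcoefZ pcoef_mon.
have [f0|fn0] := eqVneq (pcoef m f) 0.
  rewrite f0 mulr0 big1 // => m' _; case: eqP => [->|]; by rewrite ?f0 ?mul0r ?mulr0.
rewrite (bigD1_seq m) /=; [|by rewrite mem_psupp|exact: psupp_uniq].
rewrite eqxx mulr1 big1 => [|m' /negPf ->]; last by rewrite mulr0.
by rewrite addr0 mulrC.
Qed.

Fact pdiag_linear : linear pdiag_fun.
Proof.
move=> k f g; apply: polyP => m.
by rewrite pcoefP !pcoef_diag_fun pcoefP mulrDr mulrCA.
Qed.
Definition pdiag : lend P := Lend pdiag_linear.

Lemma pcoef_diag f m : pcoef m (pdiag f) = (wt m)%:~R * pcoef m f.
Proof. exact: pcoef_diag_fun. Qed.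

Lemma pdiag_var i : pdiag * mulop (pvar P i) - mulop (pvar P i) * pdiag
  = (w i)%:~R *: mulop (pvar P i).
Proof.
apply: lendP => f; rewrite lendDE lendNE !lendME lendZE !mulopE; apply: polyP => m.
rewrite -scaleN1r addrC pcoefP pcoef_diag pcoefZ !pcoef_varM pcoef_diag.
case: (posnP (m i)) => [_|mi]; first by rewrite !mulr0 addr0.
have -> : wt m = w i + wt (divcm m (ucm i)) by rewrite -{1}(cmonom_divK mi) wtM wtU.
rewrite rmorphD /=; ring.
Qed.

Lemma pdiag_der i : pdiag * pder P i - pder P i * pdiag = - (w i)%:~R *: pder P i.
Proof.
apply: lendP => f; rewrite lendDE lendNE !lendME lendZE; apply: polyP => m.
rewrite -scaleN1r addrC pcoefP pcoef_diag pcoefZ !pcoef_der pcoef_diag.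
rewrite wtM wtU rmorphD /=; ring.
Qed.

Lemma pdiag1 : pdiag 1 = 0.
Proof.
apply: polyP => m; rewrite pcoef_diag pcoef1 pcoef0.
by case: eqP => [->|_]; rewrite ?mulr0 // wt1 mul0r.
Qed.

End Diagonal.

Section ShiftDressing.
Context (K : numFieldType) (P : polyalg K gvar).
Implicit Types (f g : P) (k l : int) (e : K).
Local Notation xD n := (pvar P (gD n)).

Definition dfree f : Prop := forall n, pder P (gD n) f = 0.

Lemma dfree1 : dfree 1. Proof. by move=> n; exact: pder1. Qed.

(** Polynomials arise from those free of [D] by sums and products with the [D_n]. A whole family is
    treated at once because brackets with [D_n] turn one mode into another. *)
Lemma dfree_family (J : Type) (X : J -> lend P) :
  (forall j f, dfree f -> X j f = 0) ->
  (forall n f, (forall j, X j f = 0) -> forall j, X j (xD n * f) = 0) ->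
  forall j, X j = 0.
Proof.
move=> X0 XD j; apply: lendP => f; rewrite lend0E.
elim/poly_mon_ind: f j => [k f g IHf IHg|m] j.
  by rewrite lend_vecD lend_vecZ IHf IHg scaler0 addr0.
elim/ltn_ind: {m}(mdeg m) {-2}m (erefl (mdeg m)) j => d IH m md j.
have [[n mn]|mD] := pselect (exists n, (0 < m (gD n))%N); last first.
  apply: X0 => n; apply/pder_eq0P => m'; rewrite pcoef_mon.
  case: (m =P m') => [<- _|_ /eqP//]; apply/eqP; rewrite -leqn0 leqNgt.
  by apply/negP => mn; apply: mD; exists n.
rewrite -(cmonom_divK mn) -pvar_mon; apply: XD => {}j.
apply: (IH _ _ _ erefl).
by rewrite -md -{2}(cmonom_divK mn) mdegM mdegU.
Qed.

(** The factor [i+1] cancels the division built into [newton], so that [shiftop e] lists the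
    coefficients of [exp (e \sum_i d/dD_i z^(-i-1))]. *)
Definition dshift e (i : nat) : lend P := (e * i.+1%:R) *: pder P (gD i).
Definition shiftop e := newton (dshift e).

Lemma dshift_comm e X : (forall n, pder P (gD n) * X = X * pder P (gD n)) ->
  forall i, dshift e i * X = X * dshift e i.
Proof. by move=> DX i; apply: commuteZl. Qed.

Lemma shiftop_comm e j X : (forall n, pder P (gD n) * X = X * pder P (gD n)) ->
  shiftop e j * X = X * shiftop e j.
Proof. by move=> DX; apply: newton_commute; exact: dshift_comm. Qed.

Lemma shiftop_dfree e j f : dfree f -> shiftop e j.+1 f = 0.
Proof.
move=> df; apply: (@scalerI _ _ j.+1%:R); first by rewrite pnatr_eq0.
rewrite -lendZE newtonE scaler0 lend_sumE big1 // => i _.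
rewrite -newton_commute => [|n]; last first.
  by apply: dshift_comm => n'; apply/esym; apply: dshift_comm => n''; exact: pder_pder_comm.
by rewrite lendME lendZE df scaler0 lend_vec0.
Qed.

(** Bracketing with [D_n] is a derivation of the operator algebra that sends [dshift e i] to a
    scalar, so [newton_shift] applies; [e * e = 1] normalizes that scalar. *)
Lemma shiftop_xD e j n : e * e = 1 ->
  mulop (xD n) * shiftop e j - shiftop e j * mulop (xD n)
  = - e *: (if (n < j)%N then shiftop e (j - n.+1) else 0).
Proof.
move=> ee; pose delta0 X : lend P := - e *: (mulop (xD n) * X - X * mulop (xD n)).
have delta_linear : linear delta0.
  move=> k X Y; rewrite /delta0 mulrDr mulrDl -scalerAr -scalerAl opprD addrACA.
  by rewrite -scalerBr scalerDr !scalerA mulrC.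
pose delta := Lend delta_linear.
have -> : mulop (xD n) * shiftop e j - shiftop e j * mulop (xD n)
    = - e *: delta (shiftop e j).
  by rewrite /= /delta0 scalerA mulrNN ee scale1r.
congr (_ *: _); apply: newton_shift => [|i X]; rewrite /= /delta0.
  by rewrite mulr1 mul1r subrr scaler0.
have -> : mulop (xD n) * (dshift e i * X) - dshift e i * X * mulop (xD n)
    = (mulop (xD n) * dshift e i - dshift e i * mulop (xD n)) * X
      + dshift e i * (mulop (xD n) * X - X * mulop (xD n)).
  by rewrite mulrBl mulrBr !mulrA addrA subrK.
have -> : mulop (xD n) * dshift e i - dshift e i * mulop (xD n)
    = - (e * i.+1%:R * (i == n)%:R)%:A.
  by rewrite /dshift commutatorZr -opprB pder_mul_comm scalerN scalerA.
rewrite scalerDr -scalerAr; congr (_ + _); rewrite mulNr mulr_algl scalerN -scaleNr opprK scalerA.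
have -> : e * (e * i.+1%:R * (i == n)%:R) = i.+1%:R * (i == n)%:R.
  by rewrite !mulrA ee mul1r.
by case: eqP => [->|_]; rewrite ?mulr1 // mulr0 scale0r.
Qed.

Lemma shiftop_locfin e : e * e = 1 -> locfin (shiftop e).
Proof.
move=> ee; elim/poly_ind => [k f g [N fN] [M gM]||i f [N fN]].
- exists (maxn N M) => n; rewrite geq_max => /andP[/fN f0 /gM g0].
  by rewrite lend_vecD lend_vecZ f0 g0 scaler0 addr0.
- by exists 1%N => -[//|n] _; exact: shiftop_dfree dfree1.
have com i' : (forall n, i' != gD n) -> exists M, forall n, (M <= n)%N ->
    shiftop e n (pvar P i' * f) = 0.
  move=> ne; exists N => n Nn; rewrite -mulopE -lendME shiftop_comm ?lendME ?fN ?lend_vec0 //.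
  move=> n'; apply/eqP; rewrite -subr_eq0 pder_mul_comm.
  by rewrite [gD n' == _]eq_sym (negPf (ne n')) scale0r.
case: i => [i|[i|n]]; [by apply: com | by apply: com |].
exists (N + n.+1)%N => j jN; have := shiftop_xD j n ee.
move=> /(congr1 (fun F : lend P => F f)); rewrite lendDE lendNE !lendME lendZE.
rewrite fN; last by lia.
rewrite lend_vec0 sub0r => /eqP; rewrite eqr_oppLR => /eqP /= ->.
by case: ifP => _; rewrite ?fN ?lend0E ?scaler0 ?oppr0 //; lia.
Qed.

(* The product of [y(z) = \sum_k y(k) z^(-k-1)] with the operator
   [exp (e * \sum_n d/dD_n z^(-n-1))], which translates the [D] variables. *)
Definition dress e (y : int -> lend P) k : lend P :=
  lfsum (fun j : nat => y (k - j%:Z) * shiftop e j).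

Definition dlinear (y : int -> lend P) : Prop := forall k n,
  mulop (xD n) * y k = y k * mulop (xD n) /\ pder P (gD n) * y k = y k * pder P (gD n).

Section Dress.
Context (e : K) (y : int -> lend P).
Hypothesis ee : e * e = 1.
Hypothesis yD : dlinear y.

Lemma dress_locfin k : locfin (fun j : nat => y (k - j%:Z) * shiftop e j).
Proof.
move=> f; have [N NF] := shiftop_locfin ee f.
by exists N => n /NF h; rewrite lendME h lend_vec0.
Qed.

(** As [D_n] stands for [d(-n-1)], this is the bracket required of the modes of [a] when [e = -1],
    and of the modes of [b] when [e = 1]. *)
Lemma dress_xD k n : mulop (xD n) * dress e y k - dress e y k * mulop (xD n)
  = - e *: dress e y (k - n.+1%:Z).
Proof.
pose F (j : nat) := - e *: (y (k - n.+1%:Z - j%:Z) * shiftop e j).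
have lF : locfin F.
  by move=> f; have [N NF] := dress_locfin (k - n.+1%:Z) f; exists N => j /NF h;
    rewrite lendZE h scaler0.
rewrite -[RHS]lfsumZ; last exact: dress_locfin.
rewrite -(lfsum_shift n lF) /dress.
apply: lfsum_commutator => [||j]; first exact: dress_locfin.
  move=> f; have [N NF] := lF f; exists (N + n.+1)%N => j jN.
  by case: ifP => // nj; apply: NF; lia.
rewrite mulrA (yD _ n).1 -mulrA -[X in _ - X]mulrA -mulrBr shiftop_xD // -scalerAr.
case: ifP => nj; last by rewrite mulr0 scaler0.
by congr (_ *: (y _ * _)); lia.
Qed.

Lemma dress_xDE k n f : dress e y k (xD n * f)
  = xD n * dress e y k f + e *: dress e y (k - n.+1%:Z) f.
Proof.
have /(congr1 (fun F : lend P => F f)) := dress_xD k n.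
rewrite lendDE lendNE !lendME lendZE !mulopE => /eqP.
by rewrite subr_eq scaleNr => /eqP ->; rewrite addrC addrA subrr add0r.
Qed.

Lemma dress_dfree k f : dfree f -> dress e y k f = y k f.
Proof.
move=> df; rewrite /dress (@lfsumE _ _ _ _ 1%N) ?big_ord1 ?lendME.
- by rewrite subr0 /shiftop newton0.
- exact: dress_locfin.
- by move=> [//|n] _; rewrite lendME shiftop_dfree // lend_vec0.
Qed.

Lemma dress_comm X k : (forall n, pder P (gD n) * X = X * pder P (gD n)) ->
  (forall k, y k * X = X * y k) -> X * dress e y k = dress e y k * X.
Proof.
move=> DX yX; apply: lfsum_comm; first exact: dress_locfin.
by move=> n; apply/esym; apply: commuteMl => //; exact: shiftop_comm.
Qed.

Lemma dlinear_dfree k f : dfree f -> dfree (y k f).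
Proof.
by move=> df n; rewrite -lendME (yD k n).2 lendME df lend_vec0.
Qed.

End Dress.

(** Dressing is invisible on polynomials free of [D], so the commutator is known there. The last
    hypothesis says that [R] reacts to a factor [D_n] exactly as the commutator does, and
    [dfree_family] concludes. *)
Lemma dress_commutator e e' y z (R : int -> int -> lend P) :
  e * e = 1 -> e' * e' = 1 -> dlinear y -> dlinear z ->
  (forall k l f, dfree f -> y k (z l f) - z l (y k f) = R k l f) ->
  (forall k l n f, R k l (xD n * f)
    = xD n * R k l f + e *: R (k - n.+1%:Z) l f + e' *: R k (l - n.+1%:Z) f) ->
  forall k l, dress e y k * dress e' z l - dress e' z l * dress e y k = R k l.
Proof.
move=> ee ee' yD zD yz RD k l.
pose X (kl : int * int) := dress e y kl.1 * dress e' z kl.2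
  - dress e' z kl.2 * dress e y kl.1 - R kl.1 kl.2.
suff X0 : forall kl, X kl = 0 by have /eqP := X0 (k, l); rewrite subr_eq0 => /eqP.
have XE kl f : X kl f = dress e y kl.1 (dress e' z kl.2 f)
    - dress e' z kl.2 (dress e y kl.1 f) - R kl.1 kl.2 f by [].
apply: dfree_family => [[k' l'] f df|n f Xf [k' l']]; rewrite XE /=.
  rewrite !(dress_dfree _ _ _ df) // !dress_dfree //; try exact: dlinear_dfree.
  by rewrite yz // subrr.
have RE k1 l1 : X (k1, l1) f = 0 ->
    R k1 l1 f = dress e y k1 (dress e' z l1 f) - dress e' z l1 (dress e y k1 f).
  by rewrite XE /= => /eqP; rewrite subr_eq0 => /eqP.
have E1 : dress e y k' (dress e' z l' (xD n * f)) = xD n * dress e y k' (dress e' z l' f)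
    + e *: dress e y (k' - n.+1%:Z) (dress e' z l' f)
    + e' *: dress e y k' (dress e' z (l' - n.+1%:Z) f).
  by rewrite (dress_xDE ee' zD) lend_vecD lend_vecZ (dress_xDE ee yD).
have E2 : dress e' z l' (dress e y k' (xD n * f)) = xD n * dress e' z l' (dress e y k' f)
    + e' *: dress e' z (l' - n.+1%:Z) (dress e y k' f)
    + e *: dress e' z l' (dress e y (k' - n.+1%:Z) f).
  by rewrite (dress_xDE ee yD) lend_vecD lend_vecZ (dress_xDE ee' zD).
rewrite E1 E2 RD !(RE _ _ (Xf _)) !scalerBr mulrBr.
move: (xD n * _) (xD n * _) (e *: _) (e *: _) (e' *: _) (e' *: _) => a1 a2 a3 a4 a5 a6.
ring.
Qed.

End ShiftDressing.

(** * The realization at nonzero level *)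

Section CGenerated.
Context (K : numFieldType) (P : polyalg K gvar).
Implicit Types (f g : P).
Local Notation xC n := (pvar P (gC n)).

(* [f] is a polynomial in the [C] variables, expressed by the operators that
   commute with multiplication by [f] *)
Definition cgen f : Prop := forall X : lend P,
  (forall n, mulop (xC n) * X = X * mulop (xC n)) -> mulop f * X = X * mulop f.

Lemma pder_mul_comm0 i j : i != j ->
  pder P i * mulop (pvar P j) = mulop (pvar P j) * pder P i.
Proof.
by move=> /negPf ij; apply/eqP; rewrite -subr_eq0 pder_mul_comm ij scale0r.
Qed.

Lemma cgen_der f i : (forall n, i != gC n) -> cgen f -> pder P i f = 0.
Proof.
move=> iC /(_ (pder P i)) cf.
have : mulop f * pder P i = pder P i * mulop f.
  by apply: cf => n; rewrite pder_mul_comm0.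
by move=> /(congr1 (fun F : lend P => F 1)); rewrite !lendME !mulopE pder1 mulr0 mulr1.
Qed.

Lemma cgen_cpoly f : cgen f -> cpoly f.
Proof. by move=> cf n; split; apply: cgen_der. Qed.

Lemma cgen1 : cgen 1.
Proof. by move=> X _; apply: lendP => f; rewrite !lendME !mulopE !mul1r. Qed.

Lemma cgenZ (k : K) f : cgen f -> cgen (k *: f).
Proof.
move=> cf X XC; have -> : mulop (k *: f) = k *: mulop f.
  by apply: lendP => g; rewrite lendZE !mulopE scalerAl.
by apply: commuteZl; exact: cf.
Qed.

Lemma mulopM f g : mulop (f * g) = mulop f * mulop g.
Proof. by apply: lendP => h; rewrite lendME !mulopE mulrA. Qed.

Lemma cgenM f g : cgen f -> cgen g -> cgen (f * g).
Proof. by move=> cf cg X XC; rewrite mulopM; apply: commuteMl; [exact: cf | exact: cg]. Qed.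

Lemma cgenD f g : cgen f -> cgen g -> cgen (f + g).
Proof. by move=> cf cg X XC; rewrite mulopD; apply: commuteDl; [exact: cf | exact: cg]. Qed.

Lemma cgen_var n : cgen (xC n).
Proof. by move=> X; exact. Qed.

Lemma cgen_newton (c : nat -> P) n : (forall i, cgen (c i)) -> cgen (newton c n).
Proof.
move=> cc; apply: (newton_ind (Q := fun n x => cgen x)) => [|{}n IH]; first exact: cgen1.
rewrite -[newton c n.+1]scale1r -(@mulVf _ (n.+1%:R : K)) ?pnatr_eq0 // -scalerA.
apply: cgenZ; rewrite newtonE; apply: (big_ind cgen) => [|f g|i _].
- have -> : 0 = 0 *: (1 : P) by rewrite scale0r.
  exact/cgenZ/cgen1.
- exact: cgenD.
- by apply: cgenM => //; apply: IH; exact: leq_subr.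
Qed.

End CGenerated.

Section FieldMore.
Context (K : numFieldType) (P : polyalg K gvar) (s : nat -> P) (y : int -> lend P).
Hypothesis ly : lfield y.
Implicit Types (k : int) (X : lend P).

Lemma field_graded X (e : K) k : (forall i, mulop (s i) * X = X * mulop (s i)) ->
  (forall k, X * y k - y k * X = e *: y k) ->
  X * field s y k - field s y k * X = e *: field s y k.
Proof.
move=> sX yX; rewrite -[RHS]lfsumZ; last exact: field_locfin.
apply: lfsum_commutator => [||i]; first exact: field_locfin.
  by move=> f; have [N NF] := field_locfin s k ly f; exists N => n /NF h;
    rewrite lendZE h scaler0.
by rewrite mulrA -sX -!mulrA -mulrBr yX -scalerAr.
Qed.

Lemma field_shift X (e : K) n k : 
  (forall i, X * mulop (s i) - mulop (s i) * X
     = if (n < i)%N then e *: mulop (s (i - n.+1)%N) else 0) ->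
  (forall k, y k * X = X * y k) ->
  X * field s y k - field s y k * X = e *: field s y (k + n.+1%:Z).
Proof.
move=> sX yX.
pose F (i : nat) := e *: (mulop (s i) * y (k + n.+1%:Z + i%:Z)).
have lF : locfin F.
  by move=> f; have [N NF] := field_locfin s (k + n.+1%:Z) ly f; exists N => i /NF h;
    rewrite lendZE h scaler0.
rewrite -[RHS]lfsumZ; last exact: field_locfin.
rewrite -(lfsum_shift n lF).
apply: lfsum_commutator => [||i]; first exact: field_locfin.
  move=> f; have [N NF] := lF f; exists (N + n.+1)%N => j jN.
  by case: ifP => // nj; apply: NF; lia.
rewrite -mulrA yX !mulrA -mulrBl sX; case: ifP => ni; last by rewrite mul0r.
by rewrite -scalerAl; congr (_ *: (_ * y _)); lia.
Qed.

End FieldMore.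

Section DressMore.
Context (K : numFieldType) (P : polyalg K gvar) (e : K) (y : int -> lend P).
Hypotheses (ee : e * e = 1) (yD : dlinear y).

Lemma dress_graded (X : lend P) (h : K) k :
  (forall n, pder P (gD n) * X = X * pder P (gD n)) ->
  (forall k, X * y k - y k * X = h *: y k) ->
  X * dress e y k - dress e y k * X = h *: dress e y k.
Proof.
move=> DX yX; rewrite -[RHS]lfsumZ; last exact: dress_locfin.
apply: lfsum_commutator => [||i]; first exact: dress_locfin.
  by move=> f; have [N NF] := dress_locfin y ee k f; exists N => n /NF E;
    rewrite lendZE E scaler0.
by rewrite mulrA -[X in _ - X]mulrA (shiftop_comm _ _ DX) mulrA -mulrBl yX -scalerAl.
Qed.

Lemma dress_shift (X : lend P) (h : K) n k :
  (forall n, pder P (gD n) * X = X * pder P (gD n)) ->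
  (forall k, X * y k - y k * X = h *: y (k + n.+1%:Z)) ->
  X * dress e y k - dress e y k * X = h *: dress e y (k + n.+1%:Z).
Proof.
move=> DX yX; rewrite -[RHS]lfsumZ; last exact: dress_locfin.
apply: lfsum_commutator => [||i]; first exact: dress_locfin.
  by move=> f; have [N NF] := dress_locfin y ee (k + n.+1%:Z) f; exists N => j /NF E;
    rewrite lendZE E scaler0.
rewrite mulrA -[X in _ - X]mulrA (shiftop_comm _ _ DX) mulrA -mulrBl yX -scalerAl.
by congr (_ *: (y _ * _)); lia.
Qed.
End DressMore.

Section NonzeroLevel.
Context (K : numFieldType) (P : polyalg K gvar) (ell cc dd : K).
Hypothesis ell0 : ell != 0.
Implicit Types (f g : P) (k l : int).
Local Notation xC n := (pvar P (gC n)).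
Local Notation xD n := (pvar P (gD n)).

(** The coefficients of [exp (\sum_i C_i z^(i+1) / ((i+1) ell))], the creation half of the vertex
    operator for [a]; the inverse series [eserN] serves for [b]. *)
Definition eser (n : nat) : P := newton (fun i => ell^-1 *: xC i) n.
Definition eserN (n : nat) : P := newton (fun i => - (ell^-1 *: xC i)) n.

Lemma eser_cgen i : cgen (eser i).
Proof. by apply: cgen_newton => j; apply: cgenZ; exact: cgen_var. Qed.
Lemma eserN_cgen i : cgen (eserN i).
Proof.
by apply: cgen_newton => j; rewrite -scaleNr; apply: cgenZ; exact: cgen_var.
Qed.

(** [ell] times the logarithmic derivative of the exponential gives back the series of the [C_i];
    hence the factor [ell^-1] in the exponent. *)
Lemma eser_conv k T :
  \sum_(i < T.+1) ((k + i)%:~R * ell + cc) *: (eser i * eserN (T - i)%N)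
    = cseries P cc T + (if T == 0%N then k%:~R * ell else 0)%:A.
Proof.
have E (i : 'I_T.+1) : ((k + i)%:~R * ell + cc) *: (eser i * eserN (T - i)%N)
    = (k%:~R * ell + cc) *: (eser i * eserN (T - i)%N)
      + ell *: (i%:R *: (eser i * eserN (T - i)%N)).
  by rewrite scalerA -scalerDl; congr (_ *: _); rewrite rmorphD /=; ring.
rewrite (eq_bigr _ (fun i _ => E i)) big_split -!scaler_sumr /=.
rewrite newton_conv newton_conv1; case: T {E} => [|T] /=.
  by rewrite scaler0 addr0 addrC scalerDl.
by rewrite scaler0 scale0r add0r addr0 scalerA mulfV // scale1r.
Qed.

Definition oa1 := dress (-1) (na ell cc eser).
Definition ob1 := dress 1 (nb ell cc eserN).
Definition oc1 k : lend P :=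
  match k with
  | Posz 0 => cc%:A
  | Posz n.+1 => (n.+1%:R * ell) *: pder P (gD n)
  | Negz n => mulop (xC n)
  end.
(** The weights under the adjoint action of [d]: 1 for [a], -1 for [b], 0 for [c] and [d]. *)
Definition charge (i : gvar) : int :=
  match i with inl (inl _) => 1 | inl (inr _) => -1 | inr _ => 0 end.
Definition od1 k : lend P :=
  match k with
  | Posz 0 => dd%:A + pdiag P charge
  | Posz n.+1 => (n.+1%:R * ell) *: pder P (gC n)
  | Negz n => mulop (xD n)
  end.

Let m1 : (-1 : K) * -1 = 1. Proof. by rewrite mulrNN mulr1. Qed.
Let p1 : (1 : K) * 1 = 1. Proof. by rewrite mulr1. Qed.

Lemma fa_comm_pder i k : (forall n, i != gA n) -> pder P i * fa P ell cc k = fa P ell cc k * pder P i.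
Proof.
move=> iA; case: k => n; rewrite /fa.
  by rewrite -scalerAl -scalerAr pder_pder_comm.
by rewrite pder_mul_comm0.
Qed.

Lemma fb_comm_pder i k : (forall n, i != gB n) -> pder P i * fb P ell cc k = fb P ell cc k * pder P i.
Proof.
move=> iB; case: k => [[|n]|n]; rewrite /fb; first by rewrite pder_mul_comm0.
  by rewrite -scalerAl -scalerAr pder_pder_comm.
by rewrite pder_mul_comm0.
Qed.

Lemma fa_comm_mul i k : (forall n, i != gB n) ->
  mulop (pvar P i) * fa P ell cc k = fa P ell cc k * mulop (pvar P i).
Proof.
move=> iB; case: k => n; rewrite /fa; last exact: mulop_comm.
by rewrite -scalerAl -scalerAr pder_mul_comm0 // eq_sym.
Qed.

Lemma fb_comm_mul i k : (forall n, i != gA n) ->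
  mulop (pvar P i) * fb P ell cc k = fb P ell cc k * mulop (pvar P i).
Proof.
move=> iA; case: k => [[|n]|n]; rewrite /fb; do ?exact: mulop_comm.
by rewrite -scalerAl -scalerAr pder_mul_comm0 // eq_sym.
Qed.

Lemma na_comm (p : nat -> P) X k : (forall i, cgen (p i)) -> (forall n, mulop (xC n) * X = X * mulop (xC n)) ->
  (forall k, fa P ell cc k * X = X * fa P ell cc k) ->
  na ell cc p k * X = X * na ell cc p k.
Proof.
by move=> pC XC aX; apply: field_comm_op => [|i|//]; [exact: fa_lfield | exact: pC].
Qed.

Lemma nb_comm (q : nat -> P) X k : (forall i, cgen (q i)) -> (forall n, mulop (xC n) * X = X * mulop (xC n)) ->
  (forall k, fb P ell cc k * X = X * fb P ell cc k) ->
  nb ell cc q k * X = X * nb ell cc q k.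
Proof.
by move=> pC XC aX; apply: field_comm_op => [|i|//]; [exact: fb_lfield | exact: pC].
Qed.

Lemma na_dlinear (p : nat -> P) : (forall i, cgen (p i)) -> dlinear (na ell cc p).
Proof.
move=> pC k n; split; apply/esym;
  apply: na_comm => [//|n'|k'].
- exact: mulop_comm.
- by rewrite fa_comm_mul.
- by rewrite pder_mul_comm0.
- by rewrite fa_comm_pder.
Qed.

Lemma nb_dlinear (q : nat -> P) : (forall i, cgen (q i)) -> dlinear (nb ell cc q).
Proof.
move=> pC k n; split; apply/esym;
  apply: nb_comm => [//|n'|k'].
- exact: mulop_comm.
- by rewrite fb_comm_mul.
- by rewrite pder_mul_comm0.
- by rewrite fb_comm_pder.
Qed.

Let aD := na_dlinear eser_cgen.
Let bD := nb_dlinear eserN_cgen.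

Let ap i := cgen_cpoly (eser_cgen i).
Let bq i := cgen_cpoly (eserN_cgen i).

Lemma pder_mul_eval i j f :
  pder P i (pvar P j * f) = (if i == j then f else 0) + pvar P j * pder P i f.
Proof. exact: pder_varM. Qed.

Lemma oa1_oa1 k l : oa1 k * oa1 l = oa1 l * oa1 k.
Proof.
apply/eqP; rewrite -subr_eq0; apply/eqP.
apply: (dress_commutator (R := fun _ _ => 0)) => // [k' l' f _|k' l' n f].
  by rewrite -!lendME na_na // subrr.
by rewrite !lend0E mulr0 !scaler0 !addr0.
Qed.

Lemma ob1_ob1 k l : ob1 k * ob1 l = ob1 l * ob1 k.
Proof.
apply/eqP; rewrite -subr_eq0; apply/eqP.
apply: (dress_commutator (R := fun _ _ => 0)) => // [k' l' f _|k' l' n f].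
  by rewrite -!lendME nb_nb // subrr.
by rewrite !lend0E mulr0 !scaler0 !addr0.
Qed.

Lemma oc1_xD k n : oc1 k * mulop (xD n) - mulop (xD n) * oc1 k
  = (if k == n.+1%:Z then n.+1%:R * ell else 0)%:A.
Proof.
case: k => [[|m]|m]; rewrite /oc1.
- by rewrite commuteA subrr scale0r.
- rewrite commutatorZl pder_mul_comm scalerA; congr (_ *: _).
  have -> : (gD m == gD n) = (m == n) by [].
  have -> : (m.+1%:Z == n.+1%:Z) = (m == n) by lia.
  by case: eqP => [->|_]; rewrite ?mulr1 ?mulr0.
- by rewrite mulop_comm subrr scale0r.
Qed.

(** On polynomials free of [D] this is [na_nb]. A factor [D_n] meets [c(n+1)] in a scalar, and the
    central terms produce the same one: [k ell - (k - n - 1) ell = (n+1) ell]. *)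
Lemma oa1_ob1 k l : oa1 k * ob1 l - ob1 l * oa1 k
  = oc1 (k + l) + (if k + l == 0 then k%:~R * ell else 0)%:A.
Proof.
pose R k l := oc1 (k + l) + (if k + l == 0 then k%:~R * ell else 0)%:A.
apply: (dress_commutator (R := R)) => // {k l} [k l f df|k l n f]; rewrite /R.
  have := na_nb ap bq eser_conv k l => /(congr1 (fun F : lend P => F f)) E.
  transitivity ((na ell cc eser k * nb ell cc eserN l
    - nb ell cc eserN l * na ell cc eser k : lend P) f); first by [].
  rewrite E [LHS]lendDE [RHS]lendDE; congr (_ + _).
  by case: (k + l) => [[|m]|m] //; rewrite /oc1 lendZE df scaler0.
have := oc1_xD (k + l) n => /(congr1 (fun F : lend P => F f)).
rewrite [LHS]lendDE [X in _ + X = _]lendNE !lendME !mulopE => /eqP.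
rewrite subr_eq => /eqP E; rewrite [LHS]lendDE E [X in _ = xD n * X + _ + _]lendDE.
rewrite [X in _ = _ + -1 *: X + _]lendDE [X in _ = _ + 1 *: X]lendDE.
have -> : k - n.+1%:Z + l = k + l - n.+1%:Z by rewrite addrAC.
have -> : k + (l - n.+1%:Z) = k + l - n.+1%:Z by rewrite addrA.
rewrite !lendZE; have -> (x : P) : (1 : lend P) x = x by [].
have -> (x : P) : (1 : lend P) x = x by [].
move: (oc1 (k + l) f) (oc1 (k + l - n.+1%:Z) f) => u v.
rewrite mulrDr scalerDr scaleN1r scale1r scalerA -scalerAr subr_eq0.
move: (xD n * u) => u'.
have -> : (k - n.+1%:Z)%:~R = k%:~R - n.+1%:R :> K by rewrite rmorphB.
move: (_ *: (xD n * f)) => t.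
have -> : (if k + l == n.+1 then n.+1%:R * ell else 0) *: f
    = (-1 * (if k + l == n.+1 then (k%:~R - n.+1%:R) * ell else 0)) *: f
      + (if k + l == n.+1 then k%:~R * ell else 0) *: f.
  by rewrite -scalerDl; congr (_ *: _); case: ifP => _; ring.
move: (_ *: f) (_ *: f) => f1 f2; ring.
Qed.

(** The level in [d(n+1) = (n+1) ell d/dC_n] cancels the one in the exponent, which leaves the
    derivation of [newton_shift]. *)
Lemma eser_shift n i : (n.+1%:R * ell) *: pder P (gC n) * mulop (eser i)
    - mulop (eser i) * ((n.+1%:R * ell) *: pder P (gC n))
  = if (n < i)%N then 1 *: mulop (eser (i - n.+1)%N) else 0.
Proof.
pose delta : lend P := (n.+1%:R * ell) *: pder P (gC n).
have d1 : delta 1 = 0 by rewrite lendZE pder1 scaler0.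
have dc j x : delta (ell^-1 *: xC j * x)
    = (if j == n then n.+1%:R *: x else 0) + ell^-1 *: xC j * delta x.
  rewrite -!scalerAl lend_vecZ !lendZE pder_mul_eval scalerDr scalerDr; congr (_ + _).
    have -> : (gC n == gC j) = (j == n) by rewrite eq_sym.
    by case: eqP => _; rewrite ?scaler0 // scalerA mulrCA mulVf ?mulr1.
  by rewrite scalerAr.
have := newton_shift d1 dc i; rewrite lendZE => E.
apply: lendP => f; rewrite lendDE lendNE !lendME !lendZE !mulopE pderM scalerDr.
rewrite -scalerAr addrK scalerAl E.
by case: ifP => _; rewrite ?lend0E ?mul0r // lendZE scale1r.
Qed.

Lemma eserN_shift n i : (n.+1%:R * ell) *: pder P (gC n) * mulop (eserN i)
    - mulop (eserN i) * ((n.+1%:R * ell) *: pder P (gC n))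
  = if (n < i)%N then -1 *: mulop (eserN (i - n.+1)%N) else 0.
Proof.
pose delta : lend P := - (n.+1%:R * ell) *: pder P (gC n).
have d1 : delta 1 = 0 by rewrite lendZE pder1 scaler0.
have dc j x : delta (- (ell^-1 *: xC j) * x)
    = (if j == n then n.+1%:R *: x else 0) + - (ell^-1 *: xC j) * delta x.
  rewrite -!scaleNr -!scalerAl lend_vecZ !lendZE pder_mul_eval !scalerDr; congr (_ + _).
    have -> : (gC n == gC j) = (j == n) by rewrite eq_sym.
    by case: eqP => _; rewrite ?scaler0 // scalerA mulrNN mulrCA mulVf ?mulr1.
  by rewrite scalerAr.
have := newton_shift d1 dc i; rewrite lendZE => E.
apply: lendP => f; rewrite lendDE lendNE !lendME !lendZE !mulopE pderM scalerDr.
rewrite -scalerAr addrK scalerAl -[_ *: pder P _ _]opprK -scaleNr E.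
by case: ifP => _; rewrite ?lend0E ?oppr0 ?mul0r // lendZE scaleN1r mulNr.
Qed.

Lemma pdiag_charge_comm i : charge i = 0 ->
  (mulop (pvar P i) * pdiag P charge = pdiag P charge * mulop (pvar P i)) *
  (pder P i * pdiag P charge = pdiag P charge * pder P i).
Proof.
move=> wi; have := pdiag_var P charge i; have := pdiag_der P charge i.
rewrite wi oppr0 !scale0r => /eqP; rewrite subr_eq0 => /eqP -> /eqP.
by rewrite subr_eq0 => /eqP ->.
Qed.

Lemma pdiag_fa k : pdiag P charge * fa P ell cc k - fa P ell cc k * pdiag P charge
  = 1 *: fa P ell cc k.
Proof.
case: k => n; rewrite /fa; last by rewrite pdiag_var.
by rewrite commutatorZr pdiag_der /= rmorphN /= opprK !scale1r.
Qed.

Lemma pdiag_fb k : pdiag P charge * fb P ell cc k - fb P ell cc k * pdiag P charge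
  = -1 *: fb P ell cc k.
Proof.
case: k => [[|n]|n]; rewrite /fb ?pdiag_var //.
by rewrite commutatorZr pdiag_der /= !scaleN1r scalerN.
Qed.

Lemma od1_comm_pderD n k : (forall m, k != Negz m) -> pder P (gD n) * od1 k = od1 k * pder P (gD n).
Proof.
case: k => [[|m]|m] km; rewrite /od1.
- apply/esym; apply: commuteDl; first exact: commuteA.
  by rewrite (pdiag_charge_comm (i := gD n)).
- by apply/esym/commuteZl; exact: pder_pder_comm.
- by have := km m; rewrite eqxx.
Qed.

(** The bracket has a different source in each range of [k]: the translation of the [D] variables
    for negative modes, the charge for mode 0, and the series in the [C] variables for positive
    modes. *)
Lemma od1_oa1 k l : od1 k * oa1 l - oa1 l * od1 k = oa1 (k + l).
Proof.
case: k => [[|m]|m]; last 1 first.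
- rewrite [LHS]dress_xD // opprK scale1r; congr (dress _ _ _); lia.
- rewrite /od1 mulrDl mulrDr opprD addrACA commuteA subrr !add0r.
  rewrite -[RHS]scale1r; apply: dress_graded => // [n|k].
    by rewrite (pdiag_charge_comm (i := gD n)).
  apply: field_graded => [|i|k']; first exact: fa_lfield.
    by apply: eser_cgen => n; rewrite (pdiag_charge_comm (i := gC n)).
  exact: pdiag_fa.
- have -> : oa1 (m.+1%:Z + l) = 1 *: oa1 (l + m.+1%:Z) by rewrite scale1r addrC.
  apply: dress_shift => // [n|k]; first exact: od1_comm_pderD.
  apply: field_shift => [|i|k']; [exact: fa_lfield | exact: eser_shift |].
  by apply/esym/commuteZl; rewrite fa_comm_pder.
Qed.

Lemma od1_ob1 k l : od1 k * ob1 l - ob1 l * od1 k = - ob1 (k + l).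
Proof.
case: k => [[|m]|m]; last 1 first.
- rewrite [LHS]dress_xD // scaleN1r; congr (- dress _ _ _); lia.
- rewrite /od1 mulrDl mulrDr opprD addrACA commuteA subrr !add0r.
  rewrite -[RHS]scaleN1r; apply: dress_graded => // [n|k].
    by rewrite (pdiag_charge_comm (i := gD n)).
  apply: field_graded => [|i|k']; first exact: fb_lfield.
    by apply: eserN_cgen => n; rewrite (pdiag_charge_comm (i := gC n)).
  exact: pdiag_fb.
- have -> : - ob1 (m.+1%:Z + l) = -1 *: ob1 (l + m.+1%:Z) by rewrite scaleN1r addrC.
  apply: dress_shift => // [n|k]; first exact: od1_comm_pderD.
  apply: field_shift => [|i|k']; [exact: fb_lfield | exact: eserN_shift |].
  by apply/esym/commuteZl; rewrite fb_comm_pder.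
Qed.

Lemma oc1_oc1 k l : oc1 k * oc1 l = oc1 l * oc1 k.
Proof.
case: k => [[|m]|m]; case: l => [[|n]|n]; rewrite /oc1; do ?[exact: commuteA
  | exact/esym/commuteA | exact: mulop_comm].
- by apply: commuteZl; apply/esym/commuteZl; exact: pder_pder_comm.
- by apply: commuteZl; rewrite pder_mul_comm0.
- by apply/esym/commuteZl; rewrite pder_mul_comm0.
Qed.

Lemma od1_od1 k l : od1 k * od1 l = od1 l * od1 k.
Proof.
have E i : charge i = 0 -> forall X, X = mulop (pvar P i) \/ X = pder P i ->
    X * od1 0 = od1 0 * X.
  move=> ci X iX; apply/esym; rewrite /od1; apply: commuteDl; first exact: commuteA.
  by case: iX => ->; rewrite pdiag_charge_comm.
case: k => [[|m]|m]; case: l => [[|n]|n] //.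
- apply/esym; rewrite {1 4}/od1; apply: commuteZl; apply: (E (gC n)) => //; by right.
- apply/esym; apply: (E (gD n)) => //; by left.
- rewrite {1 4}/od1; apply: commuteZl; apply: (E (gC m)) => //; by right.
- by rewrite /od1; apply: commuteZl; apply/esym/commuteZl; exact: pder_pder_comm.
- by rewrite /od1; apply: commuteZl; rewrite pder_mul_comm0.
- apply: (E (gD m)) => //; by left.
- by rewrite /od1; apply/esym/commuteZl; rewrite pder_mul_comm0.
- exact: mulop_comm.
Qed.

Lemma oc1_oa1 k l : oc1 k * oa1 l = oa1 l * oc1 k.
Proof.
case: k => [[|m]|m]; rewrite /oc1; first exact: commuteA.
  apply: commuteZl; apply: dress_comm => // [n|k]; first exact: pder_pder_comm.
  by rewrite (aD k m).2.
apply: dress_comm => // [n|k]; first by rewrite pder_mul_comm0.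
apply: na_comm => [|n|k']; [exact: eser_cgen | exact: mulop_comm |].
by rewrite fa_comm_mul.
Qed.

Lemma oc1_ob1 k l : oc1 k * ob1 l = ob1 l * oc1 k.
Proof.
case: k => [[|m]|m]; rewrite /oc1; first exact: commuteA.
  apply: commuteZl; apply: dress_comm => // [n|k]; first exact: pder_pder_comm.
  by rewrite (bD k m).2.
apply: dress_comm => // [n|k]; first by rewrite pder_mul_comm0.
apply: nb_comm => [|n|k']; [exact: eserN_cgen | exact: mulop_comm |].
by rewrite fb_comm_mul.
Qed.

Lemma oc1_od1 k l : oc1 k * od1 l - od1 l * oc1 k
  = (if k + l == 0 then k%:~R * ell else 0)%:A.
Proof.
have kz (X Y : lend P) : X * Y = Y * X -> X * Y - Y * X = 0 by move=> ->; rewrite subrr.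
case: l => [[|n]|n]; last first.
- rewrite oc1_xD; congr (_ *: _).
  have -> : (k + Negz n == 0) = (k == n.+1%:Z) by lia.
  by case: eqP => [->|].
- case: k => [[|m]|m].
  + have -> : (Posz 0 + n.+1%:Z == 0) = false by lia.
    by rewrite scale0r; apply: kz; exact: commuteA.
  + have -> : (m.+1%:Z + n.+1%:Z == 0) = false by lia.
    rewrite scale0r; apply: kz.
    by rewrite /oc1 /od1; apply: commuteZl; apply/esym/commuteZl; exact: pder_pder_comm.
  + rewrite /oc1 /od1 commutatorZr -opprB pder_mul_comm scalerN scalerA -scaleNr.
    congr (_ *: _); have -> : (gC n == gC m) = (n == m) by [].
    have -> : (Negz m + n.+1%:Z == 0) = (n == m) by lia.
    by case: eqP => [->|_]; rewrite ?mulr0 ?oppr0 // NegzE mulrNz mulr1 mulNr.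
- have -> : k + Posz 0 = k by exact: addr0.
  case: k => [[|m]|m].
  + by rewrite commuteA subrr mul0r scale0r.
  + rewrite scale0r; apply: kz.
    by rewrite /oc1; apply: commuteZl; exact: od1_comm_pderD.
  + rewrite scale0r; apply: kz.
    apply/esym; rewrite /od1; apply: commuteDl; first exact: commuteA.
    by rewrite (pdiag_charge_comm (i := gC m)).
Qed.

Lemma na_1 (p : nat -> P) (n : nat) : na ell cc p n 1 = 0.
Proof.
rewrite /na (@fieldE _ _ _ 0%N) ?big_ord0 //; first exact: fa_lfield.
by move=> i _; rewrite -PoszD /fa lendZE pder1 scaler0.
Qed.

Lemma nb_1 (q : nat -> P) (n : nat) : nb ell cc q n.+1 1 = 0.
Proof.
rewrite /nb (@fieldE _ _ _ 0%N) ?big_ord0 //; first exact: fb_lfield.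
by move=> i _; rewrite -PoszD addSn /fb lendZE pder1 scaler0.
Qed.

Theorem nwrep1 : nwrep ell cc dd oa1 ob1 oc1 od1 1.
Proof.
split.
- exact: oa1_oa1.
- exact: ob1_ob1.
- exact: oc1_oc1.
- exact: od1_od1.
- exact: oc1_oa1.
- exact: oc1_ob1.
- exact: oa1_ob1.
- exact: od1_oa1.
- exact: od1_ob1.
- exact: oc1_od1.
- by move=> n; rewrite dress_dfree ?na_1 //; exact: dfree1.
- by move=> n; rewrite dress_dfree ?nb_1 //; exact: dfree1.
- by move=> n; rewrite /oc1 lendZE pder1 scaler0.
- by move=> n; rewrite /od1 lendZE pder1 scaler0.
- by rewrite /oc1 lendZE.
- by rewrite /od1 lendDE lendZE pdiag1 addr0.
Qed.

End NonzeroLevel.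

(** * The realization at level zero *)

Section ZeroLevel.
Context (K : numFieldType) (P : polyalg K gvar) (cc dd : K).
Hypothesis cc0 : cc != 0.
Implicit Types (f g : P) (k l : int) (X : lend P).
Local Notation xA n := (pvar P (gA n)).
Local Notation xB n := (pvar P (gB n)).
Local Notation xC n := (pvar P (gC n)).
Local Notation xD n := (pvar P (gD n)).
Local Notation fa := (fa P 0 cc).
Local Notation fb := (fb P 0 cc).

Lemma field_translate (s : nat -> P) (y : int -> lend P) X (e : K) h k : lfield y ->
  (forall i, mulop (s i) * X = X * mulop (s i)) ->
  (forall k, X * y k - y k * X = e *: y (h + k)) ->
  X * field s y k - field s y k * X = e *: field s y (h + k).
Proof.
move=> ly sX yX; rewrite -[RHS]lfsumZ; last exact: field_locfin.
apply: lfsum_commutator => [||i]; first exact: field_locfin.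
  by move=> f; have [N NF] := field_locfin s (h + k) ly f; exists N => n /NF E;
    rewrite lendZE E scaler0.
by rewrite mulrA -sX -!mulrA -mulrBr yX -scalerAr addrA.
Qed.

Lemma lfsum_single (V : algType K) m (X : lend V) :
  lfsum (fun j => if j == m then X else 0) = X.
Proof.
have E v n : (m < n)%N -> (if n == m then X else 0) v = 0 by move=> mn; rewrite gtn_eqF.
apply: lendP => v; rewrite (lfsumE _ (E v)); last by move=> u; exists m.+1; exact: E.
rewrite (bigD1 ord_max) //= eqxx big1 ?addr0 // => i /eqP im.
by case: eqP => // e; case: im; exact: val_inj.
Qed.

(** With [normal2], the normal ordered product [:fb fa:]: the annihilation modes of [fb], from mode
    1 on, stand to the right, and its creation modes, from mode 0 down, to the left. *)
Definition normal1 k := lfsum (fun j : nat => fa (k - j.+1%:Z) * fb j.+1%:Z).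
Definition normal2 k := lfsum (fun j : nat => fb (- j%:Z) * fa (k + j%:Z)).
(** At level zero [fa] and [fb] form a Weyl system with scalar [cc]. Division by [-cc] makes this
    current translate their modes as [d] does. *)
Definition sugawara k : lend P := - cc^-1 *: (normal1 k + normal2 k).

Lemma normal1_locfin k : locfin (fun j : nat => fa (k - j.+1%:Z) * fb j.+1%:Z).
Proof.
move=> f; have [N NF] := fb_lfield 0 cc f; exists N => n Nn.
by rewrite lendME NF ?lend_vec0 // ltnW.
Qed.

Lemma normal2_locfin k : locfin (fun j : nat => fb (- j%:Z) * fa (k + j%:Z)).
Proof.
move=> f; have [N NF] := lfield_shift f k (fa_lfield (P := P) 0 cc); exists N => n Nn.
by rewrite lendME NF ?lend_vec0.
Qed.

Lemma fa_fb0 k l : fa k * fb l - fb l * fa k = (if k + l == 0 then cc else 0)%:A.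
Proof. by rewrite fa_fb mulr0 add0r. Qed.

Lemma locfin_single (V : algType K) m (X : lend V) :
  locfin (fun j => if j == m then X else 0).
Proof. by move=> v; exists m.+1 => n mn; rewrite gtn_eqF. Qed.

Lemma locfin0 (V : algType K) : locfin (fun _ => 0 : lend V).
Proof. by move=> v; exists 0%N. Qed.

(** The bracket with [fa k] picks out a single term of the sums, in [normal2] when [k >= 0] and in
    [normal1] when [k < 0]. *)
Lemma fa_normal k n : fa k * (normal1 n + normal2 n) - (normal1 n + normal2 n) * fa k
  = cc *: fa (n + k).
Proof.
have E1 (j : nat) : fa k * (fa (n - j.+1%:Z) * fb j.+1%:Z) - fa (n - j.+1%:Z) * fb j.+1%:Z * fa k
    = (if k + j.+1%:Z == 0 then cc else 0) *: fa (n - j.+1%:Z).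
  by rewrite mulrA fa_fa -!mulrA -mulrBr fa_fb0 mulr_algr.
have E2 (j : nat) : fa k * (fb (- j%:Z) * fa (n + j%:Z)) - fb (- j%:Z) * fa (n + j%:Z) * fa k
    = (if k - j%:Z == 0 then cc else 0) *: fa (n + j%:Z).
  by rewrite -[X in _ - X]mulrA [fa (n + j%:Z) * _]fa_fa !mulrA -mulrBl fa_fb0 mulr_algl.
rewrite mulrDr mulrDl opprD addrACA; case: k E1 E2 => m E1 E2.
- rewrite (lfsum_commutator (G := fun _ => 0)); [|exact: normal1_locfin|exact: locfin0|]; last first.
    by move=> j; rewrite E1 (_ : (m%:Z + j.+1%:Z == 0) = false) ?scale0r //; lia.
  rewrite lfsum0 add0r -[RHS](lfsum_single m).
  apply: lfsum_commutator => [||j]; [exact: normal2_locfin|exact: locfin_single|].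
  rewrite E2; have -> : (m%:Z - j%:Z == 0) = (j == m) by lia.
  by case: eqP => [->//|_]; rewrite scale0r.
- rewrite [X in _ + X](lfsum_commutator (G := fun _ => 0));
    [|exact: normal2_locfin|exact: locfin0|]; last first.
    by move=> j; rewrite E2 (_ : (Negz m - j%:Z == 0) = false) ?scale0r //; lia.
  rewrite lfsum0 addr0 -[RHS](lfsum_single m).
  apply: lfsum_commutator => [||j]; [exact: normal1_locfin|exact: locfin_single|].
  rewrite E1; have -> : (Negz m + j.+1%:Z == 0) = (j == m) by lia.
  by case: eqP => [->|_]; rewrite ?scale0r // NegzE.
Qed.

Lemma fb_normal k n : fb k * (normal1 n + normal2 n) - (normal1 n + normal2 n) * fb k
  = - cc *: fb (n + k).
Proof.
have swap (x y : lend P) : x * y - y * x = - (y * x - x * y) by rewrite opprB.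
have E1 (j : nat) : fb k * (fa (n - j.+1%:Z) * fb j.+1%:Z) - fa (n - j.+1%:Z) * fb j.+1%:Z * fb k
    = (if n - j.+1%:Z + k == 0 then - cc else 0) *: fb j.+1%:Z.
  rewrite -[X in _ - X]mulrA [fb j.+1%:Z * _]fb_fb !mulrA -mulrBl swap fa_fb0 -scaleNr mulr_algl.
  by case: ifP; rewrite ?oppr0.
have E2 (j : nat) : fb k * (fb (- j%:Z) * fa (n + j%:Z)) - fb (- j%:Z) * fa (n + j%:Z) * fb k
    = (if n + j%:Z + k == 0 then - cc else 0) *: fb (- j%:Z).
  rewrite mulrA [fb k * fb _]fb_fb -!mulrA -mulrBr swap fa_fb0 -scaleNr mulr_algr.
  by case: ifP; rewrite ?oppr0.
rewrite mulrDr mulrDl opprD addrACA; case: (ltrP 0 (n + k)) => nk.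
- rewrite [X in _ + X](lfsum_commutator (G := fun _ => 0));
    [|exact: normal2_locfin|exact: locfin0|]; last first.
    by move=> j; rewrite E2 (_ : (n + j%:Z + k == 0) = false) ?scale0r //; lia.
  have [m mE] : exists m : nat, n + k = m.+1 by exists (absz (n + k)).-1; lia.
  rewrite lfsum0 addr0 -[RHS](lfsum_single m).
  apply: lfsum_commutator => [||j]; [exact: normal1_locfin|exact: locfin_single|].
  rewrite E1; have -> : (n - j.+1%:Z + k == 0) = (j == m) by lia.
  by case: eqP => [->|_]; rewrite ?scale0r // mE.
- rewrite (lfsum_commutator (G := fun _ => 0)); [|exact: normal1_locfin|exact: locfin0|]; last first.
    by move=> j; rewrite E1 (_ : (n - j.+1%:Z + k == 0) = false) ?scale0r //; lia.
  have [m mE] : exists m : nat, n + k = - m%:Z by exists (absz (n + k)); lia.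
  rewrite lfsum0 add0r -[RHS](lfsum_single m).
  apply: lfsum_commutator => [||j]; [exact: normal2_locfin|exact: locfin_single|].
  rewrite E2; have -> : (n + j%:Z + k == 0) = (j == m) by lia.
  by case: eqP => [->|_]; rewrite ?scale0r // mE.
Qed.

Lemma sugawara_fa n k : sugawara n * fa k - fa k * sugawara n = fa (n + k).
Proof.
rewrite /sugawara commutatorZl -opprB fa_normal scaleNr scalerN opprK scalerA mulVf //.
exact: scale1r.
Qed.

Lemma sugawara_fb n k : sugawara n * fb k - fb k * sugawara n = - fb (n + k).
Proof.
rewrite /sugawara commutatorZl -opprB fb_normal scaleNr scalerN opprK scalerA mulrN mulVf //.
exact: scaleN1r.
Qed.

Lemma sugawara_comm X n : (forall k, X * fa k = fa k * X) -> (forall k, X * fb k = fb k * X) ->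
  X * sugawara n = sugawara n * X.
Proof.
move=> Xa Xb; apply/esym/commuteZl; apply/esym; rewrite mulrDr mulrDl.
congr (_ + _); apply: lfsum_comm => [|j]; [exact: normal1_locfin| |exact: normal2_locfin|];
  by apply/esym/commuteMl; rewrite ?Xa ?Xb.
Qed.

Lemma fa_1 (n : nat) : fa n 1 = 0.
Proof. by rewrite lendZE pder1 scaler0. Qed.
Lemma fb_1 (n : nat) : fb n.+1 1 = 0.
Proof. by rewrite lendZE pder1 scaler0. Qed.

Lemma sugawara_1 (n : nat) : sugawara n 1 = 0.
Proof.
rewrite /sugawara lendZE lendDE (@lfsumE _ _ _ _ 0%N) ?(@lfsumE _ _ _ _ 0%N) ?big_ord0.
- by rewrite addr0 scaler0.
- exact: normal2_locfin.
- by move=> j _; rewrite lendME -PoszD fa_1 lend_vec0.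
- exact: normal1_locfin.
- by move=> j _; rewrite lendME fb_1 lend_vec0.
Qed.

Lemma sugawara_neg m : sugawara (- m%:Z) 1
  = - cc^-1 *: \sum_(j < m) fb (- j%:Z) (fa (- m%:Z + j%:Z) 1).
Proof.
rewrite /sugawara lendZE lendDE (@lfsumE _ _ _ _ 0%N) ?big_ord0 ?add0r.
- rewrite (@lfsumE _ _ _ _ m); first by [].
  + exact: normal2_locfin.
  + move=> j mj; rewrite lendME; have -> : - m%:Z + j%:Z = (j - m)%N by lia.
    by rewrite fa_1 lend_vec0.
- exact: normal1_locfin.
- by move=> j _; rewrite lendME fb_1 lend_vec0.
Qed.

Lemma sugawara_sugawara_neg k m : sugawara k (sugawara (- m%:Z) 1) =
  - cc^-1 *: \sum_(j < m) (fb (- j%:Z) (fa (k - m%:Z + j%:Z) 1)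
    - fb (k - j%:Z) (fa (- m%:Z + j%:Z) 1)
    + fb (- j%:Z) (fa (- m%:Z + j%:Z) (sugawara k 1))).
Proof.
rewrite sugawara_neg lend_vecZ lend_vec_sum; congr (_ *: _); apply: eq_bigr => j _.
have Ea l f : sugawara k (fa l f) = fa (k + l) f + fa l (sugawara k f).
  have := congr1 (fun F : lend P => F f) (sugawara_fa k l).
  by rewrite [LHS]lendDE [X in _ + X = _]lendNE !lendME => <-; rewrite subrK.
have Eb l f : sugawara k (fb l f) = - fb (k + l) f + fb l (sugawara k f).
  have := congr1 (fun F : lend P => F f) (sugawara_fb k l).
  by rewrite [LHS]lendDE [X in _ + X = _]lendNE !lendME [RHS]lendNE => <-; rewrite subrK.
rewrite Eb Ea lend_vecD !addrA.
by congr (_ + _); rewrite addrC.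
Qed.

(** Either side is the sum of [m + n] terms minus the sums of the first [m] and of the first [n]. *)
Lemma telescope_shift (F : nat -> P) m n :
  \sum_(j < m) (F (n + j)%N - F j) = \sum_(j < n) (F (m + j)%N - F j).
Proof.
rewrite !sumrB; apply/eqP; rewrite subr_eq addrAC eq_sym subr_eq; apply/eqP.
transitivity (\sum_(j < m + n) F j); first by rewrite big_split_ord addrC.
by rewrite addnC big_split_ord addrC.
Qed.

(** The variables generate all polynomials from 1, so an operator commuting with them is determined
    by its value at 1. *)
Lemma mulop_all X : (forall i, X * mulop (pvar P i) = mulop (pvar P i) * X) -> X = mulop (X 1).
Proof.
move=> XC; apply: lendP => f; rewrite mulopE.
elim/poly_ind: f => [k f g IHf IHg||i f IH].
- by rewrite lend_vecD lend_vecZ IHf IHg pmulP.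
- by rewrite mulr1.
- rewrite [RHS]mulrCA -IH; exact: (congr1 (fun F : lend P => F f) (XC i)).
Qed.

Lemma fa_neg_mul m f : fa (- m.+1%:Z) f = xA m * f. Proof. by rewrite -NegzE. Qed.
Lemma fb_neg_mul m f : fb (- m%:Z) f = xB m * f.
Proof. by case: m => [|m] //; rewrite -NegzE. Qed.

(** The Jacobi identity: bracketing [F m] with [J k] and [J l] in either order gives the same
    multiple of [F (k + l + m)]. *)
Lemma commutator_translate (J F : int -> lend P) (Y : K) k l m :
  (forall n k, J n * F k - F k * J n = Y *: F (n + k)) ->
  (J k * J l - J l * J k) * F m = F m * (J k * J l - J l * J k).
Proof.
move=> JF; apply: lendP => f.
have JFE n k' g : J n (F k' g) = F k' (J n g) + Y *: F (n + k') g.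
  have := congr1 (fun G : lend P => G g) (JF n k').
  by rewrite [LHS]lendDE [X in _ + X = _]lendNE !lendME lendZE => <-; rewrite addrC subrK.
have XE g : (J k * J l - J l * J k : lend P) g = J k (J l g) - J l (J k g) by [].
rewrite !lendME !XE !(JFE, lend_vecD, lend_vecZ, lend_vecN) [l + (k + m)]addrCA.
rewrite !scalerDr.
move: (F m _) (F m _) (_ *: F (k + m) _) (_ *: F (l + m) _) (_ *: (_ *: _)) => u v x y z.
ring.
Qed.

(** The commutator commutes with every variable, so [mulop_all] reduces it to its value at 1, where
    normal ordered sums are finite. Reordering there leaves a scalar for opposite modes only. *)
Lemma sugawara_sugawara k l : sugawara k * sugawara l - sugawara l * sugawara k
  = (if k + l == 0 then - k%:~R else 0)%:A.
Proof.
set X := _ - _.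
have Xa m : X * fa m = fa m * X by apply: (commutator_translate (Y := 1)) => n j; rewrite sugawara_fa scale1r.
have Xb m : X * fb m = fb m * X by apply: (commutator_translate (Y := -1)) => n j; rewrite sugawara_fb scaleN1r.
have Jcd i n : match i with inl _ => False | _ => True end ->
    mulop (pvar P i) * sugawara n = sugawara n * mulop (pvar P i).
  by move=> ii; apply: sugawara_comm => j; [apply: fa_comm_mul | apply: fb_comm_mul];
    case: i ii => [[]|[]].
have Xv i : X * mulop (pvar P i) = mulop (pvar P i) * X.
  case: i => [[n|n]|i].
  - exact: (Xa (Negz n)).
  - by case: n => [|n]; [exact: (Xb 0) | exact: (Xb (Negz n))].
  - by rewrite /X; apply: commuteDl; [|rewrite mulNr mulrN; congr (- _)];
      apply: commuteMl; rewrite Jcd.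
rewrite (mulop_all Xv); suff -> : X 1 = (if k + l == 0 then - k%:~R else 0)%:A by rewrite mulopA.
pose R (c : int) (i : nat) : P := fb (- i%:Z) (fa (c + i%:Z) 1).
(* After telescoping, [a] commutators of [fb] with [fa] remain, each a scalar [cc] up to sign when
   [a = m] and 0 otherwise; the prefactor [- cc^-1] turns the total into [-a]. *)
have posneg (a m : nat) (X1 := sugawara a (sugawara (- m%:Z) 1) - sugawara (- m%:Z) (sugawara a 1)) :
    X1 = (if a == m then - a%:R else 0)%:A.
  rewrite /X1 sugawara_1 lend_vec0 subr0 sugawara_sugawara_neg.
  pose S (i : nat) : P := fb (a%:Z - i%:Z) (fa (- m%:Z + i%:Z) 1).
  have S0 i : (m <= i)%N -> S i = 0.
    move=> mi; rewrite /S; have -> : - m%:Z + i%:Z = (i - m)%N by lia.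
    by rewrite fa_1 lend_vec0.
  have Sa i : (i < a)%N -> S i = (if a == m then - cc else 0)%:A.
    move=> ia; rewrite /S; have := fa_fb0 (- m%:Z + i%:Z) (a%:Z - i%:Z).
    move=> /(congr1 (fun G : lend P => G 1)).
    rewrite [LHS]lendDE [X in _ + X = _]lendNE !lendME.
    have -> : a%:Z - i%:Z = (a - i.+1).+1%:Z by lia.
    rewrite fb_1 lend_vec0 sub0r => /eqP; rewrite eqr_oppLR => /eqP ->.
    have -> : (- m%:Z + i%:Z + (a - i.+1).+1%:Z == 0) = (a == m) by lia.
    by rewrite -scaleNr; case: eqP; rewrite ?oppr0.
  rewrite (eq_bigr (fun j : 'I_m => S (a + j)%N - S j)) => [|j _]; last first.
    rewrite sugawara_1 !lend_vec0 addr0 /S; congr (fb _ (fa _ _) - _); lia.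
  rewrite (telescope_shift S) (eq_bigr (fun j : 'I_a => - (if a == m then - cc else 0)%:A)).
    rewrite sumr_const card_ord -scaler_nat scalerN -!scaleNr !scalerA; congr (_ *: _).
    case: eqP => _; last by rewrite mulr0.
    by rewrite mulrAC mulrNN mulVf // mul1r.
  by move=> j _; rewrite S0 ?leq_addr // sub0r Sa.
(* Here the modes of [fa] and [fb] involved are creation modes. By telescoping, the expression
   becomes symmetric in [n] and [m]. *)
have negneg (n m : nat) : sugawara (- n%:Z) (sugawara (- m%:Z) 1)
    = sugawara (- m%:Z) (sugawara (- n%:Z) 1).
  rewrite !sugawara_sugawara_neg; congr (_ *: _).
  have E (a b : nat) : \sum_(j < b) (fb (- j%:Z) (fa (- a%:Z - b%:Z + j%:Z) 1) -
      fb (- a%:Z - j%:Z) (fa (- b%:Z + j%:Z) 1) +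
      fb (- j%:Z) (fa (- b%:Z + j%:Z) (sugawara (- a%:Z) 1)))
    = - \sum_(j < b) (R (- (a + b)%N%:Z) (a + j)%N - R (- (a + b)%N%:Z) j)
      + (\sum_(j < b) R (- b%:Z) j) * sugawara (- a%:Z) 1.
    rewrite mulr_suml -sumrN -big_split /=; apply: eq_bigr => j _; congr (_ + _).
      rewrite opprB /R; congr (fb _ (fa _ _) - fb _ (fa _ _)); lia.
    rewrite /R; have -> : - b%:Z + j%:Z = - (b - j.+1).+1%:Z by have := ltn_ord j; lia.
    by rewrite !fa_neg_mul !fb_neg_mul mulr1 mulrA.
  rewrite !E (telescope_shift (R (- (n + m)%N%:Z))) addnC; congr (_ + _).
  have Q (b : nat) : \sum_(j < b) R (- b%:Z) j = - cc *: sugawara (- b%:Z) 1.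
    by rewrite sugawara_neg scalerA mulrNN mulfV // scale1r.
  rewrite !Q; move: (sugawara _ 1) (sugawara _ 1) => u v.
  by rewrite -!scalerAl mulrC.
have XE : X 1 = sugawara k (sugawara l 1) - sugawara l (sugawara k 1) by [].
rewrite XE; case: (lerP 0 k) => hk; case: (lerP 0 l) => hl.
- have [a ->] : exists a : nat, k = a by exists (absz k); lia.
  have [b ->] : exists b : nat, l = b by exists (absz l); lia.
  rewrite !sugawara_1 !lend_vec0 subrr; case: eqP => [e|_]; last by rewrite scale0r.
  have -> : a = 0%N by lia.
  by rewrite oppr0 scale0r.
- have [a ->] : exists a : nat, k = a by exists (absz k); lia.
  have [b ->] : exists b : nat, l = - b%:Z by exists (absz l); lia.
  have -> : (a%:Z - b%:Z == 0) = (a == b) by lia.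
  exact: posneg.
- have [a ->] : exists a : nat, k = - a%:Z by exists (absz k); lia.
  have [b ->] : exists b : nat, l = b by exists (absz l); lia.
  have -> : (- a%:Z + b%:Z == 0) = (b == a) by lia.
  rewrite -opprB posneg -scaleNr; congr (_ *: _).
  by case: eqP => [->|_]; rewrite ?oppr0 // rmorphN.
- have [a ak] : exists a : nat, k = - a%:Z by exists (absz k); lia.
  have [b bl] : exists b : nat, l = - b%:Z by exists (absz l); lia.
  have -> : (k + l == 0) = false by lia.
  by rewrite ak bl negneg subrr scale0r.
Qed.

(** At level zero only the product of the two series is prescribed; all of it is given to [a]. *)
Definition pser0 (i : nat) : P := if i is i'.+1 then cc^-1 *: xC i' else 1.
Definition qser0 (i : nat) : P := (i == 0%N)%:R.

Lemma pser0_cgen i : cgen (pser0 i).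
Proof. by case: i => [|i]; [exact: cgen1 | apply: cgenZ; exact: cgen_var]. Qed.
Lemma qser0_cgen i : cgen (qser0 i).
Proof.
rewrite /qser0; case: eqP => _; first exact: cgen1.
have -> : false%:R = 0 *: (1 : P) by rewrite scale0r.
exact/cgenZ/cgen1.
Qed.

Lemma ser0_conv k T :
  \sum_(i < T.+1) ((k + i)%:~R * 0 + cc) *: (pser0 i * qser0 (T - i)%N)
    = cseries P cc T + (if T == 0%N then k%:~R * 0 else 0)%:A.
Proof.
rewrite mulr0 if_same scale0r addr0 big_ord_recr /= subnn big1 => [|i _]; last first.
  rewrite /qser0; have -> : (T - i == 0)%N = false by have := ltn_ord i; lia.
  by rewrite !mulr0 scaler0.
rewrite add0r mulr0 add0r mulr1; case: T => [//|T] /=.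
by rewrite scalerA mulfV // scale1r.
Qed.

Definition oa2 := na 0 cc pser0.
Definition ob2 := nb 0 cc qser0.
Definition oc2 := nc P cc.
(** A Heisenberg system of level 1 that compensates the level -1 of [sugawara]; [dd] enters through
    mode 0. *)
Definition dpart k : lend P :=
  match k with
  | Posz 0 => dd%:A
  | Posz n.+1 => n.+1%:R *: pder P (gD n)
  | Negz n => mulop (xD n)
  end.
Definition od2 k : lend P := sugawara k + dpart k.

Lemma sugawara_comm_inr i n :
  (mulop (pvar P (inr i)) * sugawara n = sugawara n * mulop (pvar P (inr i))) *
  (pder P (inr i) * sugawara n = sugawara n * pder P (inr i)).
Proof.
split; apply: sugawara_comm => k.
- by rewrite fa_comm_mul.
- by rewrite fb_comm_mul.
- by rewrite fa_comm_pder.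
- by rewrite fb_comm_pder.
Qed.

Lemma dpart_comm X k : (forall n, mulop (xD n) * X = X * mulop (xD n)) ->
  (forall n, pder P (gD n) * X = X * pder P (gD n)) -> dpart k * X = X * dpart k.
Proof.
move=> xX dX; case: k => [[|n]|n]; rewrite /dpart //; first exact: commuteA.
exact: commuteZl.
Qed.

Lemma dpart_dpart k l : dpart k * dpart l - dpart l * dpart k
  = (if k + l == 0 then k%:~R else 0)%:A.
Proof.
have comm0 (X Y : lend P) : X * Y = Y * X -> X * Y - Y * X = (0 : K)%:A.
  by move=> ->; rewrite subrr scale0r.
case: k => [[|m]|m]; case: l => [[|n]|n]; rewrite /dpart.
- by rewrite commuteA subrr; case: (_ =P _) => _; exact/esym/scale0r.
- by rewrite commuteA subrr; case: (_ =P _) => _; exact/esym/scale0r.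
- by rewrite commuteA subrr; case: (_ =P _) => _; exact/esym/scale0r.
- have -> : (m.+1%:Z + 0%:Z == 0) = false by lia.
  apply: comm0; exact/esym/commuteA.
- have -> : (m.+1%:Z + n.+1%:Z == 0) = false by lia.
  apply: comm0; apply: commuteZl; apply/esym/commuteZl; exact: pder_pder_comm.
- rewrite commutatorZl pder_mul_comm scalerA; congr (_ *: _).
  have -> : (gD m == gD n) = (m == n) by [].
  have -> : (m.+1%:Z + Negz n == 0) = (m == n) by lia.
  by case: eqP => [->|_]; rewrite ?mulr1 ?mulr0.
- have -> : (Negz m + 0%:Z == 0) = false by lia.
  apply: comm0; exact/esym/commuteA.
- rewrite commutatorZr -opprB pder_mul_comm scalerN scalerA -scaleNr; congr (_ *: _).
  have -> : (gD n == gD m) = (n == m) by [].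
  have -> : (Negz m + n.+1%:Z == 0) = (n == m) by lia.
  by case: eqP => [->|_]; rewrite ?mulr0 ?oppr0 // NegzE mulrNz mulr1.
- have -> : (Negz m + Negz n == 0) = false by lia.
  apply: comm0; exact: mulop_comm.
Qed.

Let aD2 := na_dlinear 0 cc pser0_cgen.
Let bD2 := nb_dlinear 0 cc qser0_cgen.

Lemma od2_oa2 k l : od2 k * oa2 l - oa2 l * od2 k = oa2 (k + l).
Proof.
rewrite mulrDl mulrDr opprD addrACA (dpart_comm _ (X := oa2 l)); last 2 first.
- by move=> n; rewrite (aD2 l n).1.
- by move=> n; rewrite (aD2 l n).2.
rewrite subrr addr0 -[RHS]scale1r.
apply: field_translate => [|i|l']; first exact: fa_lfield.
  by apply: pser0_cgen => n; rewrite sugawara_comm_inr.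
by rewrite sugawara_fa scale1r.
Qed.

Lemma od2_ob2 k l : od2 k * ob2 l - ob2 l * od2 k = - ob2 (k + l).
Proof.
rewrite mulrDl mulrDr opprD addrACA (dpart_comm _ (X := ob2 l)); last 2 first.
- by move=> n; rewrite (bD2 l n).1.
- by move=> n; rewrite (bD2 l n).2.
rewrite subrr addr0 -[RHS]scaleN1r.
apply: field_translate => [|i|l']; first exact: fb_lfield.
  by apply: qser0_cgen => n; rewrite sugawara_comm_inr.
by rewrite sugawara_fb scaleN1r.
Qed.

Lemma oc2_comm X k : (forall n, mulop (xC n) * X = X * mulop (xC n)) -> oc2 k * X = X * oc2 k.
Proof.
move=> XC; case: k => [[|n]|n]; rewrite /oc2 /nc ?mul0r ?mulr0 //; exact: commuteA.
Qed.

Lemma od2_od2 k l : od2 k * od2 l = od2 l * od2 k.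
Proof.
have JD m n : dpart m * sugawara n = sugawara n * dpart m.
  by apply: dpart_comm => i; rewrite sugawara_comm_inr.
apply/eqP; rewrite -subr_eq0 /od2 !mulrDl !mulrDr !JD.
have : sugawara k * sugawara l - sugawara l * sugawara k
    + (dpart k * dpart l - dpart l * dpart k) = 0.
  rewrite sugawara_sugawara dpart_dpart -scalerDl; case: ifP => _.
    by rewrite addNr scale0r.
  by rewrite addr0 scale0r.
move: (sugawara k) (sugawara l) (dpart k) (dpart l) => a b c d e.
apply/eqP; rewrite -[RHS]e; apply: lendP => f; rewrite !(lendDE, lendNE).
move: ((a * b : lend P) f) ((b * a : lend P) f) ((a * d : lend P) f) ((b * c : lend P) f)
  ((c * d : lend P) f) ((d * c : lend P) f) => x1 x2 x3 x4 x5 x6.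
ring.
Qed.

Lemma oc2_od2 k l : oc2 k * od2 l - od2 l * oc2 k = (if k + l == 0 then k%:~R * 0 else 0)%:A.
Proof.
rewrite mulr0 if_same scale0r; apply/eqP; rewrite subr_eq0; apply/eqP/oc2_comm => n.
rewrite mulrDr mulrDl sugawara_comm_inr; congr (_ + _); apply/esym/dpart_comm => m.
  exact: mulop_comm.
exact: pder_mul_comm0.
Qed.

Theorem nwrep2 : nwrep 0 cc dd oa2 ob2 oc2 od2 1.
Proof.
split.
- move=> m n; apply: na_na => i; exact/cgen_cpoly/pser0_cgen.
- move=> m n; apply: nb_nb => i; exact/cgen_cpoly/qser0_cgen.
- by move=> m n; apply: oc2_comm => i; apply/esym/oc2_comm => j; exact: mulop_comm.
- exact: od2_od2.
- move=> m n; apply: oc2_comm => i; apply/esym/na_comm => [|j|k]; [exact: pser0_cgen|exact: mulop_comm|].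
  by rewrite fa_comm_mul.
- move=> m n; apply: oc2_comm => i; apply/esym/nb_comm => [|j|k]; [exact: qser0_cgen|exact: mulop_comm|].
  by rewrite fb_comm_mul.
- move=> m n; apply: na_nb => [i|i|]; [exact/cgen_cpoly/pser0_cgen|exact/cgen_cpoly/qser0_cgen|].
  exact: ser0_conv.
- exact: od2_oa2.
- exact: od2_ob2.
- exact: oc2_od2.
- exact: na_1.
- exact: nb_1.
- by [].
- by move=> n; rewrite lendDE sugawara_1 lendZE pder1 scaler0 addr0.
- by rewrite /oc2 lendZE.
- by rewrite lendDE (sugawara_1 0) add0r lendZE.
Qed.

End ZeroLevel.

(** * Ordered words and injectivity of the realizations *)

Section Spanning.
Context (K : numFieldType) (ell cc dd : K).
Local Notation V := (affnw_verma ell cc dd).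
Local Notation hwv := (affnw_hwv ell cc dd).
Implicit Types (u v : V) (x y : nw K).

Definition mode (n : int) x : env (affnw K) := env_gen (affnw_mode x n).

Lemma affnw_modeP k x y n :
  affnw_mode (k *: x + y) n = k *: affnw_mode x n + affnw_mode y n.
Proof.
congr pair; first exact: loop_mono_linear.
by rewrite /= addr0 -[k *: (0 : K^o)]/(k * 0) mulr0.
Qed.

Lemma mode_linear n : linear (mode n).
Proof. by move=> k x y; rewrite /mode affnw_modeP linearP. Qed.
HB.instance Definition _ n := GRing.isLinear.Build K (nw K) (env (affnw K)) *:%R (mode n)
  (mode_linear n).

Lemma mode_commute x m y n : mode m x * mode n y = mode n y * mode m x
  + mode (m + n) (lie_br x y)
  + (if m + n == 0 then m%:~R * nw_form x y else 0) *: env_gen (affnw_k K).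
Proof.
have := env_gen_br (affnw_mode x m) (affnw_mode y n).
have -> : lie_br (affnw_mode x m) (affnw_mode y n) = _ := affnw_br_mode x m y n.
rewrite linearD linearZ /= => /eqP; rewrite eq_sym subr_eq => /eqP ->.
by rewrite addrC addrA.
Qed.

Lemma env_k_commute (X : env (affnw K)) : env_gen (affnw_k K) * X = X * env_gen (affnw_k K).
Proof.
elim/env_ind: X => [k|z|a b IHa IHb|a b IHa IHb].
- by rewrite mulr_algl mulr_algr.
- apply/eqP; rewrite -subr_eq0 -env_gen_br.
  have -> : lie_br (affnw_k K) z = 0 by exact: affnw_br_kl.
  by rewrite linear0.
- by rewrite mulrDl mulrDr IHa IHb.
- by rewrite mulrA IHa -[LHS]mulrA IHb mulrA.
Qed.

Lemma affnw_mode_ge0 x (n : nat) : affnw_ge0_pred (affnw_mode x n).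
Proof.
apply/asboolP => m m0; rewrite loop_coef_mono.
by case: eqP => // e; rewrite -e in m0.
Qed.

Lemma affnw_k_ge0 : affnw_ge0_pred (affnw_k K).
Proof. by apply/asboolP => m m0; rewrite loop_coef0. Qed.

Lemma tpure1Z (k : K) (m : restr (env_lift (affnw_ev_rep ell)) (verma cc dd)) :
  tpure (env_incl (p := affnw_ge0 K)) 1 ((k%:A : env (nw K)) *: (m : verma cc dd) : restr _ _)
  = k%:A *: tpure (env_incl (p := affnw_ge0 K)) 1 m.
Proof.
rewrite tpureZ mulr1.
have -> : k%:A = 1 * env_incl (k%:A : env (lsub (affnw_ge0 K))).
  by rewrite mul1r; exact/esym/env_lift_const.
rewrite tpure_balanced; congr tpure.
by rewrite [RHS]/(env_lift (affnw_ev_rep ell) k%:A *: (m : verma cc dd)) env_lift_const.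
Qed.

Lemma hwv_k : env_gen (affnw_k K) *: hwv = ell%:A *: hwv.
Proof.
have := affnw_hwvE ell cc dd (exist _ (affnw_k K) affnw_k_ge0 : lsub (affnw_ge0 K)).
by rewrite /= loop_coef0 linear0 add0r mulr1 => ->; rewrite tpure1Z.
Qed.

Lemma tpure10 : tpure (env_incl (p := affnw_ge0 K)) 1
  (0 : restr (env_lift (affnw_ev_rep ell)) (verma cc dd)) = 0.
Proof.
have /eqP := tpureDr (env_incl (p := affnw_ge0 K)) 1
  (0 : restr (env_lift (affnw_ev_rep ell)) (verma cc dd)) 0.
by rewrite addr0 -subr_eq0 opprD addNKr oppr_eq0 => /eqP.
Qed.

Lemma hwv_pos x (n : nat) : mode n.+1 x *: hwv = 0.
Proof.
have := affnw_hwvE ell cc dd (exist (affnw_ge0_pred (K := K)) _ (affnw_mode_ge0 x n.+1) : lsub (affnw_ge0 K)).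
rewrite /= loop_coef_mono /= linear0 mulr0 scale0r addr0 /mode => ->.
by rewrite -[RHS]tpure10 scale0r.
Qed.

Lemma hwv_0 x : nw_coord 1 x = 0 -> mode 0 x *: hwv
  = (cc * nw_coord 2 x + dd * nw_coord 3 x)%:A *: hwv.
Proof.
move=> x1; have := affnw_hwvE ell cc dd (exist (affnw_ge0_pred (K := K)) _ (affnw_mode_ge0 x 0) : lsub (affnw_ge0 K)).
rewrite /= loop_coef_mono /= mulr0 scale0r addr0 /mode => ->.
have xb : borel_pred x by apply/eqP.
by rewrite (verma_hwvE cc dd (exist _ x xb : lsub (borel K))) /= tpure1Z.
Qed.

(** Tensors are brought to the highest weight vector in both inductions, by moving scalars across
    the tensor sign. *)
Lemma verma_cyclic u : exists X : env (affnw K), u = X *: hwv.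
Proof.
elim/tensor_ind: u => [a m|u v [X ->] [Y ->]|u [X ->]|]; last 1 first.
- by exists 0; rewrite scale0r.
- suff [X XE] : exists X : env (affnw K), tpure (env_incl (p := affnw_ge0 K)) 1 m = X *: hwv.
    by exists (a * X); rewrite -scalerA -XE tpureZ mulr1.
  elim/tensor_ind: m => [b k|u v [X XE] [Y YE]|u [X XE]|].
  (* The evaluation onto the enveloping algebra of [H_4] is surjective, since [x(0)] is sent to
     [x]. *)
  + have bE : exists b' : env (lsub (affnw_ge0 K)), env_lift (affnw_ev_rep ell) b' = b.
      elim/env_ind: b => [l|x|b b' [c <-] [c' <-]|b b' [c <-] [c' <-]].
      * by exists l%:A; rewrite env_lift_const.
      * exists (env_gen (exist (affnw_ge0_pred (K := K)) _ (affnw_mode_ge0 x 0) : lsub (affnw_ge0 K))).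
        by rewrite env_lift_gen /= /affnw_ev /= loop_coef_mono mulr0 scale0r addr0.
      * by exists (c + c'); rewrite rmorphD.
      * by exists (c * c'); rewrite rmorphM.
    case: bE => b' <-.
    exists (env_incl b' * (k : K)%:A).
    have -> : (env_incl b' * (k : K)%:A) *: hwv = tpure (env_incl (p := affnw_ge0 K))
        (1 * env_incl b') (((k : K)%:A : env (nw K)) *: verma_hwv cc dd : restr (env_lift (affnw_ev_rep ell)) (verma cc dd)).
      by rewrite -scalerA mul1r -[env_incl b' in RHS]mulr1 -tpureZ tpure1Z.
    rewrite tpure_balanced; congr tpure.
    have -> : ((k : K)%:A : env (nw K)) *: verma_hwv cc dd
        = tpure (env_incl (p := borel K)) 1 (k : char_module cc dd).
      rewrite /verma_hwv !tpureZ !mulr1.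
      have -> : (k : K)%:A = 1 * env_incl ((k : K)%:A : env (lsub (borel K))).
        by rewrite mul1r; exact/esym/env_lift_const.
      rewrite tpure_balanced; congr tpure.
      rewrite [LHS]/(env_lift (borel_rep cc dd) (k : K)%:A * (1 : K)) env_lift_const.
      exact: etrans (mulr1 _) (mulr1 _).
    apply/esym; apply: etrans (tpureZ _ _ _ _) _; congr tpure; exact: mulr1.
  + by exists (X + Y); rewrite scalerDl -XE -YE -tpureDr.
  + exists (- X); rewrite scaleNr -XE; apply/eqP; rewrite -addr_eq0 -tpureDr addNr.
    by rewrite tpure10.
  + by exists 0; rewrite scale0r tpure10.
- by exists (X + Y); rewrite scalerDl.
- by exists (- X); rewrite scaleNr.
Qed.

End Spanning.

Lemma seq_argmin (T : eqType) (F : T -> int) (s : seq T) : s != [::] ->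
  exists2 x, x \in s & forall y, y \in s -> F x <= F y.
Proof.
elim: s => // x [|x' s] IH _.
  by exists x; rewrite ?inE // => y; rewrite inE => /eqP ->.
have [//|z zs zmin] := IH; case: (lerP (F x) (F z)) => xz.
  exists x; first by rewrite inE eqxx.
  by move=> y; rewrite inE => /predU1P[->//|/zmin]; exact: le_trans.
exists z; first by rewrite inE zs orbT.
by move=> y; rewrite inE => /predU1P[->|/zmin//]; exact: ltW.
Qed.

(** * Spanning by ordered words, and their independence *)

Section PBWSpanning.
Context (K : numFieldType) (ell cc dd : K).
Local Notation V := (affnw_verma ell cc dd).
Local Notation hwv := (affnw_hwv ell cc dd).
Local Notation mode := (@mode K).
Implicit Types (u v : V) (x y : nw K) (k : K).

Inductive lspan (S : V -> Prop) : V -> Prop :=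
| lspan0 : lspan S 0
| lspanP k u v : S u -> lspan S v -> lspan S (k%:A *: u + v).

Lemma lspan_gen (S : V -> Prop) u : S u -> lspan S u.
Proof.
move=> Su; rewrite -[u]addr0 -[u]scale1r -[1](scale1r (1 : env (affnw K))).
exact: lspanP (lspan0 S).
Qed.

Lemma lspanD S u v : lspan S u -> lspan S v -> lspan S (u + v).
Proof.
move=> Su Sv; elim: Su => [|k w w' Sw _ IH]; first by rewrite add0r.
by rewrite -addrA; exact: lspanP.
Qed.

Lemma lspan_bind S S' (X : env (affnw K)) u : (forall u, S u -> lspan S' (X *: u)) ->
  lspan S u -> lspan S' (X *: u).
Proof.
move=> SS'; elim=> [|k w w' Sw _ IH]; first by rewrite scaler0; exact: lspan0.
have lsZ : forall w, lspan S' w -> lspan S' (k%:A *: w).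
  move=> z; elim=> [|l y y' Sy _ IHy]; first by rewrite scaler0; exact: lspan0.
  by rewrite scalerDr scalerA mulr_algl scalerA; exact: lspanP.
rewrite scalerDr scalerA mulr_algr -mulr_algl -scalerA.
by apply: lspanD => //; apply: lsZ; exact: SS'.
Qed.

Lemma lspan_trans S S' u : (forall u, S u -> lspan S' u) -> lspan S u -> lspan S' u.
Proof.
move=> SS' Su; rewrite -[u]scale1r; apply: lspan_bind Su => v /SS'.
by rewrite scale1r.
Qed.

Lemma lspanZ S k u : lspan S u -> lspan S (k%:A *: u).
Proof.
apply: lspan_bind => v Sv; rewrite -[_ *: v]addr0; exact: lspanP (lspan0 S).
Qed.

Lemma lspanN S u : lspan S u -> lspan S (- u).
Proof. by move=> /(lspanZ (-1)); rewrite (scaleN1r (1 : env (affnw K))) scaleN1r. Qed.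

Definition gkind (i : gvar) : nw K :=
  match i with
  | inl (inl _) => nw_a K | inl (inr _) => nw_b K | inr (inl _) => nw_c K
  | inr (inr _) => nw_d K
  end.
Definition gpart (i : gvar) : nat :=
  match i with inl (inl n) => n.+1 | inl (inr n) => n | inr (inl n) => n.+1 | inr (inr n) => n.+1 end.
Definition gen (i : gvar) : env (affnw K) := neg_mode (gkind i) (gpart i).

Lemma neg_mode_commute x p y q : (0 < p + q)%N ->
  neg_mode x p * neg_mode y q = neg_mode y q * neg_mode x p + neg_mode (lie_br x y) (p + q)%N.
Proof.
move=> pq; have := mode_commute x (- p%:Z) y (- q%:Z); rewrite /neg_mode /mode => ->.
rewrite -opprD -PoszD oppr_eq0; have -> : ((p + q)%N%:Z == 0) = false by lia.
by rewrite scale0r addr0.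
Qed.

Lemma neg_mode_commute0 x p y q : (0 < p + q)%N -> lie_br x y = 0 ->
  neg_mode x p * neg_mode y q = neg_mode y q * neg_mode x p.
Proof.
move=> pq xy; rewrite neg_mode_commute // xy.
by rewrite [neg_mode 0 _](linear0 (mode (- (p + q)%N%:Z))) addr0.
Qed.

Lemma neg_modeN x p : neg_mode (- x) p = - neg_mode x p.
Proof. exact: (linearN (mode (- p%:Z))). Qed.

Let br := nw_br_basis K.

Lemma gen_c i n : gen i * gen (gC n) = gen (gC n) * gen i.
Proof.
apply/esym; apply: neg_mode_commute0; first by [].
by case: i => [[m|m]|[m|m]]; rewrite /= ?br ?lie_br_alt.
Qed.

Lemma gen_same i j : gkind i = gkind j -> gen i * gen j = gen j * gen i.
Proof.
move=> ij; case: (posnP (gpart i + gpart j)) => [/eqP|pq].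
  rewrite addn_eq0 => /andP[/eqP pi /eqP pj].
  by rewrite /gen pi pj ij.
by apply: neg_mode_commute0 => //; rewrite ij lie_br_alt.
Qed.

Definition gword (s : seq gvar) u : V := foldr (fun i u => gen i *: u) u s.

Lemma gword_comm s X u : (forall i, i \in s -> gen i * X = X * gen i) ->
  X *: gword s u = gword s (X *: u).
Proof.
elim: s => //= i s IH sX; rewrite -IH => [|j js]; last by apply: sX; rewrite inE js orbT.
by rewrite !scalerA sX // inE eqxx.
Qed.

Lemma gword_perm s t u : (forall i j, i \in s -> j \in s -> gen i * gen j = gen j * gen i) ->
  perm_eq s t -> gword s u = gword t u.
Proof.
move=> sC; pose Q (t : seq gvar) := {subset t <= s} /\ gword s u = gword t u.
suff swap s1 s2 s3 : Q (s1 ++ s2 ++ s3) -> Q (s2 ++ s1 ++ s3).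
  by move=> /(catCA_perm_ind swap) H; case: (H (conj (fun i h => h) erefl)).
move=> [sub e]; split=> [i|].
  by rewrite !mem_cat orbCA -!mem_cat => /sub.
rewrite e /gword !foldr_cat -/(gword s3 u) -!/(gword _ _); move: (gword s3 u) => v.
have sub1 i : i \in s1 -> i \in s by move=> h; apply: sub; rewrite mem_cat h.
have sub2 i : i \in s2 -> i \in s by move=> h; apply: sub; rewrite !mem_cat h orbT.
elim: s1 sub1 {sub e} => [//|i s1 IH] sub1 /=; rewrite IH; last first.
  by move=> j js; apply: sub1; rewrite inE js orbT.
by rewrite gword_comm // => j /sub2 js; rewrite sC // sub1 // inE eqxx.
Qed.

(** The order [D C A B] keeps reordering under control: the bracket of a [B] with an [A] is a [C],
    which commutes with all letters, and the bracket of an [A] or a [B] with a [D] stays in its own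
    family. *)
Definition cab_word u : Prop := exists sC sA sB : seq nat,
  u = gword (map gC sC) (gword (map gA sA) (gword (map gB sB) hwv)).
Definition dcab_word u : Prop := exists (sD : seq nat) u', cab_word u' /\ u = gword (map gD sD) u'.

Lemma cab_word_c n u : cab_word u -> cab_word (gen (gC n) *: u).
Proof. by move=> [sC [sA [sB ->]]]; exists (n :: sC), sA, sB. Qed.

Lemma cab_word_a n u : cab_word u -> cab_word (gen (gA n) *: u).
Proof.
move=> [sC [sA [sB ->]]]; exists sC, (n :: sA), sB.
by rewrite gword_comm // => i /mapP[m _ ->]; rewrite gen_c.
Qed.

Lemma gen_ba n m : gen (gB n) * gen (gA m) = gen (gA m) * gen (gB n) - gen (gC (n + m)).
Proof.
rewrite /gen [LHS]neg_mode_commute /= ?addnS //; congr (_ + _).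
by rewrite nw_br_antisym br neg_modeN.
Qed.

Lemma gen_ad n m : gen (gA n) * gen (gD m) = gen (gD m) * gen (gA n) - gen (gA (n + m).+1).
Proof.
rewrite /gen [LHS]neg_mode_commute /= ?addnS //; congr (_ + _).
by rewrite nw_br_antisym br neg_modeN addSn.
Qed.

Lemma gen_bd n m : gen (gB n) * gen (gD m) = gen (gD m) * gen (gB n) + gen (gB (n + m).+1).
Proof.
rewrite /gen [LHS]neg_mode_commute /= ?addnS //; congr (_ + _).
by rewrite nw_br_antisym br opprK.
Qed.

Lemma cab_word_b n u : cab_word u -> lspan cab_word (gen (gB n) *: u).
Proof.
move=> [sC [sA [sB ->]]]; rewrite gword_comm => [|i /mapP[m _ ->]]; last by rewrite gen_c.
elim: sC => [|c sC IH] /=; last by apply: lspan_bind IH => v Sv; apply/lspan_gen/cab_word_c.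
elim: sA => [|a sA IH] /=; first by apply: lspan_gen; exists [::], [::], (n :: sB).
rewrite scalerA gen_ba scalerBl -scalerA; apply: lspanD.
  by apply: lspan_bind IH => v Sv; apply/lspan_gen/cab_word_a.
by apply/lspanN/lspan_gen/cab_word_c; exists [::], sA, sB.
Qed.

Lemma dcab_word_d n u : dcab_word u -> dcab_word (gen (gD n) *: u).
Proof. by move=> [sD [u' [Su' ->]]]; exists (n :: sD), u'. Qed.

Lemma cab_word_dcab u : cab_word u -> dcab_word u.
Proof. by exists [::], u. Qed.

Lemma lspan_d n u : lspan dcab_word u -> lspan dcab_word (gen (gD n) *: u).
Proof. by apply: lspan_bind => v Sv; apply/lspan_gen/dcab_word_d. Qed.

(** An [A] or [B] that passes a [D] leaves behind a letter of its family with a larger index, so the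
    induction on the [D] letters must run over all generators at once. *)
Lemma dcab_word_gen i u : dcab_word u -> lspan dcab_word (gen i *: u).
Proof.
have up v : lspan cab_word v -> lspan dcab_word v by apply: lspan_trans => w /cab_word_dcab/lspan_gen.
move=> [sD [u' [Su' ->]]]; elim: sD i => [|d sD IH] i /=.
  case: i => [[n|n]|[n|n]].
  - exact/up/lspan_gen/cab_word_a.
  - exact/up/cab_word_b.
  - exact/up/lspan_gen/cab_word_c.
  - exact/lspan_gen/dcab_word_d/cab_word_dcab.
case: i => [[n|n]|[n|n]]; rewrite scalerA.
- rewrite gen_ad scalerBl -scalerA; apply: lspanD; first exact/lspan_d/(IH (gA n)).
  exact/lspanN/(IH (gA _)).
- rewrite gen_bd scalerDl -scalerA; apply: lspanD; first exact/lspan_d/(IH (gB n)).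
  exact/(IH (gB _)).
- rewrite -[_ * _]gen_c -scalerA; exact/lspan_d/(IH (gC n)).
- have -> : gen (inr (inr n)) * gen (gD d) = gen (gD d) * gen (gD n) by exact: gen_same.
  rewrite -scalerA; exact/lspan_d/(IH (gD n)).
Qed.

Lemma lspan_gens i u : lspan dcab_word u -> lspan dcab_word (gen i *: u).
Proof. by apply: lspan_bind => v; exact: dcab_word_gen. Qed.

Lemma dcab_word_hwv : dcab_word hwv.
Proof. by exists [::], hwv; split=> //; exists [::], [::], [::]. Qed.

Lemma lspan_word s : lspan dcab_word (gword s hwv).
Proof. by elim: s => [|i s IH] /=; [apply/lspan_gen/dcab_word_hwv | exact: lspan_gens]. Qed.

Lemma dcab_word_word u : dcab_word u -> exists s, u = gword s hwv.
Proof.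
move=> [sD [u' [[sC [sA [sB ->]]] ->]]].
by exists (map gD sD ++ map gC sC ++ map gA sA ++ map gB sB); rewrite /gword !foldr_cat.
Qed.

Lemma gword_k s : env_gen (affnw_k K) *: gword s hwv = ell%:A *: gword s hwv.
Proof.
rewrite gword_comm => [|i _]; last by rewrite env_k_commute.
rewrite hwv_k -gword_comm // => i _; by rewrite mulr_algl mulr_algr.
Qed.

Lemma lspan_mode_hwv n x : lspan dcab_word (mode n x *: hwv).
Proof.
have g i : lspan dcab_word (gen i *: hwv) by apply/lspan_gens/lspan_gen/dcab_word_hwv.
have h k : lspan dcab_word (k%:A *: hwv) by apply/lspanZ/lspan_gen/dcab_word_hwv.
elim/(@nw_ind K): x => [k x y Sx Sy||||].
- rewrite linearP scalerDl /= -mulr_algl -scalerA; apply: lspanD => //.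
  exact: lspanZ.
- case: n => [[|n]|n]; [|by rewrite hwv_pos; exact: lspan0 | exact: (g (gA n))].
  by rewrite -[Posz 0]/(0 : int) hwv_0 ?nw_vecE.
- by case: n => [[|n]|n]; [exact: (g (gB 0)) | rewrite hwv_pos; exact: lspan0 | exact: (g (gB n.+1))].
- case: n => [[|n]|n]; [|by rewrite hwv_pos; exact: lspan0 | exact: (g (gC n))].
  by rewrite -[Posz 0]/(0 : int) hwv_0 ?nw_vecE.
- case: n => [[|n]|n]; [|by rewrite hwv_pos; exact: lspan0 | exact: (g (gD n))].
  by rewrite -[Posz 0]/(0 : int) hwv_0 ?nw_vecE.
Qed.

(** Any mode, annihilation modes included, is carried through the word to the highest weight vector;
    each bracket is again a mode, applied to a shorter word. *)
Lemma lspan_mode s n x : lspan dcab_word (mode n x *: gword s hwv).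
Proof.
elim: s n x => [|i s IH] n x; first exact: lspan_mode_hwv.
rewrite /= scalerA.
have -> : gen i = mode (- (gpart i)%:Z) (gkind i) by [].
rewrite mode_commute !scalerDl -scalerA -[X in _ + X *: _]mulr_algl -scalerA gword_k.
apply: lspanD; first apply: lspanD.
- by have := IH n x => /(lspan_gens i).
- exact: IH.
- by do 2!apply: lspanZ; exact: lspan_word.
Qed.

Lemma lspan_env X u : lspan dcab_word u -> lspan dcab_word (X *: u).
Proof.
elim/env_ind: X u => [k|z|a b IHa IHb|a b IHa IHb] u Su.
- exact: lspanZ.
- elim/affnw_ind: z => [|y z Sy Sz|x n|k].
  + by rewrite linear0 scale0r; exact: lspan0.
  + by rewrite linearD scalerDl; exact: lspanD.
  + apply: lspan_bind Su => v /dcab_word_word[s ->]; exact: lspan_mode.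
  + apply: lspan_bind Su => v /dcab_word_word[s ->].
    rewrite linearZ /= -mulr_algl -scalerA gword_k.
    by do 2!apply: lspanZ; exact: lspan_word.
- by rewrite scalerDl; apply: lspanD; [exact: IHa | exact: IHb].
- by rewrite -scalerA; apply: IHa; exact: IHb.
Qed.

Lemma lspan_all u : lspan dcab_word u.
Proof.
by have [X ->] := verma_cyclic u; apply: lspan_env; apply/lspan_gen/dcab_word_hwv.
Qed.

Definition pbw (x : seq nat * seq nat * seq nat * seq nat) : seq gvar :=
  map gD x.1.1.1 ++ map gC x.1.1.2 ++ map gA x.1.2 ++ map gB x.2.

Lemma pbw_span u : exists t : seq (K * (seq nat * seq nat * seq nat * seq nat)),
  u = \sum_(x <- t) x.1%:A *: gword (pbw x.2) hwv.
Proof.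
elim: (lspan_all u) => [|k w v [sD [u' [[sC [sA [sB ->]]] ->]]] _ [t ->]].
  by exists [::]; rewrite big_nil.
exists ((k, (sD, sC, sA, sB)) :: t); rewrite big_cons.
by rewrite /pbw /gword !foldr_cat.
Qed.

Definition wmon (s : seq gvar) : {cmonom gvar} := foldr (fun i m => mmul (ucm i) m) mone s.

Lemma wmonE s i : wmon s i = count_mem i s.
Proof.
by elim: s => [|j s IH] /=; rewrite ?cm1 // cmM cmU IH.
Qed.

(** Letters commute within each of the four blocks, so the vector depends on multiplicities only. *)
Lemma pbw_wmon (x y : seq nat * seq nat * seq nat * seq nat) : wmon (pbw x) = wmon (pbw y) -> gword (pbw x) hwv = gword (pbw y) hwv.
Proof.
case: x y => [[[sD sC] sA] sB] [[[tD tC] tA] tB] e.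
have E i : count_mem i (pbw (sD, sC, sA, sB)) = count_mem i (pbw (tD, tC, tA, tB)).
  by rewrite -!wmonE e.
have c0 (g g' : nat -> gvar) s n : (forall m, g' m == g n = false) -> count_mem (g n) (map g' s) = 0%N.
  by move=> gg'; rewrite count_map -(count_pred0 s); apply: eq_count => m /=; rewrite gg'.
have c1 (g : nat -> gvar) (s t : seq nat) : injective g ->
    (forall n, count_mem (g n) (map g s) = count_mem (g n) (map g t)) -> perm_eq (map g s) (map g t).
  move=> gi h; apply: perm_map; apply/allP => n _ /=; apply/eqP.
  have := h n; rewrite !count_map !(eq_count (a2 := pred1 n)) // => m /=; exact: inj_eq.
have pD : perm_eq (map gD sD) (map gD tD).
  apply: c1 gD_inj _ => n; have := E (gD n); rewrite /pbw !count_cat /=.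
  by rewrite !(c0 gD gC) // !(c0 gD gA) // !(c0 gD gB) // !addn0.
have pC : perm_eq (map gC sC) (map gC tC).
  apply: c1 gC_inj _ => n; have := E (gC n); rewrite /pbw !count_cat /=.
  by rewrite !(c0 gC gD) // !(c0 gC gA) // !(c0 gC gB) // !addn0.
have pA : perm_eq (map gA sA) (map gA tA).
  apply: c1 gA_inj _ => n; have := E (gA n); rewrite /pbw !count_cat /=.
  by rewrite !(c0 gA gD) // !(c0 gA gC) // !(c0 gA gB) // !addn0.
have pB : perm_eq (map gB sB) (map gB tB).
  apply: c1 gB_inj _ => n; have := E (gB n); rewrite /pbw !count_cat /=.
  by rewrite !(c0 gB gD) // !(c0 gB gC) // !(c0 gB gA) // !addn0.
have same (g : nat -> gvar) (s : seq nat) : (forall m n, gkind (g m) = gkind (g n)) ->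
    forall i j, i \in map g s -> j \in map g s -> gen i * gen j = gen j * gen i.
  by move=> gk i j /mapP[m _ ->] /mapP[n _ ->]; exact: gen_same.
rewrite /pbw /gword !foldr_cat -!/(gword _ _) /=.
rewrite (gword_perm _ _ pD) 1?(gword_perm _ _ pC) 1?(gword_perm _ _ pA) 1?(gword_perm _ _ pB) //;
  exact: same.
Qed.

Section Injectivity.
Context (P : polyalg K gvar) (oa ob oc od : int -> lend P).
Hypothesis H : nwrep ell cc dd oa ob oc od 1.

Definition gop (i : gvar) : lend P := nwop oa ob oc od (- (gpart i)%:Z) (gkind i).

Definition mu (i : gvar) : int :=
  match i with inl _ => 0 | inr (inl _) => 1 | inr (inr _) => -1 end.
Definition muge (k : int) (f : P) : Prop := psupported (fun m => (k <= wt mu m)%R) f.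

Hypothesis triangular : forall i (k : int) f, muge k f -> muge (k + mu i + 1) (gop i f - pvar P i * f).

Lemma mugeW (k l : int) f : l <= k -> muge k f -> muge l f.
Proof. by move=> lk kf m /kf; exact: le_trans. Qed.

Lemma mugeD (k : int) f g : muge k f -> muge k g -> muge k (f + g).
Proof. by move=> kf kg; rewrite -[f]scale1r; exact: psupportedP. Qed.

Lemma muge_var i (k : int) f : muge k f -> muge (k + mu i) (pvar P i * f).
Proof.
by apply: psupported_varM => m km; rewrite wtM wtU addrC lerD2l.
Qed.

Lemma lift_gword s : muge (wt mu (wmon s) + 1) (affnw_lift H (gword s hwv) - pmon P (wmon s)).
Proof.
elim: s => [|i s IH] /=.
  by rewrite affnw_lift_hwv pmon1 subrr; exact: psupported0.
rewrite affnw_lift_mode -/(gop i) -pvar_mon wtM wtU.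
have ge0 : muge (wt mu (wmon s)) (pmon P (wmon s)).
  by move=> m; rewrite pcoef_mon; case: (wmon s =P m) => [->|_ /eqP].
set f := affnw_lift H (gword s hwv) in IH *.
have fge : muge (wt mu (wmon s)) f.
  rewrite -[f](subrK (pmon P (wmon s))); apply: mugeD => //.
  apply: mugeW IH; lia.
have -> : gop i f - pvar P i * pmon P (wmon s)
    = (gop i f - pvar P i * f) + pvar P i * (f - pmon P (wmon s)).
  by rewrite mulrBr addrA subrK.
apply: mugeD.
  by have := @triangular i _ _ fge; rewrite [mu i + _]addrC.
by have := @muge_var i _ _ IH; rewrite addrAC [mu i + _]addrC.
Qed.

(** Words with equal monomials are equal vectors and are collected first. Among the monomials whose
    collected coefficient is nonzero, take one of least weight: the tails of all words lie in
    strictly larger weights, so this coefficient survives in the image. *)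
Lemma affnw_lift_eq0 u : affnw_lift H u = 0 -> u = 0.
Proof.
have [t ->] := pbw_span u.
pose mon (x : K * (seq nat * seq nat * seq nat * seq nat)) := wmon (pbw x.2).
(* A representative among the words with monomial [m]; the default is not reached when [m] is in
   [ms]. *)
pose rp m := nth (0, ([::], [::], [::], [::])) t (index m (map mon t)).
pose c m := \sum_(x <- t | mon x == m) x.1.
pose ms := undup (map mon t).
have monrp m : m \in ms -> mon (rp m) = m.
  rewrite mem_undup => mt; rewrite /rp -(nth_map _ mone) ?nth_index //.
  by rewrite -(size_map mon) index_mem.
have -> : \sum_(x <- t) x.1%:A *: gword (pbw x.2) hwv
    = \sum_(m <- ms) (c m)%:A *: gword (pbw (rp m).2) hwv.
  transitivity (\sum_(m <- ms) \sum_(x <- t | mon x == m) x.1%:A *: gword (pbw x.2) hwv).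
    rewrite (exchange_big_dep predT) //= big_seq [RHS]big_seq; apply: eq_bigr => x xt.
    have xms : mon x \in ms by rewrite mem_undup; exact: map_f.
    rewrite [RHS]big_mkcond (bigD1_seq (mon x)) ?undup_uniq //= eqxx.
    rewrite big1 ?addr0 // => m /negPf; rewrite eq_sym => mx.
    by rewrite mx.
  rewrite big_seq [RHS]big_seq; apply: eq_bigr => m mt.
  rewrite /c scaler_suml scaler_suml; apply: eq_bigr => x /eqP xm.
  by congr (_ *: _); apply: pbw_wmon; rewrite -/(mon x) -/(mon (rp m)) monrp.
rewrite linear_sum /= => Su0.
suff c0 m : m \in ms -> c m = 0.
  by rewrite big_seq big1 // => m /c0 ->; rewrite scale0r scale0r.
move=> mms; apply/eqP; apply/negPn/negP => cm.
have [m0] : exists2 x, x \in [seq m <- ms | c m != 0] &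
    forall z, z \in [seq m <- ms | c m != 0] -> wt mu x <= wt mu z.
  apply: seq_argmin; apply/eqP => e.
  by have : m \in [seq m <- ms | c m != 0]; [rewrite mem_filter cm | rewrite e].
rewrite mem_filter => /andP[cm0 m0ms] m0min.
have := congr1 (pcoef m0) Su0; rewrite pcoef_sum pcoef0.
rewrite (bigD1_seq m0) ?undup_uniq //= big_seq_cond big1 => [|m' /andP[m'ms m'm0]].
  rewrite addr0 affnw_lift_const pcoefZ => /eqP; rewrite mulf_eq0 (negPf cm0) /=.
  have := @lift_gword (pbw (rp m0).2); rewrite -/(mon _) monrp // => L.
  rewrite -[affnw_lift H _](subrK (pmon P m0)) pcoefD pcoef_mon eqxx.
  have [->|/L] := eqVneq (pcoef m0 (affnw_lift H (gword (pbw (rp m0).2) hwv) - pmon P m0)) 0.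
    by rewrite add0r oner_eq0.
  by rewrite gerDl.
rewrite affnw_lift_const pcoefZ.
have [->|cm'] := eqVneq (c m') 0; first by rewrite mul0r.
have := @lift_gword (pbw (rp m').2); rewrite -/(mon _) monrp // => L.
rewrite -[affnw_lift H _](subrK (pmon P m')) pcoefD pcoef_mon (negPf m'm0) addr0.
have [->|/L] := eqVneq (pcoef m0 (affnw_lift H (gword (pbw (rp m').2) hwv) - pmon P m')) 0.
  by rewrite mulr0.
move=> lt; have : wt mu m0 <= wt mu m' by apply: m0min; rewrite mem_filter cm'.
lia.
Qed.

Lemma affnw_lift_inj u v : affnw_lift H u = affnw_lift H v -> u = v.
Proof.
move=> uv; apply/eqP; rewrite -subr_eq0; apply/eqP/affnw_lift_eq0.
by rewrite linearB /= uv subrr.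
Qed.

End Injectivity.
End PBWSpanning.

(** * Singular polynomials *)

Section Raising.
Context (K : numFieldType) (P : polyalg K gvar).
Implicit Types (f g : P) (r s : int) (X Y : lend P).

Definition raises r X : Prop := forall (k : int) f, muge k f -> muge (k + r) (X f).

Lemma raisesW r s X : s <= r -> raises r X -> raises s X.
Proof. by move=> sr rX k f /rX; apply: mugeW; rewrite lerD2l. Qed.

Lemma raises0 r : raises r 0.
Proof. by move=> k f _; rewrite lend0E; exact: psupported0. Qed.

Lemma raises_subrr r X : raises r (X - X).
Proof. by rewrite subrr; exact: raises0. Qed.

Lemma raises1 : raises 0 1.
Proof. by move=> k f; rewrite addr0. Qed.

Lemma raisesD r X Y : raises r X -> raises r Y -> raises r (X + Y).
Proof. by move=> rX rY k f kf; apply: mugeD; [exact: rX | exact: rY]. Qed.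

Lemma raisesZ r (a : K) X : raises r X -> raises r (a *: X).
Proof.
move=> rX k f kf; rewrite lendZE -[_ *: _]addr0; apply: psupportedP; first exact: rX.
exact: psupported0.
Qed.

Lemma raisesM r s X Y : raises r X -> raises s Y -> raises (r + s) (X * Y).
Proof. by move=> rX rY k f /rY/rX; rewrite -addrA [s + r]addrC. Qed.

Lemma raisesM0 r X Y : raises 0 X -> raises r Y -> raises r (X * Y).
Proof. by move=> rX rY; rewrite -[r]add0r; exact: raisesM. Qed.

Lemma raises_var i : raises (mu i) (mulop (pvar P i)).
Proof. by move=> k f; exact: muge_var. Qed.

Lemma raises_der i : raises (- mu i) (pder P i).
Proof.
move=> k f; apply: psupported_der => m; rewrite wtM wtU => km.
by rewrite lerBlDr addrC.
Qed.

Lemma raises_sum r (J : Type) (t : seq J) (F : J -> lend P) :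
  (forall j, raises r (F j)) -> raises r (\sum_(j <- t) F j).
Proof.
move=> rF; elim: t => [|j t IH]; first by rewrite big_nil; exact: raises0.
by rewrite big_cons; exact: raisesD.
Qed.

Lemma raises_lfsum r F : locfin F -> (forall n, raises r (F n)) -> raises r (lfsum F).
Proof.
move=> lF rF k f kf; have [N NF] := lF f; rewrite (lfsumE lF NF).
rewrite -(lend_sumE _ xpredT (fun n : 'I_N => F n)).
by apply: raises_sum kf => n; exact: rF.
Qed.

Lemma raises_lfsum_tail r F : locfin F -> (forall n, raises r (F n.+1)) ->
  raises r (lfsum F - F 0%N).
Proof.
move=> lF rF.
have l1 : locfin (fun n => if (0 < n)%N then F n else 0).
  by move=> f; have [N NF] := lF f; exists N => n /NF; case: ifP.
have -> : lfsum F - F 0%N = lfsum (fun n => if (0 < n)%N then F n else 0).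
  apply: lendP => f; have [N NF] := lF f.
  have N1 n : (N.+1 <= n)%N -> F n f = 0 by move=> /ltnW/NF.
  have N2 n : (N.+1 <= n)%N -> (if (0 < n)%N then F n else 0) f = 0 by case: ifP => _ // /N1.
  rewrite [LHS]lendDE (lfsumE lF N1) (lfsumE l1 N2) lendNE !big_ord_recl /= add0r.
  by rewrite addrC addrA addNr add0r.
by apply: raises_lfsum => // -[|n] /=; [exact: raises0 | exact: rF].
Qed.

Lemma raises_newton (c : nat -> lend P) n : (forall i, raises 1 (c i)) ->
  raises 1 (newton c n.+1).
Proof.
(* The bound is the truth value of [n > 0] read as a number: 0 for the constant coefficient and 1
   for the others, which is what the recursion preserves. *)
move=> rc; suff : raises (n.+1 > 0)%N (newton c n.+1) by [].
move: (n.+1) => {}n.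
apply: (newton_ind (Q := fun n x => raises (n > 0)%N x)) => [|{}n IH]; first exact: raises1.
rewrite -[newton c n.+1]scale1r -(@mulVf _ (n.+1%:R : K)) ?pnatr_eq0 // -scalerA.
apply: raisesZ; rewrite newtonE; apply: raises_sum => i.
apply: raisesW (raisesM (rc i) (IH (n - i)%N (leq_subr _ _))); lia.
Qed.

Lemma mulop_sum (J : Type) (t : seq J) (F : J -> P) :
  mulop (\sum_(j <- t) F j) = \sum_(j <- t) mulop (F j).
Proof. by apply: lendP => f; rewrite mulopE mulr_suml lend_sumE. Qed.

Lemma mulopZ (a : K) f : mulop (a *: f) = a *: mulop f.
Proof. by apply: lendP => g; rewrite lendZE !mulopE scalerAl. Qed.

Lemma mulop_newton (c : nat -> P) n : mulop (newton c n) = newton (fun i => mulop (c i)) n.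
Proof.
apply: (newton_ind (Q := fun n x => mulop x = newton (fun i => mulop (c i)) n)) => [|{}n IH].
  by apply: lendP => f; rewrite mulopE mul1r.
apply: newton_eq; rewrite -mulopZ newtonE mulop_sum; apply: eq_bigr => i _.
by rewrite mulopM IH // leq_subr.
Qed.

Section Fields.
Context (ell cc : K).

Lemma raises_fa k : raises 0 (fa P ell cc k).
Proof.
case: k => n; last exact: raises_var.
apply: raisesZ; exact: (@raises_der (gB n)).
Qed.

Lemma raises_fb k : raises 0 (fb P ell cc k).
Proof.
case: k => [[|n]|n]; [exact: (@raises_var (gB 0)) | | exact: (@raises_var (gB n.+1))].
apply: raisesZ; exact: (@raises_der (gA n)).
Qed.

Context (s : nat -> P) (y : int -> lend P).
Hypotheses (ly : lfield y) (s0 : s 0%N = 1) (sr : forall i, raises 1 (mulop (s i.+1))).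
Hypothesis yr : forall k, raises 0 (y k).

Lemma raises_s i : raises 0 (mulop (s i)).
Proof.
case: i => [|i]; last by apply: raisesW (@sr i).
rewrite s0 (_ : mulop 1 = 1) ?raises1 //; first exact: raises1.
by apply: lendP => f; rewrite mulopE mul1r.
Qed.

Lemma raises_field k : raises 0 (field s y k).
Proof.
apply: raises_lfsum => [|i]; first exact: field_locfin.
by apply: raisesM0; [exact: raises_s | exact: yr].
Qed.

Lemma raises_field_tail k : raises 1 (field s y k - y k).
Proof.
have -> : y k = mulop (s 0%N) * y (k + 0%N%:Z).
  by rewrite addr0 s0; apply: lendP => f; rewrite lendME mulopE mul1r.
apply: (raises_lfsum_tail (F := fun i => mulop (s i) * y (k + i%:Z))) => [|i].
  exact: field_locfin.
by rewrite -[1]addr0; apply: raisesM; [exact: sr | exact: yr].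
Qed.

Lemma raises_dress_tail e k : e * e = 1 -> raises 1 (dress e (field s y) k - field s y k).
Proof.
move=> ee; have -> : field s y k = field s y (k - 0%N%:Z) * shiftop P e 0.
  by rewrite subr0 /shiftop newton0 mulr1.
apply: (raises_lfsum_tail (F := fun j => field s y (k - j%:Z) * shiftop P e j)) => [|j].
  exact: dress_locfin.
apply: raisesM0; first exact: raises_field.
apply: raises_newton => i; apply: raisesZ; exact: (@raises_der (gD i)).
Qed.

(** The equations are triangular with leading coefficient [s 0 = 1]. High modes vanish on [f]
    anyway, and from there one descends. *)
Lemma field_eq0 (k0 : int) f : (forall n : nat, field s y (k0 + n%:Z) f = 0) ->
  forall n : nat, y (k0 + n%:Z) f = 0.
Proof.
move=> f0; have [N NF] := lfield_shift f k0 ly.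
suff H m n : (N <= n + m)%N -> y (k0 + n%:Z) f = 0 by move=> n; apply: (H N); exact: leq_addl.
elim: m n => [|m IH] n; first by rewrite addn0 => /NF.
rewrite addnS => Nnm.
have Fn i : (m.+1 <= i)%N -> y (k0 + n%:Z + i%:Z) f = 0.
  by move=> mi; rewrite -addrA -PoszD; apply: NF; lia.
have := f0 n; rewrite (fieldE _ ly Fn) big_ord_recl /= s0 mul1r addr0.
rewrite big1 ?addr0 // => i _; rewrite -addrA -PoszD IH ?mulr0 //.
rewrite /bump /=; lia.
Qed.

Lemma field_eq0_ge0 f : (forall n : nat, field s y n f = 0) -> forall n : nat, y n f = 0.
Proof.
by move=> h n; rewrite -[n%:Z]add0r; apply: field_eq0 => m; rewrite add0r.
Qed.

Lemma field_eq0_gt0 f : (forall n : nat, field s y n.+1 f = 0) -> forall n : nat, y n.+1 f = 0.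
Proof.
move=> h n; have -> : n.+1%:Z = 1 + n%:Z by lia.
apply: field_eq0 => m; have -> : 1 + m%:Z = m.+1%:Z by lia.
exact: h.
Qed.

End Fields.

End Raising.

Section Classification1.
Context (K : numFieldType) (P : polyalg K gvar) (ell cc dd : K).
Hypothesis ell0 : ell != 0.
Implicit Types (f g : P).
Local Notation oa := (oa1 P ell cc).
Local Notation ob := (ob1 P ell cc).
Local Notation oc := (oc1 P ell cc).
Local Notation od := (od1 P ell dd).

Let m1 : (-1 : K) * -1 = 1. Proof. by rewrite mulrNN mulr1. Qed.
Let p1 : (1 : K) * 1 = 1. Proof. by rewrite mulr1. Qed.

Lemma raises_eser i : raises 1 (mulop (eser P ell i.+1)).
Proof.
by rewrite mulop_newton; apply: raises_newton => j; rewrite mulopZ; apply: raisesZ;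
  exact: (@raises_var _ P (gC j)).
Qed.

Lemma raises_eserN i : raises 1 (mulop (eserN P ell i.+1)).
Proof.
rewrite mulop_newton; apply: raises_newton => j; rewrite -scaleNr mulopZ; apply: raisesZ.
exact: (@raises_var _ P (gC j)).
Qed.

(** The series in the [C] variables and the [D] derivatives of the dressing raise the weight except
    for their constant terms, which are 1; to leading order only the variable is left. *)
Lemma triangular1 i (k : int) f : muge k f ->
  muge (k + mu i + 1) (gop oa ob oc od i f - pvar P i * f).
Proof.
suff : raises (mu i + 1) (gop oa ob oc od i - mulop (pvar P i)).
  by move=> h /h; rewrite addrA.
have tail e s y (k0 : int) X : e * e = 1 -> lfield y -> s 0%N = 1 ->
    (forall i, raises 1 (mulop (s i.+1))) -> (forall k, raises 0 (y k)) -> y k0 = X ->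
    raises 1 (dress e (field s y) k0 - X).
  move=> ee ly s0 sr yr <-; rewrite -[dress _ _ _](subrK (field s y k0)) -addrA.
  by apply: raisesD; [exact: raises_dress_tail | exact: raises_field_tail].
rewrite /gop; case: i => [[n|n]|[n|n]] /=; rewrite !nwop_basis.
- apply: tail => //; [exact: fa_lfield | exact: raises_eser | exact: raises_fa].
- apply: tail => //; [exact: fb_lfield | exact: raises_eserN | exact: raises_fb |].
  by case: n.
- exact: raises_subrr.
- exact: raises_subrr.
Qed.

Definition psingular (oa ob oc od : int -> lend P) f : Prop := forall n : nat,
  [/\ oa n f = 0, ob n.+1 f = 0, oc n.+1 f = 0 & od n.+1 f = 0].

Lemma scaled_eq0 (a : K) f : a != 0 -> a *: f = 0 -> f = 0.
Proof. by move=> a0 /eqP; rewrite scaler_eq0 (negPf a0) => /eqP. Qed.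

(** The modes of [c] force [f] to be free of [D], which removes the translation from [a] and [b];
    the triangularity in [field_eq0] then removes the series. *)
Lemma psingular1P f : psingular oa ob oc od f <-> forall n : nat,
  [/\ fa P ell cc n f = 0, fb P ell cc n.+1 f = 0, pder P (gC n) f = 0 & pder P (gD n) f = 0].
Proof.
have nl n : (n.+1%:R * ell : K) != 0 by rewrite mulf_neq0 // pnatr_eq0.
split=> [sf|sf].
  have df : dfree f by move=> n; case: (sf n) => _ _ + _; rewrite /oc1 lendZE => /scaled_eq0; apply.
  have fa0 (n : nat) : fa P ell cc n f = 0.
    apply: (field_eq0_ge0 (s := eser P ell)) n => [|//|n]; first exact: fa_lfield.
    by case: (sf n) => + _ _ _; rewrite /oa1 dress_dfree.
  have fb0 (n : nat) : fb P ell cc n.+1 f = 0.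
    apply: (field_eq0_gt0 (s := eserN P ell)) n => [|//|n]; first exact: fb_lfield.
    by case: (sf n) => _ + _ _; rewrite /ob1 dress_dfree.
  move=> n; split=> //; case: (sf n) => _ _ _; rewrite /od1 lendZE => /scaled_eq0; exact.
have df : dfree f by move=> n; case: (sf n).
move=> n; split.
- rewrite /oa1 dress_dfree // /na (@fieldE _ _ _ 0%N) ?big_ord0 //; first exact: fa_lfield.
  by move=> i _; rewrite -PoszD; case: (sf (n + i)%N).
- rewrite /ob1 dress_dfree // /nb (@fieldE _ _ _ 0%N) ?big_ord0 //; first exact: fb_lfield.
  by move=> i _; rewrite -PoszD addSn; case: (sf (n + i)%N).
- by rewrite /oc1 lendZE df scaler0.
- by rewrite /od1 lendZE; case: (sf n) => _ _ -> _; rewrite scaler0.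
Qed.

End Classification1.

Section Classification2.
Context (K : numFieldType) (P : polyalg K gvar) (cc dd : K).
Hypothesis cc0 : cc != 0.
Implicit Types (f g : P).
Local Notation oa := (oa2 P cc).
Local Notation ob := (ob2 P cc).
Local Notation oc := (oc2 P cc).
Local Notation od := (od2 P cc dd).

Lemma raises_pser0 i : raises 1 (mulop (pser0 P cc i.+1)).
Proof. by rewrite mulopZ; apply: raisesZ; exact: (@raises_var _ P (gC i)). Qed.

Lemma raises_qser0 i : raises 1 (mulop (qser0 P i.+1)).
Proof. by move=> k f _; rewrite mulopE mul0r; exact: psupported0. Qed.

Lemma raises_sugawara k : raises 0 (sugawara P cc k).
Proof.
apply: raisesZ; apply: raisesD; apply: raises_lfsum => [|j].
- exact: normal1_locfin.
- by apply: raisesM0; [exact: raises_fa | exact: raises_fb].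
- exact: normal2_locfin.
- by apply: raisesM0; [exact: raises_fb | exact: raises_fa].
Qed.

(** The quadratic term of [d] preserves the weight, whereas [D_n] has weight -1; so it counts as a
    higher term. *)
Lemma triangular2 i (k : int) f : muge k f ->
  muge (k + mu i + 1) (gop oa ob oc od i f - pvar P i * f).
Proof.
suff : raises (mu i + 1) (gop oa ob oc od i - mulop (pvar P i)).
  by move=> h /h; rewrite addrA.
have tail s y (k0 : int) X : lfield y -> s 0%N = 1 ->
    (forall i, raises 1 (mulop (s i.+1))) -> (forall k, raises 0 (y k)) -> y k0 = X ->
    raises 1 (field s y k0 - X).
  by move=> ly s0 sr yr <-; exact: raises_field_tail.
rewrite /gop; case: i => [[n|n]|[n|n]] /=; rewrite !nwop_basis.
- apply: tail => //; [exact: fa_lfield | exact: raises_pser0 | exact: raises_fa].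
- apply: tail => //; [exact: fb_lfield | exact: raises_qser0 | exact: raises_fb |].
  by case: n.
- exact: raises_subrr.
- by rewrite /od2 /= addrK; exact: raises_sugawara.
Qed.

(** Once the annihilation modes of [fa] and [fb] kill [f], so do the positive modes of the quadratic
    term, and only [d/dD_n] remains of [d(n+1)]. *)
Lemma psingular2P f : psingular oa ob oc od f <-> forall n : nat,
  [/\ pder P (gA n) f = 0, pder P (gB n) f = 0 & pder P (gD n) f = 0].
Proof.
have faE (n : nat) : fa P 0 cc n f = cc *: pder P (gB n) f by rewrite /fa lendZE mulr0 add0r.
have fbE (n : nat) : fb P 0 cc n.+1 f = - cc *: pder P (gA n) f.
  by rewrite /fb lendZE mulr0 sub0r.
have sug0 : (forall n : nat, fa P 0 cc n f = 0) -> (forall n : nat, fb P 0 cc n.+1 f = 0) ->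
    forall n : nat, sugawara P cc n.+1 f = 0.
  move=> a0 b0 n; rewrite /sugawara lendZE lendDE (@lfsumE _ _ _ _ 0%N) ?(@lfsumE _ _ _ _ 0%N) ?big_ord0.
  - by rewrite addr0 scaler0.
  - exact: normal2_locfin.
  - by move=> j _; rewrite lendME -PoszD a0 lend_vec0.
  - exact: normal1_locfin.
  - by move=> j _; rewrite lendME b0 lend_vec0.
split=> [sf|sf].
  have fa0 (n : nat) : fa P 0 cc n f = 0.
    apply: (field_eq0_ge0 (s := pser0 P cc)) n => [|//|n]; first exact: fa_lfield.
    by case: (sf n).
  have fb0 (n : nat) : fb P 0 cc n.+1 f = 0.
    apply: (field_eq0_gt0 (s := qser0 P)) n => [|//|n]; first exact: fb_lfield.
    by case: (sf n).
  move=> n; split.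
  - by have := fb0 n; rewrite fbE => /scaled_eq0; apply; rewrite oppr_eq0.
  - by have := fa0 n; rewrite faE => /scaled_eq0; apply.
  - case: (sf n) => _ _ _; rewrite /od2 lendDE sug0 // add0r /= => /scaled_eq0; apply.
    by rewrite pnatr_eq0.
have fa0 (n : nat) : fa P 0 cc n f = 0 by rewrite faE; case: (sf n) => _ -> _; rewrite scaler0.
have fb0 (n : nat) : fb P 0 cc n.+1 f = 0 by rewrite fbE; case: (sf n) => -> _ _; rewrite scaler0.
move=> n; split.
- rewrite /oa2 /na (@fieldE _ _ _ 0%N) ?big_ord0 //; first exact: fa_lfield.
  by move=> i _; rewrite -PoszD.
- rewrite /ob2 /nb (@fieldE _ _ _ 0%N) ?big_ord0 //; first exact: fb_lfield.
  by move=> i _; rewrite -PoszD addSn.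
- by rewrite /oc2 /nc lend0E.
- by rewrite /od2 lendDE sug0 // add0r lendZE; case: (sf n) => _ _ ->; rewrite scaler0.
Qed.

End Classification2.

(** * Singular vectors of the Verma module and singular polynomials *)

Section SingularTransfer.
Context (K : numFieldType) (P : polyalg K gvar) (ell cc dd : K).
Local Notation V := (affnw_verma ell cc dd).
Context (oa ob oc od : int -> lend P) (H : nwrep ell cc dd oa ob oc od (1 : P)).
Local Notation phi := (affnw_lift H : V -> P).
Hypothesis triangular : forall i (k : int) f, muge k f ->
  muge (k + mu i + 1) (gop oa ob oc od i f - pvar P i * f).
Implicit Types (u v : V) (f : P).

Lemma affnw_lift_gen x u : phi (env_gen x *: u) = affnw_op ell oa ob oc od x (phi u).
Proof. by rewrite linearZ /= affnw_mod_gen. Qed.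

Lemma affnw_lift_sum (J : Type) (s : seq J) (z : J -> K) (v : J -> V) :
  phi (\sum_(j <- s) (z j)%:A *: v j) = \sum_(j <- s) z j *: phi (v j).
Proof.
elim: s => [|j s IH]; first by rewrite !big_nil linear0.
by rewrite !big_cons linearD /= affnw_lift_const IH.
Qed.

Lemma mode_plus (x : nw K) (n : nat) : affnw_plus (affnw_mode x n.+1).
Proof.
split=> //= [m m0|]; last by exists 0; rewrite loop_coef_mono /= scale0r.
by rewrite loop_coef_mono; case: eqP => // e; rewrite -e in m0.
Qed.

Lemma mode_a_plus : affnw_plus (affnw_mode (nw_a K) 0).
Proof.
split=> //= [m m0|]; last by exists 1; rewrite loop_coef_mono eqxx scale1r.
by rewrite loop_coef_mono; case: eqP => // e; rewrite -e ltxx in m0.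
Qed.

Lemma affnw_singularP u : affnw_singular u <-> psingular oa ob oc od (phi u).
Proof.
have inj w : phi w = 0 -> w = 0.
  by move=> w0; apply: (affnw_lift_inj triangular); rewrite w0 linear0.
split=> [su n|su x [xn [k xk] x2]].
  have nw m (y : nw K) : affnw_plus (affnw_mode y m) -> nwop oa ob oc od m y (phi u) = 0.
    by move=> /su e; rewrite -affnw_lift_mode e linear0.
  have e := nwop_basis oa ob oc od; split.
  - case: n => [|n]; [rewrite -[Posz 0]/(0 : int)|]; rewrite -(e _).1.1.1; apply: nw.
      exact: mode_a_plus.
    exact: mode_plus.
  - by rewrite -(e _).1.1.2; apply: nw; exact: mode_plus.
  - by rewrite -(e _).1.2; apply: nw; exact: mode_plus.
  - by rewrite -(e _).2; apply: nw; exact: mode_plus.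
apply: inj; rewrite affnw_lift_gen /affnw_op x2 mulr0 scale0r addr0 lend_sumE.
rewrite big1 // => -[[|n]|n] _.
- have -> : nwop oa ob oc od (Posz 0) (loop_coef x.1 0) = k *: oa 0.
    by rewrite xk -(nwop_basis oa ob oc od 0); exact: (linearZ_LR (nwop oa ob oc od 0)).
  rewrite lendZE.
  by case: (su 0%N) => -> _ _ _; rewrite scaler0.
- case: (su n.+1) (su n) => oan _ _ _ [_ obn ocn odn].
  by rewrite /nwop !lendDE !lendZE oan obn ocn odn !scaler0 !addr0.
- by rewrite xn // linear0.
Qed.

(** The common form of the three bases of the claim: in the realization the members are multiples of
    distinct monomials, so independence and spanning are read off coefficient by coefficient. *)
Lemma monomial_basis (J : eqType) (v : J -> V) (a : J -> K) (M : J -> {cmonom gvar}) :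
  (forall j, phi (v j) = a j *: pmon P (M j)) -> (forall j, a j != 0) -> injective M ->
  (forall j, affnw_singular (v j)) ->
  (forall w, affnw_singular w -> forall m, pcoef m (phi w) != 0 -> exists j, m = M j) ->
  is_basis (@affnw_singular K V) v.
Proof.
move=> vE a0 Minj vS spanM; split=> // [s z s_uniq|w sw].
  move=> /(congr1 (affnw_lift H)); rewrite linear0 affnw_lift_sum => z0 j js.
  have /(congr1 (pcoef (M j))) := z0; rewrite pcoef0 pcoef_sum (bigD1_seq j) //=.
  rewrite big1 => [|i ij]; last first.
    by rewrite vE !pcoefZ pcoef_mon (inj_eq Minj) (negPf ij) !mulr0.
  rewrite addr0 vE !pcoefZ pcoef_mon eqxx mulr1 => /eqP.
  by rewrite mulf_eq0 (negPf (a0 j)) orbF => /eqP.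
have [s sE] : exists s, psupp (phi w) = map M s.
  have t0 m : m \in psupp (phi w) -> exists j, m = M j.
    by rewrite mem_psupp => /(spanM w sw).
  elim: (psupp (phi w)) t0 => [|m t IH] t0; first by exists [::].
  have [|s ->] := IH; first by move=> m' m't; apply: t0; rewrite inE m't orbT.
  have [|j ->] := t0 m; first by rewrite inE eqxx.
  by exists (j :: s).
exists s, (fun j => pcoef (M j) (phi w) / a j); apply: (affnw_lift_inj triangular).
rewrite affnw_lift_sum [LHS](polyE (phi w)) sE big_map; apply: eq_bigr => j _.
by rewrite vE scalerA divfK.
Qed.

End SingularTransfer.

(** * Partitions and the linear systems *)

Lemma sorted_geq_eq (s t : seq nat) : sorted geq s -> sorted geq t -> perm_eq s t -> s = t.
Proof.
apply: sorted_eq; first by move=> y x z /= xy yz; exact: leq_trans yz xy.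
by move=> x y /andP[xy yx]; apply: anti_leq; apply/andP; split.
Qed.

Lemma is_partition_rem q nu : is_partition nu -> is_partition (rem q nu).
Proof.
case/andP=> nus nu0; apply/andP; split; last by apply: contra nu0; exact: mem_rem.
apply: (subseq_sorted _ (rem_subseq q nu) nus).
by move=> y x z /= xy yz; exact: leq_trans yz xy.
Qed.

Lemma sumn_rem q nu : q \in nu -> (q + sumn (rem q nu))%N = sumn nu.
Proof. by move=> qnu; rewrite (perm_sumn (perm_to_rem qnu)). Qed.

Definition partition_insert q nu := sort geq (q :: nu).

Lemma perm_insert q nu : perm_eq (partition_insert q nu) (q :: nu).
Proof. by rewrite perm_sort. Qed.

Lemma is_partition_insert q nu : (0 < q)%N -> is_partition nu ->
  is_partition (partition_insert q nu).
Proof.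
move=> q0 /andP[_ nu0]; rewrite /is_partition sort_sorted; last first.
  by move=> x y; exact: leq_total.
by rewrite (perm_mem (perm_insert q nu)) inE negb_or nu0 andbT eq_sym -lt0n.
Qed.

Lemma rem_insert q nu : (0 < q)%N -> is_partition nu -> rem q (partition_insert q nu) = nu.
Proof.
move=> q0 pnu; apply: sorted_geq_eq.
- by case/andP: (is_partition_rem q (is_partition_insert q0 pnu)).
- by case/andP: pnu.
- rewrite -(perm_cons q); apply: perm_trans (perm_insert q nu).
  by rewrite perm_sym perm_to_rem // (perm_mem (perm_insert q nu)) inE eqxx.
Qed.

(** A partition with a chosen distinct part is the same as a smaller partition with a part to
    insert. *)
Lemma sum_removals (V : nmodType) (F : seq nat -> nat -> V) t :
  \sum_(nu <- partitions_of t.+1) \sum_(q <- undup nu) F (rem q nu) q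
  = \sum_(i < t.+1) \sum_(nu <- partitions_of (t - i)) F nu i.+1.
Proof.
transitivity (\sum_(nu <- partitions_of t.+1) \sum_(1 <= q < t.+2 | q \in nu) F (rem q nu) q).
  apply: eq_big_seq => nu; rewrite mem_partitions_of => /andP[/andP[_ nu0] /eqP nut].
  rewrite -[RHS]big_filter; apply: perm_big; apply: uniq_perm; rewrite ?undup_uniq //.
    by rewrite filter_uniq // iota_uniq.
  move=> q; rewrite mem_undup mem_filter mem_index_iota.
  case: (boolP (q \in nu)) => //= qnu; apply/esym/andP; split.
    by rewrite lt0n; apply: contraNneq nu0 => <-.
  by rewrite ltnS -nut -(sumn_rem qnu) leq_addr.
rewrite (exchange_big_dep predT) //= big_add1 big_mkord; apply: eq_bigr => i _.
rewrite -big_filter -(big_map (rem i.+1) predT (fun nu => F nu i.+1)).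
have part nu : (nu \in [seq nu <- partitions_of t.+1 | i.+1 \in nu])
    = [&& i.+1 \in nu, is_partition nu & sumn nu == t.+1].
  by rewrite mem_filter mem_partitions_of.
apply: perm_big; apply: uniq_perm.
- rewrite map_inj_in_uniq; first by exact: filter_uniq (partitions_of_uniq _).
  move=> nu nu'.
  rewrite !part => /and3P[inu /andP[nus _] _] /and3P[inu' /andP[nus' _] _] e.
  apply: sorted_geq_eq => //; apply: perm_trans (perm_to_rem inu) _.
  by rewrite e perm_sym; exact: perm_to_rem.
- exact: partitions_of_uniq.
- move=> nu; rewrite mem_partitions_of; apply/mapP/idP => [[mu]|/andP[pnu /eqP nut]].
    rewrite part => /and3P[imu pmu /eqP mut] ->; rewrite is_partition_rem //=.
    by apply/eqP/(@addnI i.+1); rewrite sumn_rem // mut addSn subnKC // -ltnS ltn_ord.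
  exists (partition_insert i.+1 nu); last by rewrite rem_insert.
  rewrite part is_partition_insert // (perm_mem (perm_insert _ _)) inE eqxx /=.
  by rewrite (perm_sumn (perm_insert _ _)) /= nut addSn eqSS subnKC // -ltnS ltn_ord.
Qed.

Lemma sumn_undup nu : sumn nu = (\sum_(q <- undup nu) count_mem q nu * q)%N.
Proof.
rewrite sumnE -big_undup_iterop_count; apply: eq_bigr => q _.
by rewrite Monoid.iteropE iter_addn_0 mulnC.
Qed.

Section PartitionCoefficients.
Context (K : numFieldType) (l : K).
Hypothesis l0 : l != 0.

(* [prod_p (p l)^(-q_p) / q_p!], where [q_p] is the multiplicity of [p]: the
   coefficients of [exp (sum_p x_p / (p l))]. *)
Fixpoint ecoef (nu : seq nat) : K :=
  if nu is p :: mu then ecoef mu / ((count_mem p nu)%:R * p%:R * l) else 1.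

Lemma ecoef_rem q nu : 0%N \notin nu -> q \in nu ->
  ecoef (rem q nu) = ecoef nu * ((count_mem q nu)%:R * q%:R * l).
Proof.
elim: nu => // p nu IH; rewrite inE negb_or => /andP[p0 nu0].
have den0 : ((count_mem p (p :: nu))%:R * p%:R * l : K) != 0.
  by rewrite /= eqxx !mulf_neq0 // pnatr_eq0 // eq_sym.
rewrite inE [rem q _]/=; have [<- _|pq /= qnu] := eqVneq p q.
  by rewrite [ecoef (_ :: _)]/= divfK.
rewrite IH // count_rem qnu /= eqxx (eq_sym q) (negPf pq) subn0.
by rewrite add0n mulrAC.
Qed.

(** Removing [q] multiplies the coefficient by [l] times [q] times its multiplicity, and these
    products of part and multiplicity add up to the weight. *)
Lemma ecoef_rem_sum nu : 0%N \notin nu ->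
  \sum_(q <- undup nu) ecoef (rem q nu) = ecoef nu * ((sumn nu)%:R * l).
Proof.
move=> nu0; rewrite sumn_undup natr_sum mulr_suml mulr_sumr; apply: eq_big_seq => q.
by rewrite mem_undup => qnu; rewrite ecoef_rem // natrM.
Qed.

(** The left side satisfies the recursion of [newton]: the factor [t] is distributed over the
    distinct parts by [ecoef_rem_sum], and [sum_removals] regroups the terms by the part removed. *)
Lemma ecoef_newton (A : comAlgType K) (x : nat -> A) t :
  \sum_(nu <- partitions_of t) ecoef nu *: \prod_(p <- nu) x p
  = newton (fun i => l^-1 *: x i.+1) t.
Proof.
pose E t := \sum_(nu <- partitions_of t) ecoef nu *: \prod_(p <- nu) x p.
rewrite -/(E t).
apply: (newton_ind (Q := fun t x => E t = x)) => [|n IH].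
  have -> : E 0%N = \sum_(nu <- [:: [::]]) ecoef nu *: \prod_(p <- nu) x p.
    apply: perm_big; apply: uniq_perm; rewrite ?partitions_of_uniq // => nu.
    rewrite mem_partitions_of inE; case: nu => // p nu.
    rewrite /is_partition inE negb_or; apply/negbTE/negP.
    by move=> /andP[/andP[_ /andP[p0 _]]]; rewrite /= addn_eq0 => /andP[/eqP pe]; rewrite pe in p0.
  by rewrite big_seq1 big_nil scale1r.
apply: newton_eq; rewrite /E scaler_sumr.
transitivity (\sum_(nu <- partitions_of n.+1) \sum_(q <- undup nu)
    l^-1 *: (x q * (ecoef (rem q nu) *: \prod_(p <- rem q nu) x p))).
  apply: eq_big_seq => nu; rewrite mem_partitions_of => /andP[/andP[_ nu0] /eqP nun].
  rewrite scalerA -[n.+1%:R](mulfK l0) -{1}nun mulrAC [_ * ecoef nu]mulrC.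
  rewrite -ecoef_rem_sum // mulrC mulr_sumr scaler_suml; apply: eq_big_seq => q.
  rewrite mem_undup => qnu; rewrite -scalerA -scalerAr (perm_big _ (perm_to_rem qnu)).
  by rewrite big_cons.
rewrite (sum_removals (fun nu q => l^-1 *: (x q * (ecoef nu *: \prod_(p <- nu) x p)))).
apply: eq_bigr => i _; rewrite -(IH (n - i)%N) ?leq_subr // -scalerAl mulr_sumr scaler_sumr.
by [].
Qed.

Section Recursion.
Context (m : nat) (b : seq nat -> nat -> K).
Hypothesis b_rec : forall nu p, is_partition nu -> (0 < p)%N -> (sumn nu + p)%N = m ->
  b nu p * ((sumn nu)%:R * l) = \sum_(q <- undup nu) b (rem q nu) (p + q)%N.

(** Each use of the recursion shortens [nu] and adds the removed part to [p], so everything comes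
    down to the value at the empty partition, where [p = m]. *)
Lemma ecoef_unique nu p : is_partition nu -> (0 < p)%N -> (sumn nu + p)%N = m ->
  b nu p = b [::] m * ecoef nu.
Proof.
elim: {nu}(size nu) {-2}nu (leqnn (size nu)) p => [|n IH] nu nun p pnu p0 nup.
  by move: nun nup; case: nu pnu => // _ _ /= <-; rewrite mulr1.
have [nu0|/eqP nunil] := eqVneq nu [::]; first by rewrite -nup nu0 /= mulr1.
have nu_pos : 0%N \notin nu by case/andP: pnu.
have s0 : ((sumn nu)%:R * l) != 0.
  rewrite mulf_neq0 // pnatr_eq0; case: (nu) nunil nu_pos => //= q s _.
  by rewrite inE negb_or addn_eq0 eq_sym => /andP[/negPf ->].
apply: (mulIf s0); rewrite b_rec // -mulrA -ecoef_rem_sum // mulr_sumr; apply: eq_big_seq => q.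
rewrite mem_undup => qnu; have qs := sumn_rem qnu; apply: IH.
- by rewrite size_rem //; case: (nu) nun.
- exact: is_partition_rem.
- by rewrite addn_gt0 p0.
- by rewrite -nup -qs; lia.
Qed.

End Recursion.

End PartitionCoefficients.

(** * The solutions of the two linear systems *)

Section Solutions.
Context (K : numFieldType) (ell cc : K) (m : nat).
Hypotheses (ell0 : ell != 0) (m0 : (0 < m)%N).
Implicit Types (b : seq nat -> nat -> K) (nu la : seq nat).

Lemma partition_nz nu : is_partition nu -> 0%N \notin nu.
Proof. by case/andP. Qed.

Lemma insert_partitions nu p : is_partition nu -> (0 < p)%N -> (sumn nu + p)%N = m ->
  partition_insert p nu \in partitions_of m.
Proof.
move=> pnu p0 nup; rewrite mem_partitions_of is_partition_insert //.
by rewrite (perm_sumn (perm_insert _ _)) /= addnC nup eqxx.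
Qed.

Lemma mem_insert p nu : p \in partition_insert p nu.
Proof. by rewrite (perm_mem (perm_insert _ _)) inE eqxx. Qed.

Lemma rem2_coef_sum b la p : is_partition la -> p \in la ->
  \sum_(q <- undup la) rem2_coef b la p q
  = \sum_(q <- undup (rem p la)) b (rem q (rem p la)) (p + q)%N.
Proof.
move=> pla pin; rewrite /rem2_coef -big_mkcond -big_filter /=; apply: perm_big.
apply: uniq_perm; rewrite ?filter_uniq ?undup_uniq // => q.
by rewrite mem_filter !mem_undup andb_idr //; exact: mem_rem.
Qed.

Lemma ecoef_rem2_sum (l : K) la p : l != 0 -> is_partition la -> p \in la ->
  \sum_(q <- undup la) rem2_coef (fun nu _ => ecoef l nu) la p q
  = ecoef l (rem p la) * ((sumn (rem p la))%:R * l).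
Proof.
move=> l0 pla pin; rewrite rem2_coef_sum // -ecoef_rem_sum //.
exact/partition_nz/is_partition_rem.
Qed.

Section SolutionI.
Hypothesis ccm : cc + m%:R * ell = 0.

Let ccE : cc = - (m%:R * ell).
Proof. by apply/eqP; rewrite -addr_eq0 ccm. Qed.

(** Behind this solution is the product of [exp (\sum_p c(-p) z^p / (p ell))] with the series of the
    [b(-s)]. The exponential does not see [s], whence coefficients depending on the partition
    alone. *)
Lemma solution_i_exists : solution_i ell cc m (ecoef ell) (fun nu _ => ecoef ell nu).
Proof.
move=> la; rewrite mem_partitions_of => /andP[pla /eqP lam].
split=> [p pin||p pin].
- by rewrite ecoef_rem ?partition_nz // -!mulrA subrr.
- by rewrite ecoef_rem_sum ?partition_nz // lam ccE mulrN addNr.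
- rewrite ecoef_rem2_sum // -mulrDr ccE -{1}lam -(sumn_rem pin) natrD.
  by rewrite [X in _ * X](_ : _ = 0) ?mulr0 //; ring.
Qed.

(** Since [cc = - m ell], the factor [cc + p ell] in the third equation is [- |nu| ell], and the
    equation becomes the recursion of [ecoef_unique]. The second one then gives [a], as [m ell] is
    invertible. *)
Lemma solution_i_coef a b : solution_i ell cc m a b ->
  (forall nu p, is_partition nu -> (0 < p)%N -> (sumn nu + p)%N = m ->
    b nu p = b [::] m * ecoef ell nu)
  /\ (forall la, la \in partitions_of m -> a la = b [::] m * ecoef ell la).
Proof.
move=> sab; have bE nu p : is_partition nu -> (0 < p)%N -> (sumn nu + p)%N = m ->
    b nu p = b [::] m * ecoef ell nu.
  apply: ecoef_unique => // {}nu {}p pnu p0 nup.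
  have := insert_partitions pnu p0 nup => la_in; have [_ _] := sab _ la_in.
  move=> /(_ p (mem_insert p nu)).
  rewrite rem2_coef_sum ?mem_insert ?is_partition_insert // rem_insert // => /eqP.
  rewrite addrC addr_eq0 => /eqP ->; rewrite ccE -nup natrD -mulrN; congr (_ * _); ring.
split=> // la la_in; have [_ + _] := sab _ la_in.
move: la_in; rewrite mem_partitions_of => /andP[pla /eqP lam].
have -> : \sum_(p <- undup la) b (rem p la) p = b [::] m * (ecoef ell la * (m%:R * ell)).
  rewrite -lam -ecoef_rem_sum ?partition_nz // lam mulr_sumr; apply: eq_big_seq => p.
  rewrite mem_undup => pin; apply: bE; first exact: is_partition_rem.
    by rewrite lt0n; apply: contraNneq (partition_nz pla) => <-.
  by rewrite addnC sumn_rem.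
have ml0 : (m%:R * ell : K) != 0 by rewrite mulf_neq0 // pnatr_eq0 -lt0n.
rewrite ccE mulrN mulrA => /eqP; rewrite addrC subr_eq0 => /eqP H.
exact/esym/(mulIf ml0).
Qed.

Lemma solution_i_nonzero a b : solution_i ell cc m a b -> nonzero_i m a b -> b [::] m != 0.
Proof.
move=> /solution_i_coef[bE aE] [[la la_in]|[nu [p [pnu p0 nup]]]].
  by rewrite aE // mulf_eq0 negb_or => /andP[].
by rewrite bE // mulf_eq0 negb_or => /andP[].
Qed.

End SolutionI.

Section SolutionII.
Hypothesis ccm : cc - m%:R * ell = 0.

Let ccE : cc = m%:R * ell.
Proof. by apply/eqP; rewrite -subr_eq0 ccm. Qed.

Let ellN : - ell != 0. Proof. by rewrite oppr_eq0. Qed.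

(** The sign of the level is reversed because [a] carries the exponential inverse to that of [b]. *)
Lemma solution_ii_exists : solution_ii ell cc m (fun nu _ => ecoef (- ell) nu).
Proof.
move=> la; rewrite mem_partitions_of => /andP[pla /eqP lam].
split=> [p q pin qin pq|p pin].
- have pq' : p \in rem q la by rewrite rem_mem.
  have qp' : q \in rem p la by rewrite rem_mem // eq_sym.
  rewrite /rem2_coef qp' (ecoef_rem ellN (partition_nz (is_partition_rem p pla)) qp').
  rewrite !ecoef_rem ?partition_nz // count_rem pin /= (negPf pq) subn0; ring.
- rewrite ecoef_rem2_sum // -mulrBr ccE -{1}lam -(sumn_rem pin) natrD.
  by rewrite [X in _ * X](_ : _ = 0) ?mulr0 //; ring.
Qed.

Lemma solution_ii_coef b : solution_ii ell cc m b ->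
  forall nu p, is_partition nu -> (0 < p)%N -> (sumn nu + p)%N = m ->
    b nu p = b [::] m * ecoef (- ell) nu.
Proof.
move=> sb; apply: ecoef_unique => // nu p pnu p0 nup.
have := insert_partitions pnu p0 nup => la_in; have [_] := sb _ la_in.
move=> /(_ p (mem_insert p nu)).
rewrite rem2_coef_sum ?mem_insert ?is_partition_insert // rem_insert // => /eqP.
rewrite subr_eq0 => /eqP <-; rewrite ccE -nup natrD; congr (_ * _); ring.
Qed.

Lemma solution_ii_nonzero b : solution_ii ell cc m b -> pair_nonzero m b -> b [::] m != 0.
Proof.
move=> /solution_ii_coef bE [nu [p [pnu p0 nup]]].
by rewrite bE // mulf_eq0 negb_or => /andP[].
Qed.

End SolutionII.

Lemma pair_nonzero_ecoef (l : K) : pair_nonzero m (fun nu _ => ecoef l nu).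
Proof. by exists [::], m; rewrite /= oner_eq0. Qed.

End Solutions.

(** * Action of the elements of (i) and (ii) *)

Lemma conv_inverse (A : comNzRingType) (p q z : nat -> A) m :
  (forall T, \sum_(i < T.+1) p i * q (T - i)%N = (T == 0%N)%:R) ->
  \sum_(s < m.+1) p (m - s)%N * \sum_(i < s.+1) q i * z (s - i)%N = z m.
Proof.
(* Truncation at degree [m] leaves the coefficients up to [m] unchanged and reduces the claim to
   associativity in a polynomial ring. *)
move=> pq; pose F (x : nat -> A) := \poly_(i < m.+1) x i.
have FE x i : (i <= m)%N -> (F x)`_i = x i by move=> im; rewrite coef_poly ltnS im.
have FM x y s : (s <= m)%N -> (F x * F y)`_s = \sum_(i < s.+1) x i * y (s - i)%N.
  move=> sm; rewrite coefM; apply: eq_bigr => i _; rewrite !FE //.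
    exact: leq_trans (leq_subr _ _) sm.
  by apply: leq_trans sm; rewrite -ltnS.
transitivity ((F q * F z * F p)`_m).
  rewrite coefM; apply: eq_bigr => s _; rewrite FM ?FE ?leq_subr 1?mulrC //.
  by rewrite -ltnS.
rewrite mulrAC [F q * _]mulrC coefM big_ord_recl FM // pq mul1r subn0 FE // big1 ?addr0 //.
by move=> i _; rewrite FM ?pq ?mul0r //=; exact: ltn_ord.
Qed.

Lemma pvar_exp (K : numFieldType) (P : polyalg K gvar) i k :
  pvar P i ^+ k = pmon P (wmon (nseq k i)).
Proof.
elim: k => [|k IH]; first by rewrite expr0 -pmon1.
by rewrite exprS IH pvar_mon.
Qed.

Section CreationOperators.
Context (K : numFieldType) (P : polyalg K gvar) (ell cc dd : K).
Local Notation V := (affnw_verma ell cc dd).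
Context (oa ob oc od : int -> lend P) (H : nwrep ell cc dd oa ob oc od (1 : P)).
Local Notation phi := (affnw_lift H : V -> P).
Hypothesis ocN : forall n f, oc (Negz n) f = pvar P (gC n) * f.
Implicit Types (u : V) (f : P).

Definition cvar p : P := pvar P (gC p.-1).

Lemma lift_neg_mode x p u : phi (neg_mode x p *: u) = nwop oa ob oc od (- p%:Z) x (phi u).
Proof. exact: affnw_lift_mode. Qed.

Lemma lift_neg_modes_c la u : 0%N \notin la ->
  phi (neg_modes (nw_c K) la *: u) = (\prod_(p <- la) cvar p) * phi u.
Proof.
elim: la => [|p la IH] la0; first by rewrite /neg_modes !big_nil scale1r mul1r.
move: la0; rewrite inE negb_or => /andP[p0 la0].
rewrite /neg_modes !big_cons -scalerA lift_neg_mode nwop_basis.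
case: p p0 => // p _; rewrite ocN -/(neg_modes _ la) IH //.
exact: mulrA.
Qed.

Lemma lift_scale k (X : env (affnw K)) u : phi ((k *: X) *: u) = k *: phi (X *: u).
Proof. by rewrite -mulr_algl -scalerA affnw_lift_const. Qed.

Lemma lift_envD (X Y : env (affnw K)) u : phi ((X + Y) *: u) = phi (X *: u) + phi (Y *: u).
Proof. by rewrite scalerDl linearD. Qed.

Lemma lift_env_sum (J : Type) (s : seq J) (X : J -> env (affnw K)) u :
  phi ((\sum_(j <- s) X j) *: u) = \sum_(j <- s) phi (X j *: u).
Proof.
elim: s => [|j s IH]; first by rewrite !big_nil scale0r linear0.
by rewrite !big_cons scalerDl linearD /= IH.
Qed.

Lemma lift_removals (l : K) (b : seq nat -> nat -> K) k x m u : l != 0 ->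
  (forall nu p, is_partition nu -> (0 < p)%N -> (sumn nu + p)%N = m.+1 ->
     b nu p = k * ecoef l nu) ->
  phi ((\sum_(la <- partitions_of m.+1) \sum_(p <- undup la)
     b (rem p la) p *: (neg_modes (nw_c K) (rem p la) * neg_mode x p)) *: u)
  = k *: \sum_(i < m.+1) newton (fun i => l^-1 *: cvar i.+1) (m - i)
      * nwop oa ob oc od (Negz i) x (phi u).
Proof.
move=> l0 bE; rewrite lift_env_sum.
transitivity (\sum_(la <- partitions_of m.+1) \sum_(p <- undup la)
    k *: ((ecoef l (rem p la) *: \prod_(q <- rem p la) cvar q)
      * nwop oa ob oc od (- p%:Z) x (phi u))).
  apply: eq_big_seq => la; rewrite mem_partitions_of => /andP[pla /eqP lam].
  rewrite lift_env_sum; apply: eq_big_seq => p; rewrite mem_undup => pin.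
  have p0 : (0 < p)%N by rewrite lt0n; apply: contraNneq (partition_nz pla) => <-.
  rewrite lift_scale -scalerA lift_neg_modes_c ?partition_nz ?is_partition_rem //.
  by rewrite lift_neg_mode bE ?is_partition_rem // 1?addnC ?sumn_rem // -scalerA scalerAl.
rewrite (sum_removals (fun nu p => k *: ((ecoef l nu *: \prod_(q <- nu) cvar q)
      * nwop oa ob oc od (- p%:Z) x (phi u)))).
rewrite scaler_sumr; apply: eq_bigr => i _; rewrite -scaler_sumr -mulr_suml.
by rewrite (ecoef_newton l0).
Qed.

(** The coefficient of the exponential series times that of the [b(-s)]. The summand [s = 0] comes
    from the terms with [a la], the others from the removals. *)
Lemma lift_element_i a b k m u : ell != 0 ->
  (forall nu p, is_partition nu -> (0 < p)%N -> (sumn nu + p)%N = m.+1 ->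
     b nu p = k * ecoef ell nu) ->
  (forall la, la \in partitions_of m.+1 -> a la = k * ecoef ell la) ->
  phi (element_i m.+1 a b *: u) = k *: \sum_(s < m.+2)
    newton (fun i => ell^-1 *: cvar i.+1) (m.+1 - s) * ob (- s%:Z) (phi u).
Proof.
move=> ell0 bE aE; have -> : element_i m.+1 a b
    = \sum_(la <- partitions_of m.+1) a la *: (neg_modes (nw_c K) la * neg_mode (nw_b K) 0)
      + \sum_(la <- partitions_of m.+1) \sum_(p <- undup la)
          b (rem p la) p *: (neg_modes (nw_c K) (rem p la) * neg_mode (nw_b K) p).
  exact: big_split.
rewrite lift_envD.
rewrite (lift_removals _ _ ell0 bE) [in RHS]big_ord_recl scalerDr subn0.
congr (_ + _).
  rewrite lift_env_sum -(ecoef_newton ell0) mulr_suml scaler_sumr; apply: eq_big_seq => la la_in.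
  have la0 : 0%N \notin la by move: la_in; rewrite mem_partitions_of => /andP[/partition_nz].
  rewrite lift_scale -scalerA lift_neg_modes_c // lift_neg_mode nwop_basis aE //.
  by rewrite -scalerA scalerAl.
by congr (_ *: _); apply: eq_bigr => i _; rewrite nwop_basis.
Qed.

Lemma lift_element_ii b k m u : ell != 0 ->
  (forall nu p, is_partition nu -> (0 < p)%N -> (sumn nu + p)%N = m.+1 ->
     b nu p = k * ecoef (- ell) nu) ->
  phi (element_ii m.+1 b *: u) = k *: \sum_(s < m.+1)
    newton (fun i => - (ell^-1 *: cvar i.+1)) (m - s) * oa (Negz s) (phi u).
Proof.
move=> ell0 bE; have ellN : - ell != 0 by rewrite oppr_eq0.
rewrite /element_ii (lift_removals _ _ ellN bE); congr (_ *: _); apply: eq_bigr => i _.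
rewrite nwop_basis; congr (newton _ _ * _); apply: funext => j.
by rewrite invrN scaleNr.
Qed.

End CreationOperators.

Section CreationOperators1.
Context (K : numFieldType) (P : polyalg K gvar) (ell cc dd : K).
Hypothesis ell0 : ell != 0.
Implicit Types (f : P).

Lemma ob1_neg f s : dfree f -> (forall n, pder P (gA n) f = 0) ->
  ob1 P ell cc (- s%:Z) f = \sum_(i < s.+1) eserN P ell i * (pvar P (gB (s - i)) * f).
Proof.
move=> df af; rewrite /ob1 dress_dfree ?mulr1 // /nb (@fieldE _ _ _ s.+1).
- apply: eq_bigr => i _; congr (_ * _).
  have -> : - s%:Z + i%:Z = - (s - i)%N%:Z by have := ltn_ord i; lia.
  by case: (s - i)%N.
- exact: fb_lfield.
- move=> i si; have -> : - s%:Z + i%:Z = (i - s.+1).+1%:Z by lia.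
  by rewrite /fb lendZE af scaler0.
Qed.

Lemma oa1_neg f s : dfree f -> (forall n, pder P (gB n) f = 0) ->
  oa1 P ell cc (Negz s) f = \sum_(i < s.+1) eser P ell i * (pvar P (gA (s - i)) * f).
Proof.
move=> df bf; rewrite /oa1 dress_dfree ?mulrNN ?mulr1 // /na (@fieldE _ _ _ s.+1).
- apply: eq_bigr => i _; congr (_ * _).
  by have -> : Negz s + i%:Z = Negz (s - i) by have := ltn_ord i; lia.
- exact: fa_lfield.
- move=> i si; have -> : Negz s + i%:Z = (i - s.+1)%N%:Z by lia.
  by rewrite /fa lendZE bf scaler0.
Qed.

Lemma eser_eserN_sum T : \sum_(i < T.+1) eser P ell i * eserN P ell (T - i)%N = (T == 0%N)%:R.
Proof. exact: newton_conv. Qed.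

Lemma eserN_eser_sum T : \sum_(i < T.+1) eserN P ell i * eser P ell (T - i)%N = (T == 0%N)%:R.
Proof.
rewrite -eser_eserN_sum (reindex_inj rev_ord_inj) /=; apply: eq_bigr => i _.
by rewrite subSS mulrC subKn // -ltnS.
Qed.

Lemma pder_var_exp i j k : i != j -> pder P i (pvar P j ^+ k) = 0.
Proof.
move=> ij; elim: k => [|k IH]; first by rewrite expr0 pder1.
by rewrite exprS pder_varM IH mulr0 addr0 (negPf ij).
Qed.

Local Notation phi := (affnw_lift (nwrep1 P cc dd ell0) : affnw_verma ell cc dd -> P).

Lemma oc1N n f : oc1 P ell cc (Negz n) f = pvar P (gC n) * f.
Proof. by []. Qed.

(** Powers of [B_(m+1)] are free of the [D] and [A] variables, so the modes of [b] act on them by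
    convolution of the variables [B_n] with [eserN]. The element convolves with the inverse series
    and leaves one variable. *)
Lemma lift_element_i_exp a b k m j : 
  (forall nu p, is_partition nu -> (0 < p)%N -> (sumn nu + p)%N = m.+1 ->
     b nu p = k * ecoef ell nu) ->
  (forall la, la \in partitions_of m.+1 -> a la = k * ecoef ell la) ->
  phi (element_i m.+1 a b ^+ j *: affnw_hwv ell cc dd) = k ^+ j *: pvar P (gB m.+1) ^+ j.
Proof.
move=> bE aE; elim: j => [|j IH]; first by rewrite !scale1r affnw_lift_hwv.
rewrite exprS -scalerA (lift_element_i (nwrep1 P cc dd ell0) oc1N _ ell0 bE aE) ?IH //.
have df : dfree (k ^+ j *: pvar P (gB m.+1) ^+ j).
  by move=> n; rewrite lend_vecZ pder_var_exp // scaler0.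
have af n : pder P (gA n) (k ^+ j *: pvar P (gB m.+1) ^+ j) = 0.
  by rewrite lend_vecZ pder_var_exp // scaler0.
under eq_bigr do rewrite ob1_neg //.
have := conv_inverse (fun i => pvar P (gB i) * (k ^+ j *: pvar P (gB m.+1) ^+ j)) m.+1 eser_eserN_sum.
move=> ->; by rewrite -scalerAr scalerA -exprS -exprS.
Qed.

Lemma lift_element_ii_exp b k m j : 
  (forall nu p, is_partition nu -> (0 < p)%N -> (sumn nu + p)%N = m.+1 ->
     b nu p = k * ecoef (- ell) nu) ->
  phi (element_ii m.+1 b ^+ j *: affnw_hwv ell cc dd) = k ^+ j *: pvar P (gA m) ^+ j.
Proof.
move=> bE; elim: j => [|j IH]; first by rewrite !scale1r affnw_lift_hwv.
rewrite exprS -scalerA (lift_element_ii (nwrep1 P cc dd ell0) oc1N _ ell0 bE) ?IH //.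
have df : dfree (k ^+ j *: pvar P (gA m) ^+ j).
  by move=> n; rewrite lend_vecZ pder_var_exp // scaler0.
have bf n : pder P (gB n) (k ^+ j *: pvar P (gA m) ^+ j) = 0.
  by rewrite lend_vecZ pder_var_exp // scaler0.
under eq_bigr do rewrite oa1_neg //.
have := conv_inverse (fun i => pvar P (gA i) * (k ^+ j *: pvar P (gA m) ^+ j)) m eserN_eser_sum.
move=> ->; by rewrite -scalerAr scalerA -exprS -exprS.
Qed.

End CreationOperators1.

(** * Bases of singular vectors *)

Section SingularBases.
Context (K : numFieldType) (P : polyalg K gvar) (ell cc dd : K).
Local Notation V := (affnw_verma ell cc dd).
Implicit Types (f : P) (w : V).

Lemma single_variable f j (m : {cmonom gvar}) : (forall i, i != j -> pder P i f = 0) -> pcoef m f != 0 ->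
  m = wmon (nseq (m j) j).
Proof.
move=> f0 mf; apply: cmonom_eqP => i; rewrite wmonE count_nseq /=.
have [<-|ij] := eqVneq j i; first by rewrite mul1n.
by rewrite mul0n; apply: (proj1 (pder_eq0P _ _) (f0 i _)) mf; rewrite eq_sym.
Qed.

Lemma pder_mon0 i (m : {cmonom gvar}) : m i = 0%N -> pder P i (pmon P m) = 0.
Proof.
move=> mi; apply/pder_eq0P => m'; rewrite pcoef_mon.
by case: (m =P m') => [<-|_]; rewrite ?mi // eqxx.
Qed.

Definition opt_deg (o : option nat) : nat := if o is Some k then k.+1 else 0.

Lemma power_basis (H : nwrep ell cc dd (oa1 P ell cc) (ob1 P ell cc) (oc1 P ell cc)
    (od1 P ell dd) (1 : P)) X (k : K) i :
  k != 0 ->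
  (forall j, affnw_lift H (X ^+ j *: affnw_hwv ell cc dd) = k ^+ j *: pvar P i ^+ j) ->
  (forall f, psingular (oa1 P ell cc) (ob1 P ell cc) (oc1 P ell cc) (od1 P ell dd) f <->
    forall j, j != i -> pder P j f = 0) ->
  singular_basis (affnw_hwv ell cc dd) (fun j : nat => X ^+ j.+1 *: affnw_hwv ell cc dd).
Proof.
move=> k0 XE sP.
have vE (o : option nat) : (if o is Some j then X ^+ j.+1 *: affnw_hwv ell cc dd
    else affnw_hwv ell cc dd) = X ^+ opt_deg o *: affnw_hwv ell cc dd.
  by case: o => //=; rewrite expr0 scale1r.
apply: (@monomial_basis _ _ _ _ _ _ _ _ _ H (@triangular1 _ P ell cc dd) _ _
  (fun o => k ^+ opt_deg o) (fun o => wmon (nseq (opt_deg o) i))).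
- by move=> o; rewrite vE XE pvar_exp.
- by move=> o; rewrite expf_neq0.
- move=> o o' /(congr1 (fun m : {cmonom gvar} => m i)); rewrite !wmonE !count_nseq /= eqxx !mul1n.
  by case: o o' => [j|] [j'|] //= [->].
- move=> o; apply/(affnw_singularP H (@triangular1 _ P ell cc dd))/sP => j ji.
  by rewrite vE XE lend_vecZ pder_var_exp // scaler0.
- move=> w /(affnw_singularP H (@triangular1 _ P ell cc dd))/sP w0 m mw.
  rewrite (single_variable w0 mw); case: (m i) => [|j]; first by exists None.
  by exists (Some j).
Qed.

(** For [cc = - m ell], the coefficient [n ell + cc] vanishes at [n = m] only, while
    [n ell - cc = (n + m) ell] is never 0; so [B_m] is the one variable not excluded. *)
Lemma singular_basis_i m a b : ell != 0 -> (0 < m)%N -> cc + m%:R * ell = 0 ->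
  solution_i ell cc m a b -> nonzero_i m a b ->
  singular_basis (affnw_hwv ell cc dd)
    (fun k : nat => element_i m a b ^+ k.+1 *: affnw_hwv ell cc dd).
Proof.
move=> ell0 m0 ccm sab nab; have ccE : cc = - (m%:R * ell).
  by apply/eqP; rewrite -addr_eq0 ccm.
have [bE aE] := solution_i_coef ell0 m0 ccm sab.
have k0 := solution_i_nonzero ell0 m0 ccm sab nab.
have nz (n : nat) : n != m -> n%:R * ell + cc != 0.
  by move=> nm; rewrite ccE -mulrBl mulf_neq0 // subr_eq0 eqr_nat.
have nz' (n : nat) : n.+1%:R * ell - cc != 0.
  by rewrite ccE opprK -mulrDl mulf_neq0 // -natrD pnatr_eq0.
apply: (power_basis (H := nwrep1 P cc dd ell0) (i := gB m) k0) => [j|f].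
  by case: (m) m0 bE aE => // m' _ bE aE; exact: lift_element_i_exp.
split=> [/(psingular1P _ _ ell0) sf|sf].
  move=> [[n|n]|[n|n]] nm; case: (sf n) => //.
  - by move=> _ + _ _; rewrite /fb lendZE => /scaled_eq0; apply.
  - by move=> + _ _ _; rewrite /fa lendZE => /scaled_eq0; apply; apply: nz.
apply/(psingular1P _ _ ell0) => n; split; rewrite ?sf //.
- rewrite /fa lendZE; have [->|nm] := eqVneq n m; first by rewrite ccE subrr scale0r.
  by rewrite sf ?scaler0.
- by rewrite /fb lendZE sf ?scaler0.
Qed.

Lemma singular_basis_ii m b : ell != 0 -> (0 < m)%N -> cc - m%:R * ell = 0 ->
  solution_ii ell cc m b -> pair_nonzero m b ->
  singular_basis (affnw_hwv ell cc dd)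
    (fun k : nat => element_ii m b ^+ k.+1 *: affnw_hwv ell cc dd).
Proof.
move=> ell0 m0 ccm sb nb; have ccE : cc = m%:R * ell.
  by apply/eqP; rewrite -subr_eq0 ccm.
have bE := solution_ii_coef ell0 ccm sb.
have k0 := solution_ii_nonzero ell0 ccm sb nb.
have nz (n : nat) : n.+1 != m -> n.+1%:R * ell - cc != 0.
  by move=> nm; rewrite ccE -mulrBl mulf_neq0 // subr_eq0 eqr_nat.
have nz' (n : nat) : n%:R * ell + cc != 0.
  by rewrite ccE -mulrDl mulf_neq0 // -natrD pnatr_eq0 addn_eq0 negb_and -!lt0n m0 orbT.
(* The variable of [a(-m)] has index [m-1]. *)
apply: (power_basis (H := nwrep1 P cc dd ell0) (i := gA m.-1) k0) => [j|f].
  by case: (m) m0 bE => // m' _ bE; exact: lift_element_ii_exp.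
split=> [/(psingular1P _ _ ell0) sf|sf].
  move=> [[n|n]|[n|n]] nm; case: (sf n) => //.
  - move=> _ + _ _; rewrite /fb lendZE => /scaled_eq0; apply; apply: nz.
    by apply: contraNneq nm => <-.
  - by move=> + _ _ _; rewrite /fa lendZE => /scaled_eq0; apply.
apply/(psingular1P _ _ ell0) => n; split; rewrite ?sf //.
- by rewrite /fa lendZE sf ?scaler0.
- rewrite /fb lendZE; have [nm|nm] := eqVneq n.+1 m; first by rewrite ccE nm subrr scale0r.
  by rewrite sf ?scaler0 //; apply: contraNneq nm => -[->]; rewrite prednK.
Qed.

Definition opt_part (o : option ne_partition) : seq nat := if o is Some la then la else [::].

Lemma opt_partP o : is_partition (opt_part o).
Proof. by case: o => //= la; have /andP[] := nepartP la. Qed.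

Lemma opt_part_inj : injective opt_part.
Proof.
move=> [la|] [la'|] //=.
- by move=> e; congr Some; apply: val_inj.
- by move=> e; have := nepartP la; rewrite e eqxx andbF.
- by move=> e; have := nepartP la'; rewrite -e eqxx andbF.
Qed.

Definition pmonom (la : seq nat) := wmon (map (fun p => gC p.-1) la).

Lemma pmonom_inj la la' : is_partition la -> is_partition la' -> pmonom la = pmonom la' -> la = la'.
Proof.
move=> pla pla' e; apply: sorted_geq_eq; [by case/andP: pla | by case/andP: pla' |].
apply/allP => p _; apply/eqP.
have part0 mu : is_partition mu -> count_mem 0%N mu = 0%N.
  by case/andP=> _ mu0; apply/count_memPn.
case: p => [|p]; first by rewrite !part0.
have := congr1 (fun m : {cmonom gvar} => m (gC p)) e; rewrite !wmonE !count_map.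
have E mu : is_partition mu -> count (preim (fun q => gC q.-1) (pred1 (gC p))) mu = count_mem p.+1 mu.
  case/andP=> _ mu0; apply: eq_in_count => q qmu /=.
  rewrite (inj_eq gC_inj); case: q qmu => // qmu; by rewrite qmu in mu0.
by rewrite !E.
Qed.

Lemma pmonom_onto (m : {cmonom gvar}) : (forall n, [/\ m (gA n) = 0%N, m (gB n) = 0%N & m (gD n) = 0%N]) ->
  exists2 la, is_partition la & m = pmonom la.
Proof.
move=> m0; have [s sE] : exists s, m = wmon s.
  elim/cmonom_ind: m {m0} => [|i m [s ->]]; first by exists [::].
  by exists (i :: s).
have sC i : i \in s -> exists n, i = gC n.
  rewrite -has_pred1 has_count -wmonE -sE; case: i => [[n|n]|[n|n]]; case: (m0 n) => A B D.
  - by rewrite A.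
  - by rewrite B.
  - by exists n.
  - by rewrite D.
exists (sort geq (map gpart s)).
  rewrite /is_partition sort_sorted; last by move=> x y; exact: leq_total.
  by rewrite mem_sort; apply/mapP => -[i /sC[n ->]].
apply: cmonom_eqP => i; rewrite sE !wmonE.
have /permP -> : perm_eq (map (fun p => gC p.-1) (sort geq (map gpart s)))
    (map (fun p => gC p.-1) (map gpart s)) by apply: perm_map; rewrite perm_sort.
rewrite -map_comp map_id_in // => j /sC[n ->] //.
Qed.

End SingularBases.

Lemma singular_basis_iii (K : numFieldType) (P : polyalg K gvar) (cc dd : K) : cc != 0 ->
  singular_basis (affnw_hwv 0 cc dd)
    (fun la : ne_partition => neg_modes (nw_c K) la *: affnw_hwv 0 cc dd).
Proof.
move=> cc0; pose H := nwrep2 P dd cc0.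
have vE (o : option ne_partition) : (if o is Some la
    then neg_modes (nw_c K) la *: affnw_hwv 0 cc dd else affnw_hwv 0 cc dd)
    = neg_modes (nw_c K) (opt_part o) *: affnw_hwv 0 cc dd.
  by case: o => //=; rewrite /neg_modes big_nil scale1r.
have phiE o : affnw_lift H (neg_modes (nw_c K) (opt_part o) *: affnw_hwv 0 cc dd)
    = 1 *: pmon P (pmonom (opt_part o)).
  rewrite (lift_neg_modes_c H) ?partition_nz ?opt_partP // affnw_lift_hwv mulr1 scale1r.
  elim: (opt_part o) => [|p la IH]; first by rewrite big_nil pmon1.
  by rewrite big_cons IH pvar_mon.
have count0 i la : (forall n, i != gC n) -> pmonom la i = 0%N.
  move=> iC; rewrite wmonE; apply/count_memPn/mapP => -[p _ e].
  by have := iC p.-1; rewrite e eqxx.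
apply: (@monomial_basis _ _ _ _ _ _ _ _ _ H (@triangular2 _ P cc dd) _ _
  (fun=> 1) (fun o => pmonom (opt_part o))).
- by move=> o; rewrite vE phiE.
- by move=> o; rewrite oner_eq0.
- by move=> o o' e; apply/opt_part_inj/pmonom_inj => //; exact: opt_partP.
- move=> o; apply/(affnw_singularP H (@triangular2 _ P cc dd))/(psingular2P _ cc0) => n.
  by rewrite vE phiE scale1r; split; apply: pder_mon0; apply: count0.
- move=> w /(affnw_singularP H (@triangular2 _ P cc dd))/(psingular2P _ cc0) w0 m mw.
  have [|la pla ->] := pmonom_onto (m := m).
    by move=> n; case: (w0 n) => A B D; split; apply: (proj1 (pder_eq0P _ _) _ _ mw).
  have [->|la0] := eqVneq la [::]; first by exists None.
  have nela : is_partition la && (la != [::]) by rewrite pla.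
  by exists (Some (NePartition nela)).
Qed.

(** * Irreducibility *)

Section Reducibility.
Context (K : numFieldType) (P : polyalg K gvar) (ell cc dd : K).
Local Notation V := (affnw_verma ell cc dd).
Local Notation hwv := (affnw_hwv ell cc dd).
Context (oa ob oc od : int -> lend P) (H : nwrep ell cc dd oa ob oc od (1 : P)).
Implicit Types (f g x : P) (u v : V).

Definition stable x (X : lend P) : Prop := forall g, exists g', X (x * g) = x * g'.

Lemma stable_comm x X : mulop x * X = X * mulop x -> stable x X.
Proof.
by move=> xX g; exists (X g); rewrite -[LHS]/((X * mulop x) g) -xX.
Qed.

Lemma stableP x k X Y : stable x X -> stable x Y -> stable x (k *: X + Y).
Proof.
move=> sX sY g; have [g1 e1] := sX g; have [g2 e2] := sY g.
by exists (k *: g1 + g2); rewrite lendDE lendZE e1 e2 mulrDr scalerAr.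
Qed.

Lemma stable0 x : stable x 0.
Proof. by move=> g; exists 0; rewrite lend0E mulr0. Qed.

(** The preimage of the ideal generated by the variable is a submodule. It contains the nonzero [w],
    but not the highest weight vector, since 1 is not a multiple of a variable. *)
Lemma ideal_reducible i : let x := pvar P i in
  (forall k, [/\ stable x (oa k), stable x (ob k), stable x (oc k) & stable x (od k)]) ->
  (exists w, affnw_lift H w = x) -> ~ irreducible_module V.
Proof.
move=> x sx [w wx] [_ irr]; pose W u := exists g, affnw_lift H u = x * g.
have sD X Y : stable x X -> stable x Y -> stable x (X + Y).
  by move=> sX sY; rewrite -[X]scale1r; exact: stableP.
have sZ k X : stable x X -> stable x (k *: X).
  by move=> sX; rewrite -[_ *: _]addr0; apply: stableP => //; exact: stable0.
have snw n y : stable x (nwop oa ob oc od n y).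
  by have [sa sb sc sd] := sx n; exact: sD _ _ (sD _ _ (sD _ _ (sZ _ _ sa) (sZ _ _ sb)) (sZ _ _ sc)) (sZ _ _ sd).
have sW : is_submodule W.
  split=> [|u v [g ug] [h vh]|X u].
  - by exists 0; rewrite linear0 mulr0.
  - by exists (g + h); rewrite linearD /= ug vh mulrDr.
  - elim/env_ind: X u => [k|z|X Y IHX IHY|X Y IHX IHY] u Wu.
    + by have [g ug] := Wu; exists (k *: g); rewrite affnw_lift_const ug scalerAr.
    + have [g ug] := Wu; suff /(_ g)[h e] : stable x (affnw_op ell oa ob oc od z).
        by exists h; rewrite affnw_lift_gen ug.
      rewrite /affnw_op; apply: (sD _ _); last by apply/sZ/stable_comm; rewrite mulr1 mul1r.
      apply: (big_rec (stable x)) => [|n X _ sX]; first exact: stable0.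
      exact: (sD _ _ (snw n _) sX).
    + have [[g ug] [h uh]] := (IHX u Wu, IHY u Wu).
      by exists (g + h); rewrite scalerDl linearD /= ug uh mulrDr.
    + by rewrite -scalerA; apply/IHX/IHY.
have x0 (g : P) : x * g != 1.
  apply/eqP => /(congr1 (pcoef mone)); rewrite pcoef_varM cm1 eqxx pcoef1 eqxx.
  by move/eqP; rewrite eq_sym oner_eq0.
have [|g] := irr W sW _ hwv.
  exists w; first by exists 1; rewrite mulr1.
  apply: contra_eq_neq wx => ->; rewrite linear0 /x /pvar eq_sym.
  apply/eqP => /(congr1 (pcoef (ucm i))); rewrite pcoef_mon pcoef0 eqxx.
  by move/eqP; rewrite oner_eq0.
by rewrite affnw_lift_hwv => /esym/eqP; apply/negP.
Qed.

End Reducibility.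

Section Reducible1.
Context (K : numFieldType) (P : polyalg K gvar) (ell cc dd : K).
Hypothesis ell0 : ell != 0.

(** A variable of nonzero charge is neither a [C_n] nor a [D_n]. Commuting with the two fields, it
    commutes with all modes except [d(0)], whose bracket with it is a multiple of it. *)
Lemma stable1 i : charge i != 0 ->
  (forall k, mulop (pvar P i) * fa P ell cc k = fa P ell cc k * mulop (pvar P i)) ->
  (forall k, mulop (pvar P i) * fb P ell cc k = fb P ell cc k * mulop (pvar P i)) ->
  forall k, [/\ stable (pvar P i) (oa1 P ell cc k), stable (pvar P i) (ob1 P ell cc k),
    stable (pvar P i) (oc1 P ell cc k) & stable (pvar P i) (od1 P ell dd k)].
Proof.
move=> ci xa xb k.
have iC n : gC n != i by apply: contra_neq ci => <-.
have iD n : gD n != i by apply: contra_neq ci => <-.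
have Dx n : pder P (gD n) * mulop (pvar P i) = mulop (pvar P i) * pder P (gD n).
  exact: pder_mul_comm0.
split.
- apply: stable_comm; apply: dress_comm; rewrite ?mulrNN ?mulr1 // => l.
  apply: field_comm_op; [exact: fa_lfield | by move=> j; exact: mulop_comm|].
  by move=> j; rewrite xa.
- apply: stable_comm; apply: dress_comm; rewrite ?mulr1 // => l.
  apply: field_comm_op; [exact: fb_lfield | by move=> j; exact: mulop_comm|].
  by move=> j; rewrite xb.
- apply: stable_comm; case: k => [[|n]|n]; rewrite /oc1.
  + by rewrite -scalerAl -scalerAr mul1r mulr1.
  + by rewrite -scalerAl -scalerAr Dx.
  + exact: mulop_comm.
- case: k => [[|n]|n]; rewrite /od1.
  + apply: stableP; first by apply: stable_comm; rewrite mulr1 mul1r.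
    move=> g; exists (pdiag P charge g + (charge i)%:~R *: g).
    have /(congr1 (fun X : lend P => X g)) := pdiag_var P charge i.
    rewrite lendDE lendNE !lendME lendZE !mulopE => /eqP; rewrite subr_eq => /eqP ->.
    by rewrite addrC mulrDr scalerAr.
  + apply: stable_comm; rewrite -scalerAl -scalerAr; congr (_ *: _).
    exact/esym/pder_mul_comm0.
  + apply: stable_comm; exact: mulop_comm.
Qed.

Lemma reducible_i m : (0 < m)%N -> cc + m%:R * ell = 0 ->
  ~ irreducible_module (affnw_verma ell cc dd).
Proof.
move=> m0 ccm; apply: (ideal_reducible (H := nwrep1 P cc dd ell0) (i := gB m)).
  apply: stable1 => // [[n|n]|k].
  (* At [n = m] the coefficient of [d/dB_m] is 0, and this is the only mode of [fa] that could fail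
     to commute with [B_m]. *)
  - rewrite /fa; have [->|nm] := eqVneq n m.
      by rewrite addrC ccm scale0r mulr0 mul0r.
    rewrite -scalerAl -scalerAr; congr (_ *: _); apply/esym/pder_mul_comm0.
    by rewrite (inj_eq gB_inj).
  - exact: mulop_comm.
  - exact: fb_comm_mul.
have [bE aE] := solution_i_coef ell0 m0 ccm (solution_i_exists ell0 ccm).
case: m m0 ccm bE aE => // m _ _ bE aE.
exists (element_i m.+1 (ecoef ell) (fun nu _ => ecoef ell nu) ^+ 1 *: affnw_hwv ell cc dd).
by rewrite (lift_element_i_exp _ _ _ _ _ bE aE) expr1 scale1r expr1.
Qed.

Lemma reducible_ii m : (0 < m)%N -> cc - m%:R * ell = 0 ->
  ~ irreducible_module (affnw_verma ell cc dd).
Proof.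
move=> m0 ccm; apply: (ideal_reducible (H := nwrep1 P cc dd ell0) (i := gA m.-1)).
  apply: stable1 => // [k|[[|n]|n]].
  - exact: fa_comm_mul.
  - exact: mulop_comm.
  - rewrite /fb; have [nm|nm] := eqVneq n.+1 m.
      by rewrite -opprB nm ccm oppr0 scale0r mulr0 mul0r.
    rewrite -scalerAl -scalerAr; congr (_ *: _); apply/esym/pder_mul_comm0.
    by rewrite (inj_eq gA_inj); apply: contra_neq nm => ->; rewrite prednK.
  - exact: mulop_comm.
have bE := solution_ii_coef ell0 ccm (solution_ii_exists ell0 ccm).
case: m m0 ccm bE => // m _ _ bE.
exists (element_ii m.+1 (fun nu _ => ecoef (- ell) nu) ^+ 1 *: affnw_hwv ell cc dd).
by rewrite (lift_element_ii_exp _ _ _ _ _ bE) expr1 scale1r expr1.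
Qed.

End Reducible1.

(** At level zero the modes of [c] commute with all the others, so multiplication by [C_0], which is
    [c(-1)], is an endomorphism; its image is the submodule. *)
Lemma reducible_iii (K : numFieldType) (P : polyalg K gvar) (cc dd : K) : cc != 0 ->
  ~ irreducible_module (affnw_verma 0 cc dd).
Proof.
move=> cc0; pose H := nwrep2 P dd cc0.
apply: (ideal_reducible (H := H) (i := gC 0)) => [k|].
  split; apply: stable_comm; have -> : mulop (pvar P (gC 0)) = oc2 P cc (Negz 0) by [].
  - exact: (nwrep_ca H).
  - exact: (nwrep_cb H).
  - exact: (nwrep_cc H).
  - apply/eqP; rewrite -subr_eq0 (nwrep_cd H); case: ifP => _; rewrite ?mulr0 scale0r //.
exists (neg_mode (nw_c K) 1 *: affnw_hwv 0 cc dd).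
rewrite lift_neg_mode nwop_basis affnw_lift_hwv; exact: mulr1.
Qed.

(** * Irreducibility away from the resonances *)

Section Irreducible.
Context (K : numFieldType) (P : polyalg K gvar) (ell cc dd : K).
Hypotheses (ell0 : ell != 0) (cc_ell : ~ exists n : int, cc = ell * n%:~R).
Local Notation V := (affnw_verma ell cc dd).
Local Notation hwv := (affnw_hwv ell cc dd).
Local Notation oa := (oa1 P ell cc).
Local Notation ob := (ob1 P ell cc).
Local Notation oc := (oc1 P ell cc).
Local Notation od := (od1 P ell dd).
Local Notation phi := (affnw_lift (nwrep1 P cc dd ell0) : V -> P).
Implicit Types (f g : P) (u v w : V).

Lemma last_pder (v : nat -> gvar) f : injective v -> (exists n, pder P (v n) f != 0) ->
  exists2 k, pder P (v k) f != 0 & forall n, (k < n)%N -> pder P (v n) f = 0.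
Proof.
move=> v_inj ex; have [N NF] := pder_locfin f v_inj.
have bd n : pder P (v n) f != 0 -> (n <= N)%N.
  by apply: contra_neqT; rewrite -ltnNge => /ltnW; exact: NF.
have [k kf kmax] := ex_maxnP ex bd; exists k => // n kn; apply/eqP.
by apply: contraTT kn => /kmax; rewrite -leqNgt.
Qed.

Lemma coefA_neq0 (n : nat) : n%:R * ell + cc != 0.
Proof.
apply/eqP => e; apply: cc_ell; exists (- n%:Z); apply/eqP.
by rewrite rmorphN mulrN -addr_eq0 addrC mulrC e.
Qed.

Lemma coefB_neq0 (n : nat) : n%:R * ell - cc != 0.
Proof.
apply/eqP => e; apply: cc_ell; exists n%:Z; apply/eqP.
by rewrite eq_sym -subr_eq0 mulrC e.
Qed.

(* Only after all derivatives in the [d]- and [c]-variables vanish, and for the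
   last variable actually occurring, do the fields reduce to one derivative. *)
Lemma lowering f : (exists i, pder P i f != 0) ->
  exists n y k i, [/\ k != 0, pder P i f != 0 & nwop oa ob oc od n y f = k *: pder P i f].
Proof.
move=> ex; have nl n : (n.+1%:R * ell : K) != 0 by rewrite mulf_neq0 // pnatr_eq0.
have [[n nf]|noD] := pselect (exists n, pder P (gD n) f != 0).
  by exists n.+1, (nw_c K), (n.+1%:R * ell), (gD n); rewrite nwop_basis.
have df : dfree f by move=> n; apply/eqP; apply: contrapT => /negP h; apply: noD; exists n.
have [[n nf]|noC] := pselect (exists n, pder P (gC n) f != 0).
  by exists n.+1, (nw_d K), (n.+1%:R * ell), (gC n); rewrite nwop_basis.
have [exB|noB] := pselect (exists n, pder P (gB n) f != 0).
  have [k kf kmax] := last_pder gB_inj exB.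
  exists k, (nw_a K), (k%:R * ell + cc), (gB k); rewrite coefA_neq0; split=> //.
  rewrite nwop_basis /oa1 dress_dfree ?mulrNN ?mulr1 // /na (@fieldE _ _ _ 1%N).
  - by rewrite big_ord1 addr0 mul1r.
  - exact: fa_lfield.
  - by move=> i i0; rewrite -PoszD /fa lendZE kmax ?scaler0 // -addn1 leq_add2l.
have [exA|noA] := pselect (exists n, pder P (gA n) f != 0).
  have [k kf kmax] := last_pder gA_inj exA.
  exists k.+1, (nw_b K), (k.+1%:R * ell - cc), (gA k); rewrite coefB_neq0; split=> //.
  rewrite nwop_basis /ob1 dress_dfree ?mulr1 // /nb (@fieldE _ _ _ 1%N).
  - by rewrite big_ord1 addr0 mul1r.
  - exact: fb_lfield.
  - by move=> i i0; rewrite -PoszD /fb lendZE kmax ?scaler0 // -addn1 leq_add2l.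
by case: ex => [[[n|n]|[n|n]]] nf; [case: noA | case: noB | case: noC | case: noD]; exists n.
Qed.

Lemma pder_all0 f : (forall i, pder P i f = 0) -> f = pcoef mone f *: 1.
Proof.
move=> f0; apply: polyP => m; rewrite pcoefZ pcoef1.
have [->|m1] := eqVneq m mone; first by rewrite mulr1.
rewrite mulr0; apply/eqP; apply: contraNT m1 => mf; apply/eqP/cmonom_eqP => i.
by rewrite cm1 (proj1 (pder_eq0P _ _) (f0 i) _ mf).
Qed.

(** Induction on a degree bound: [lowering] decreases the degree without killing the vector, until a
    nonzero constant remains, which is a multiple of the image of the highest weight vector. *)
Lemma submodule_hwv (W : V -> Prop) d w : is_submodule W -> W w -> phi w != 0 ->
  psupported (fun m => (mdeg m < d)%N) (phi w) -> W hwv.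
Proof.
move=> [W0 WD WZ]; elim: d w => [|d IH] w Ww w0 dw.
  case/negP: w0; apply/eqP/polyP => m; rewrite pcoef0; apply/eqP/negPn/negP.
  by move=> /dw.
have [/lowering[n [y [k [i [k0 iw e]]]]]|nf] := pselect (exists i, pder P i (phi w) != 0).
  apply: (IH (env_gen (affnw_mode y n) *: w)); first exact: WZ.
    by rewrite affnw_lift_mode e scaler_eq0 negb_or k0.
  rewrite affnw_lift_mode e -[_ *: _]addr0; apply: psupportedP; last exact: psupported0.
  by apply: psupported_der dw => m; rewrite mdegM mdegU.
have f0 i : pder P i (phi w) = 0.
  by apply/eqP; apply: contrapT => /negP h; apply: nf; exists i.
have e := pder_all0 f0; set k := pcoef _ _ in e.
have k0 : k != 0 by apply: contraNneq w0 => k0; rewrite e k0 scale0r.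
have -> : hwv = (k^-1)%:A *: w; last exact: WZ.
apply: (affnw_lift_inj (@triangular1 _ P ell cc dd) (H := nwrep1 P cc dd ell0)).
by rewrite affnw_lift_hwv affnw_lift_const [X in _ *: X]e scalerA mulVf // scale1r.
Qed.

Lemma irreducible_verma : irreducible_module V.
Proof.
split.
  exists hwv; apply/eqP => /(congr1 phi); rewrite affnw_lift_hwv linear0 => /eqP.
  by rewrite oner_eq0.
move=> W sW [w Ww w0] v; have [X ->] := verma_cyclic v.
have [_ _ WZ] := sW; apply: WZ.
apply: (@submodule_hwv W (\max_(m <- psupp (phi w)) mdeg m).+1 w) => // [|m mf].
  apply: contra_neq w0 => w0.
  apply: (affnw_lift_inj (@triangular1 _ P ell cc dd) (H := nwrep1 P cc dd ell0)).
  by rewrite w0 linear0.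
by rewrite ltnS leq_bigmax_seq // mem_psupp.
Qed.

End Irreducible.

Lemma irreducible_vermaP (K : numFieldType) (ell cc dd : K) : cc != 0 ->
  irreducible_module (affnw_verma ell cc dd) <->
  ell != 0 /\ ~ (exists n : int, cc = ell * n%:~R).
Proof.
move=> cc0; pose P := polyalg_exists K gvar; split=> [irr|[ell0 cc_ell]]; last first.
  exact: (irreducible_verma P).
have ell0 : ell != 0.
  by apply: contraPneq irr => ->; exact: (reducible_iii P).
(* The integer 0 would give [cc = 0]; positive integers are the resonances of (ii) and negative ones
   those of (i). *)
split=> // -[[[|n]|n] e].
- by rewrite e mulr0 eqxx in cc0.
- by apply: (reducible_ii P ell0 (m := n.+1)) irr => //; rewrite e mulrC subrr.
- apply: (reducible_i P ell0 (m := n.+1)) irr => //.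
  by rewrite e NegzE rmorphN mulrN mulrC addNr.
Qed.

Theorem theorem3p3 (R : realType) (ell cc dd : R[i]) (hcc : cc != 0) :
  (irreducible_module (affnw_verma ell cc dd) <->
     ell != 0 /\ ~ (exists n : int, cc = ell * n%:~R))
  /\
  (forall m : nat, (0 < m)%N -> ell != 0 -> cc + m%:R * ell = 0 ->
     (exists (a : seq nat -> R[i]) (b : seq nat -> nat -> R[i]),
        solution_i ell cc m a b /\ nonzero_i m a b)
     /\
     (forall (a : seq nat -> R[i]) (b : seq nat -> nat -> R[i]),
        solution_i ell cc m a b -> nonzero_i m a b ->
        singular_basis (affnw_hwv ell cc dd)
          (fun k : nat => element_i m a b ^+ k.+1 *: affnw_hwv ell cc dd)))
  /\
  (forall m : nat, (0 < m)%N -> ell != 0 -> cc - m%:R * ell = 0 ->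
     (exists c : seq nat -> nat -> R[i],
        solution_ii ell cc m c /\ pair_nonzero m c)
     /\
     (forall c : seq nat -> nat -> R[i],
        solution_ii ell cc m c -> pair_nonzero m c ->
        singular_basis (affnw_hwv ell cc dd)
          (fun k : nat => element_ii m c ^+ k.+1 *: affnw_hwv ell cc dd)))
  /\
  (ell = 0 ->
     singular_basis (affnw_hwv ell cc dd)
       (fun la : ne_partition =>
          neg_modes (nw_c R[i]) la *: affnw_hwv ell cc dd)).
Proof.
pose P := polyalg_exists R[i] gvar.
split; [exact: irreducible_vermaP | split; [|split]].
- move=> m m0 ell0 ccm; split; last by move=> a b; exact: (singular_basis_i P).
  exists (ecoef ell), (fun nu _ => ecoef ell nu); split; first exact: solution_i_exists.
  (* The nonzero entry is at the empty partition, where [ecoef] is 1. *)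
  by right; exact: pair_nonzero_ecoef.
- move=> m m0 ell0 ccm; split; last by move=> c; exact: (singular_basis_ii P).
  exists (fun nu _ => ecoef (- ell) nu); split; first exact: solution_ii_exists.
  exact: pair_nonzero_ecoef.
- by move=> ->; exact: (singular_basis_iii P).
Qed.
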